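(* Let $G_0$ be a plane graph and let $v_1v_2\cdots v_{2n-1}$ ($n\ge1$) be a path lying on the boundary of the unbounded face of $G_0$, such that $v_2,v_4,\dots,v_{2n-2}$ have degree two in $G_0$. Let $G$ be obtained from $G_0$ by adding a new leaf $v_0$ adjacent to $v_1$ and a new leaf $v_{2n}$ adjacent to $v_{2n-1}$, both drawn in the unbounded face. For $j=1,\dots,2n$ let $m_j$ be the edge-vertex of $H_G$ corresponding to the edge $v_{j-1}v_j$, and let $K=H_G\setminus\{v_0,v_2,\dots,v_{2n}\}$. Let $\overline{G}$ be the graph obtained by taking two disjoint copies of $K$ and identifying, for each $j=1,\dots,2n$, the copy of $m_j$ in the first copy with the copy of $m_j$ in the second copy (equivalently: draw $K$ so that $m_1,\dots,m_{2n}$ lie on a horizontal line $\ell$, the rest of $K$ lies above $\ell$ and no edge lies along $\ell$, and let $\overline{G}$ be the union of $K$ with its mirror image across $\ell$). Then $\operatorname{M}(\overline{G})$ is either a perfect square or twice a perfect square.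
   Context: All graphs have no loops and no multiple edges; the plane graph $G$ is assumed to have no vertex of degree one inside any bounded face. For a plane graph $G$, its dual refinement $H_G$ is the graph whose vertices are: the vertices of $G$ (original vertices), one vertex for each bounded face of $G$ (face-vertices), and one vertex at the midpoint of each edge of $G$ (edge-vertices). For each edge $e$ of $G$, the edge-vertex of $e$ is joined to the two endpoints of $e$ and to the face-vertex of each bounded face of $G$ whose boundary contains $e$; these are all the edges of $H_G$. Removing a vertex also removes its incident edges. $\operatorname{M}(K)$ denotes the number of perfect matchings of $K$. *)

(* Defs.v *)
From mathcomp Require Import all_boot.

Set Implicit Arguments.
Unset Strict Implicit.
Unset Printing Implicit Defensive.

(** * Subgraphs of a relation and perfect matchings *)

(** The graph with vertex set [A] and adjacency [e] (restricted to [A]). *)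
Definition edges (T : finType) (A : {set T}) (e : rel T) : {set {set T}} :=
  [set [set x; y] | x in A, y in A & e x y].

Definition perfect_matching (T : finType) (A : {set T}) (e : rel T)
    (P : {set {set T}}) : bool :=
  (P \subset edges A e) && [forall x in A, #|[set d in P | x \in d]| == 1].

Definition num_pm (T : finType) (A : {set T}) (e : rel T) : nat :=
  #|[set P | perfect_matching A e P]|.

(** * Plane graphs

    A plane graph is given, up to orientation-preserving homeomorphism of the
    plane, by its combinatorial data: vertices [V], faces [F] and
    - [rot u v]: the neighbour of [u] following [v] clockwise around [u];
    - [lface u v]: the face on the left of the edge [uv] traversed from [u]
      to [v];
    - [iface u]: the face containing [u], meaningful only if [u] is isolated.
    The graph need not be connected, so a face may have several boundary
    walks. *)
Record drawing (V F : finType) := Drawing {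
  adj : rel V;
  rot : V -> V -> V;
  lface : V -> V -> F;
  iface : V -> F;
  outer : F
}.

Section PlaneGraph.
Variables (V F : finType) (G : drawing V F).

Definition degree (u : V) : nat := #|[set v | adj G u v]|.

Definition vertex_on (f : F) (u : V) : bool :=
  [exists v, adj G u v && (lface G u v == f)]
  || ((degree u == 0) && (iface G u == f)).

Definition edge_on (f : F) (e : {set V}) : bool :=
  [exists u, exists v,
     [&& adj G u v, e == [set u; v] & lface G u v == f]].

Definition vertex_face_rel : rel (V + F) := fun x y =>
  match x, y with
  | inl u, inl v => adj G u v
  | inl u, inr f | inr f, inl u => vertex_on f u
  | inr _, inr _ => false
  end.

(** [plane_rot_closed] and [plane_rot_trans] say that [rot u] permutes the
    neighbours of [u] in a single cycle.  By [plane_face], [lface] is constant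
    along the boundary walks obtained from [rot].

    For the last two fields, let [c] be the number of components, [g] the sum
    of the genera of the rotation systems of the components, and [b] the number
    of boundary walks (an isolated vertex counting for one), so that
    [V - E + b = 2c - 2g].  The multigraph joining, for each boundary walk, its
    component to its face is connected by [plane_conn], hence has cycle rank
    [r = b - c - F + 1 >= 0], and [V - E + F = 1 + c - 2g - r].
    So [plane_euler] says exactly that [g = 0] and [r = 0]: every component is
    drawn on a sphere, and the components are placed in each other's faces
    in a tree-like fashion. *)
Record plane_graph : Prop := PlaneGraph {
  plane_sym : symmetric (adj G);
  plane_irr : irreflexive (adj G);
  plane_rot_closed : forall u v, adj G u v -> adj G u (rot G u v);
  plane_rot_trans :
    forall u v w, adj G u v -> adj G u w -> fconnect (rot G u) v w;
  plane_face :
    forall u v, adj G u v -> lface G v (rot G v u) = lface G u v;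
  plane_conn : forall x y, connect vertex_face_rel x y;
  plane_euler :
    #|V| + #|F| = #|edges [set: V] (adj G)| + 1 + n_comp (adj G) predT
}.

Definition no_inner_leaf : Prop :=
  forall u f, degree u = 1 -> vertex_on f u -> f = outer G.

(** * The dual refinement

    Its vertices lie in [V + F + {set V}]: original vertices, face-vertices and
    edge-vertices (an edge being the set of its endpoints). *)

Definition dr_vertex : finType := (V + F + {set V})%type.
Definition orig (u : V) : dr_vertex := inl (inl u).
Definition face_vertex (f : F) : dr_vertex := inl (inr f).
Definition edge_vertex (e : {set V}) : dr_vertex := inr e.

Definition dr_verts : {set dr_vertex} :=
  [set orig u | u : V]
  :|: [set face_vertex f | f : F & f != outer G]
  :|: [set edge_vertex e | e in edges [set: V] (adj G)].

Definition dr_inc (e : {set V}) (x : dr_vertex) : bool :=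
  match x with
  | inl (inl u) => u \in e
  | inl (inr f) => (f != outer G) && edge_on f e
  | inr _ => false
  end.

Definition dr_adj : rel dr_vertex := fun x y =>
  match x, y with
  | inr e, inl _ => dr_inc e y
  | inl _, inr e => dr_inc e x
  | _, _ => false
  end.

End PlaneGraph.

(** * Adding two leaves in the unbounded face

    [G] is [G0] together with a leaf [inr false] at [a] and a leaf [inr true]
    at [b].  The faces keep their names; [aol_rot] says that deleting the new
    leaves from the rotations of [G] gives those of [G0]. *)
Record add_outer_leaves (V F : finType) (G0 : drawing V F) (a b : V)
    (G : drawing (V + bool)%type F) : Prop := AddOuterLeaves {
  aol_adj : forall u v, adj G (inl u) (inl v) = adj G0 u v;
  aol_adjl : forall x, adj G (inr false) x = (x == inl a);
  aol_adjr : forall x, adj G (inr true) x = (x == inl b);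
  aol_outer : outer G = outer G0;
  aol_lface :
    forall u v, adj G0 u v -> lface G (inl u) (inl v) = lface G0 u v;
  aol_iface :
    forall u, degree G (inl u) = 0 -> iface G (inl u) = iface G0 u;
  aol_leaf : forall s, vertex_on G (outer G0) (inr s);
  aol_rot : forall u v, adj G0 u v ->
    exists k, iter k.+1 (rot G (inl u)) (inl v) = inl (rot G0 u v)
      /\ forall j, 0 < j <= k ->
           exists s, iter j (rot G (inl u)) (inl v) = inr s
}.

(** The sequence v_0, v_1, ..., v_{2n}, where only the values of [v] at
    1, ..., 2n-1 matter. *)
Definition ext_path (V : finType) (n : nat) (v : nat -> V) (j : nat) :
    V + bool :=
  if j == 0 then inr false else if j == n.*2 then inr true else inl (v j).

(** * Gluing two copies of a graph along a set [M] of vertices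

    The two copies of a vertex of [M] are both represented by the first one. *)
Section Double.
Variables (T : finType) (A : {set T}) (e : rel T) (M : {set T}).

Definition glue (p : T * bool) : T * bool :=
  if p.1 \in M then (p.1, false) else p.

Definition double_verts : {set T * bool} :=
  [set glue p | p in setX A [set: bool]].

Definition double_adj : rel (T * bool) := fun p q =>
  [exists x in A, exists y in A, exists s : bool,
     [&& e x y, p == glue (x, s) & q == glue (y, s)]].

End Double.

(** The graph K with its vertices m_1, ..., m_{2n}; [w] is the sequence
    v_0, ..., v_{2n}. *)
Section Kgraph.
Variables (V F : finType) (G : drawing V F) (n : nat) (w : nat -> V).

Definition K_verts : {set dr_vertex V F} :=
  dr_verts G :\: [set orig F (w i.*2) | i : 'I_n.+1].

Definition m_verts : {set dr_vertex V F} :=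
  [set edge_vertex F [set w j; w j.+1] | j : 'I_n.*2].

End Kgraph.

(* Main.v *)
(** The double graph is bipartite, with the edge-vertices on one side.  Orient the
    edges of [G], forward along the path, and give the incidences of the edge-vertex
    of [e] the signs of the boundary (vertices) and of the coboundary (faces) of [e],
    those of m_j in the second copy being multiplied by (-1)^j.  Call primal the
    vertices of the first copy and the faces of the second one, dual the others: in
    the resulting matrix [N] the primal columns are orthogonal to the dual ones, and
    each of the two families is independent.  Let a perfect matching permute the rows
    of [N] so that its terms come on the diagonal, and make them equal to 1.  By
    planarity, no cycle of primal columns leads from each column to another one met by
    its matched row.  With orthogonality, this makes the determinant positive.  So all
    matchings contribute to [det N] with the same sign, and their number is |det N|.

    Adding the two copies and subtracting them gives det N = 2^n det X det Y, where
    [X] (resp. [Y]) is the matrix of [K] without the m_j with [j] even (resp. odd).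
    As [det X ^ 2 = det Y ^ 2], the number of perfect matchings is 2^n (det X)^2.
    If [G] is not connected, the two sides have different sizes. *)

From mathcomp Require Import all_boot all_order all_fingroup all_algebra ring lra zify realalg.
Require Import Defs.

Set Implicit Arguments.
Unset Strict Implicit.
Unset Printing Implicit Defensive.

Import Order.TTheory GRing.Theory Num.Theory.
Local Open Scope ring_scope.

(** * Linear algebra *)

(** Orthogonality replaces topology. Closed chains are boundaries because two orthogonal independent
    families together have, by Euler's formula, as many members as there are rows; no Jordan curve
    is drawn. A cycle of primal columns carries a vector orthogonal to all primal columns, hence a
    combination of dual ones, and the support of its coefficients plays the part of the interior.
    The matching pairs the rows inside with the columns inside, so this block is square; the
    coefficients are in its kernel, and a vector of its left kernel has zero energy. Two obstacles
    shape this argument. An edge with one face on both sides is adjacent to it but has entry zero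
    there, so such matched pairs must be excluded. And the relation around a cycle needs signs on
    the faces that agree across edges and are opposite on the two sides of the path. Positivity
    comes from deforming the normalised matrix to the identity without a zero of the determinant.
    For the two minors, the incidence matrix of all edges is bordered by [n] alternating chains
    along the path. These may start at either end, and transposing exchanges the resulting
    determinants. *)

Section FiniteLinearAlgebra.
Variable K : fieldType.

Lemma extend_enum_val (I : finType) (A : {set I}) (v : 'I_#|A| -> K) :
  exists y : I -> K, forall k, y (enum_val k) = v k.
Proof.
exists (fun i => if [pick k | enum_val k == i] is Some k then v k else 0) => k.
by case: pickP => [l /eqP /enum_val_inj -> // | /(_ k)]; rewrite eqxx.
Qed.

Lemma exists_left_kernel (I J : finType) (A : {set I}) (B : {set J})
    (M : I -> J -> K) :
  (#|B| < #|A|)%N ->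
  exists y : I -> K, (exists2 i, i \in A & y i != 0) /\
    forall j, j \in B -> \sum_(i in A) y i * M i j = 0.
Proof.
move=> ltBA; pose X := \matrix_(i < #|A|, j < #|B|) M (enum_val i) (enum_val j).
have: kermx X != 0.
  rewrite kermx_eq0 /row_free neq_ltn; apply/orP; left.
  exact: leq_ltn_trans (rank_leq_col X) ltBA.
case/rowV0Pn => v /sub_kermxP vX0 /rV0Pn [k vk].
have [y yE] := extend_enum_val (fun k => v 0 k); exists y; split.
  by exists (enum_val k); rewrite ?enum_valP ?yE.
move=> j jB; rewrite big_enum_val /=.
move/matrixP/(_ 0 (enum_rank_in jB j)): vX0; rewrite !mxE; apply: etrans.
by apply: eq_bigr => i _; rewrite yE !mxE enum_rankK_in.
Qed.

(** A column with a non-zero coefficient in [x] is a combination of the others, so whatever kills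
    the others, which are fewer than the rows, kills it too. *)
Lemma singular_left_kernel (I J : finType) (A : {set I}) (B : {set J})
    (M : I -> J -> K) (x : J -> K) :
  (#|B| <= #|A|)%N -> (exists2 j, j \in B & x j != 0) ->
  (forall i, i \in A -> \sum_(j in B) M i j * x j = 0) ->
  exists y : I -> K, (exists2 i, i \in A & y i != 0) /\
    forall j, j \in B -> \sum_(i in A) y i * M i j = 0.
Proof.
move=> leBA [j0 j0B xj0] Mx0.
have: (#|B :\ j0| < #|A|)%N by rewrite (cardsD1 j0 B) j0B in leBA.
case/(exists_left_kernel M) => y [y0 yM]; exists y; split=> // j jB.
have [-> | nj] := eqVneq j j0; last by apply: yM; rewrite !inE nj.
apply/eqP; rewrite -(mulIr_eq0 _ (mulIf xj0)) mulr_suml.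
have: \sum_(i in A) y i * \sum_(j in B) M i j * x j = 0.
  by apply: big1 => i iA; rewrite Mx0 ?mulr0.
under eq_bigr do rewrite (bigD1 j0) //= mulrDr mulr_sumr.
rewrite big_split /= exchange_big /= [X in _ + X]big1 ?addr0 => [e | k /andP[kB nk]].
  by apply/eqP; rewrite -[RHS]e; apply: eq_bigr => i _; rewrite mulrA.
under eq_bigr do rewrite mulrA; rewrite -mulr_suml yM ?mul0r //.
by rewrite !inE nk.
Qed.

Lemma injective_surjective (I J : finType) (A : {set I}) (B : {set J})
    (M : I -> J -> K) :
  #|A| = #|B| ->
  (forall x : J -> K, (forall i, i \in A -> \sum_(j in B) M i j * x j = 0) ->
     forall j, j \in B -> x j = 0) ->
  forall y : I -> K, exists x : J -> K,
    forall i, i \in A -> y i = \sum_(j in B) M i j * x j.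
Proof.
move=> eqAB inj y.
pose X := \matrix_(j < #|B|, i < #|A|) M (enum_val i) (enum_val j).
have freeX : row_free X.
  rewrite -kermx_eq0; apply/rowV0P => v /sub_kermxP vX0.
  have [x xE] := extend_enum_val (fun k => v 0 k).
  apply/rowP => k; rewrite mxE -xE; apply: inj (enum_valP k) => i iA.
  move/matrixP/(_ 0 (enum_rank_in iA i)): vX0; rewrite !mxE; apply: etrans.
  rewrite big_enum_val; apply: eq_bigr => j _.
  by rewrite xE !mxE enum_rankK_in // mulrC.
have fullX : row_full X by rewrite /row_full (eqP freeX) eqAB.
pose yr := \row_i y (enum_val i) : 'rV_#|A|.
have /submxP [v vE] : (yr <= X)%MS by apply: submx_full.
have [x xE] := extend_enum_val (fun k => v 0 k); exists x => i iA.
have /rowP/(_ (enum_rank_in iA i)) := vE; rewrite !mxE enum_rankK_in // => ->.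
rewrite [RHS]big_enum_val; apply: eq_bigr => j _.
by rewrite xE !mxE enum_rankK_in // mulrC.
Qed.

End FiniteLinearAlgebra.

Section Orthogonal.
Variable R : realFieldType.

Lemma sum_sqr_eq0 (I : finType) (A : {set I}) (y : I -> R) :
  \sum_(i in A) y i * y i = 0 -> forall i, i \in A -> y i = 0.
Proof.
move=> /eqP; rewrite psumr_eq0 => [/allP y0 i iA | i _]; last by rewrite -expr2 sqr_ge0.
by have := y0 i (mem_index_enum i); rewrite iA /= mulf_eq0 orbb => /eqP.
Qed.

(** The two families together form an injective square system, so [y] is a combination of both; its
    [B2]-part is orthogonal to itself. With Euler's formula as the cardinality hypothesis, this is
    the source of all exactness statements below. *)
Lemma orthogonal_exact (I J1 J2 : finType) (A : {set I}) (B1 : {set J1})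
    (B2 : {set J2}) (M1 : I -> J1 -> R) (M2 : I -> J2 -> R) :
  #|A| = (#|B1| + #|B2|)%N ->
  (forall j k, j \in B1 -> k \in B2 -> \sum_(i in A) M1 i j * M2 i k = 0) ->
  (forall x, (forall i, i \in A -> \sum_(j in B1) M1 i j * x j = 0) ->
     forall j, j \in B1 -> x j = 0) ->
  (forall x, (forall i, i \in A -> \sum_(j in B2) M2 i j * x j = 0) ->
     forall j, j \in B2 -> x j = 0) ->
  forall y : I -> R,
  (forall k, k \in B2 -> \sum_(i in A) y i * M2 i k = 0) ->
  exists b : J1 -> R, forall i, i \in A -> y i = \sum_(j in B1) M1 i j * b j.
Proof.
move=> cardA orth inj1 inj2 y yB2.
pose B := [set s : J1 + J2 | match s with inl j => j \in B1 | inr k => k \in B2 end].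
pose M i s := match s with inl j => M1 i j | inr k => M2 i k end.
have sumB (F : J1 + J2 -> R) : \sum_(s in B) F s =
    \sum_(j in B1) F (inl j) + \sum_(k in B2) F (inr k).
  by rewrite big_sumType /=; congr (_ + _); apply: eq_bigl => s; rewrite inE.
have cardB : #|A| = #|B|.
  rewrite cardA -!sum1_card big_sumType /=.
  by congr (_ + _)%N; apply: eq_bigl => s; rewrite inE.
(* the squared norm of the B2-component of a vector orthogonal to B2 vanishes *)
have nul2 (z : I -> R) (c1 : J1 -> R) (c2 : J2 -> R) :
  (forall i, i \in A -> z i = \sum_(j in B1) M1 i j * c1 j + \sum_(k in B2) M2 i k * c2 k) ->
  (forall k, k \in B2 -> \sum_(i in A) z i * M2 i k = 0) ->
  forall i, i \in A -> \sum_(k in B2) M2 i k * c2 k = 0.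
  move=> zE zB2; apply: (@sum_sqr_eq0 _ A (fun i => \sum_(k in B2) M2 i k * c2 k)).
  have h : \sum_(i in A) z i * (\sum_(k in B2) M2 i k * c2 k) = 0.
    under eq_bigr do rewrite mulr_sumr; rewrite exchange_big /=; apply: big1 => k kB.
    under eq_bigr do rewrite mulrA; by rewrite -mulr_suml zB2 ?mul0r.
  have h2 : \sum_(i in A) (\sum_(j in B1) M1 i j * c1 j) * (\sum_(k in B2) M2 i k * c2 k) = 0.
    under eq_bigr do rewrite mulr_sumr; rewrite exchange_big /=; apply: big1 => k kB.
    under eq_bigr do rewrite mulr_suml; rewrite exchange_big /=; apply: big1 => j jB.
    have := orth j k jB kB; move/(congr1 ( *%R^~ (c1 j * c2 k))); rewrite mul0r mulr_suml; apply: etrans.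
    by apply: eq_bigr => i _; rewrite -!mulrA; congr (_ * _); rewrite mulrCA.
  apply: etrans (etrans (congr2 (fun a b : R => a - b) h h2) (subrr 0)).
  rewrite /= -sumrB; apply: eq_bigr => i iA.
  by rewrite -mulrBl zE // addrC addKr.
have inj : forall x : J1 + J2 -> R,
    (forall i, i \in A -> \sum_(j in B) M i j * x j = 0) -> forall j, j \in B -> x j = 0.
  move=> x x0.
  have x0' i : i \in A -> 0 = \sum_(j in B1) M1 i j * x (inl j) +
      \sum_(k in B2) M2 i k * x (inr k) by move/x0; rewrite sumB.
  have x2 := @nul2 (fun=> 0) (fun j => x (inl j)) (fun k => x (inr k)) x0'.
  have {}x2 i : i \in A -> \sum_(k in B2) M2 i k * x (inr k) = 0.
    by apply: x2 => k _; apply: big1 => l _; rewrite mul0r.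
  case=> j; rewrite inE => jB.
    apply: (inj1 (fun j => x (inl j))) jB => i iA.
    by have := x0' i iA; rewrite x2 // addr0.
  by apply: (inj2 (fun j => x (inr j))) jB.
have [x xE] := injective_surjective cardB inj y.
have xE' i : i \in A -> y i = \sum_(j in B1) M1 i j * x (inl j) +
      \sum_(k in B2) M2 i k * x (inr k) by move/xE; rewrite sumB.
exists (fun j => x (inl j)) => i iA.
by rewrite [LHS]xE' // (nul2 y _ _ xE' yB2) // addr0.
Qed.

End Orthogonal.

(** * Positivity of determinants by deformation *)

Section PositiveDeterminant.
Variable R : rcfType.

Lemma det_neq0P m (M : 'M[R]_m) :
  (forall x : 'I_m -> R, (forall i, \sum_j M i j * x j = 0) -> forall j, x j = 0) <->
  \det M != 0.
Proof.
split=> [inj | nz x Mx0 j].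
  rewrite -det_tr; apply/negP => /det0P [v v0 vM]; case/negP: v0; apply/eqP.
  apply/rowP => k; rewrite mxE; apply: inj => i.
  have /rowP/(_ i) := vM; rewrite !mxE; apply: etrans; apply: eq_bigr => l _.
  by rewrite mxE mulrC.
pose v := \row_k x k; have vM : v *m M^T = 0.
  apply/rowP => i; rewrite !mxE -[RHS](Mx0 i); apply: eq_bigr => l _.
  by rewrite !mxE mulrC.
have /rowP/(_ j) : v = 0; last by rewrite !mxE.
apply/eqP; apply: contraNT nz => v0; rewrite -det_tr; apply/det0P.
by exists v.
Qed.

(** The determinant is a polynomial in [t]; without a root on the unit interval it keeps its sign.
    The intermediate value theorem is why the field is real closed. *)
Lemma det_path m (M0 M1 : 'M[R]_m) :
  (forall t, 0 <= t <= 1 -> \det (M0 + t *: M1) != 0) ->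
  0 < \det M0 -> 0 < \det (M0 + M1).
Proof.
move=> nz M0_gt0.
pose p := \det (map_mx polyC M0 + 'X *: map_mx polyC M1).
have pE t : p.[t] = \det (M0 + t *: M1).
  rewrite -horner_evalE -det_map_mx; congr (\det _); apply/matrixP => i j.
  by rewrite !mxE /= horner_evalE !hornerE.
rewrite ltNge; apply/negP => le0.
have [||t t01 /rootP rt] := @poly_ivt _ (- p) 0 1; first exact: ler01.
  by rewrite !hornerN !pE scale0r addr0 scale1r oppr_le0 oppr_ge0 (ltW M0_gt0).
by have := nz t t01; rewrite -pE -[p.[t]]opprK -hornerN rt oppr0 eqxx.
Qed.

Variables (m : nat) (P : 'M[R]_m) (V : pred 'I_m).
Hypothesis P_diag : forall i, P i i = 1.
Hypothesis P_orth : forall i j, V i != V j -> \sum_k P k i * P k j = 0.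
Hypothesis P_row : forall i,
  \sum_(j | (j != i) && (V j == V i)) `|P i j| <= 1.
Hypothesis P_injV : forall x : 'I_m -> R, (forall i, ~~ V i -> x i = 0) ->
  (forall i, V i -> \sum_j P i j * x j = 0) -> forall j, x j = 0.
Hypothesis P_det : \det P != 0.

Let inside := \matrix_(i, j) (if V i == V j then P i j else 0).
Let across := \matrix_(i, j) (if V i == V j then 0 else P i j).

(** The image [r] of [x] lives on the rows in [V] and is orthogonal to the columns in [V]. The block
    on [V] is nonsingular, hence so is its transpose, and [r] is zero. *)
Let P_injF (x : 'I_m -> R) : (forall i, V i -> x i = 0) ->
  (forall i, ~~ V i -> \sum_j P i j * x j = 0) -> forall j, x j = 0.
Proof.
move=> xV PxF; pose r i := \sum_j P i j * x j.
have rF i : ~~ V i -> r i = 0 by exact: PxF.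
(* The block on [V], padded with the identity to keep the full size. *)
pose PV := \matrix_(i, j) (if V i && V j then P i j else (i == j)%:R).
have PV_det : \det PV != 0.
  apply/det_neq0P => y PVy.
  have yF i : ~~ V i -> y i = 0.
    move=> Vi; have := PVy i; rewrite (bigD1 i) //= big1 ?addr0 => [|j ji].
      by rewrite mxE (negPf Vi) eqxx mul1r.
    by rewrite mxE (negPf Vi) eq_sym (negPf ji) mul0r.
  apply: P_injV => // i Vi; rewrite -[RHS](PVy i); apply: eq_bigr => j _.
  rewrite mxE Vi /=; case: ifPn => // /yF ->; by rewrite !mulr0.
have rV : forall j, r j = 0.
  apply: (iffRL (@det_neq0P _ PV^T)); first by rewrite det_tr.
  move=> i; have [Vi | Vi] := boolP (V i); last first.
    apply: big1 => j _; rewrite !mxE (negPf Vi) andbF.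
    by have [-> | _] := eqVneq; rewrite ?mul0r // rF ?mulr0.
  transitivity (\sum_k P k i * r k).
    apply: eq_bigr => k _; rewrite !mxE Vi andbT; case: ifPn => // /rF ->.
    by rewrite !mulr0.
  under eq_bigr do rewrite mulr_sumr; rewrite exchange_big /=; apply: big1 => j _.
  have [Vj | Vj] := boolP (V j).
    by apply: big1 => k _; rewrite xV // !mulr0.
  under eq_bigr do rewrite mulrA; rewrite -mulr_suml P_orth ?mul0r //.
  by rewrite Vi (negPf Vj).
by apply: (iffRL (@det_neq0P _ P)) => //.
Qed.

Let inside_inj (x : 'I_m -> R) :
  (forall i, \sum_(j | V i == V j) P i j * x j = 0) -> forall j, x j = 0.
Proof.
move=> x0 j; have [Vj | Vj] := boolP (V j).
  have -> : x j = (if V j then x j else 0) by rewrite Vj.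
  apply: (P_injV (x := fun j => if V j then x j else 0)) => i Vi.
    by rewrite (negPf Vi).
  rewrite -[RHS](x0 i) [RHS]big_mkcond /=; apply: eq_bigr => k _.
  by rewrite Vi; case: (V k); rewrite ?mulr0.
have -> : x j = (if V j then 0 else x j) by rewrite (negPf Vj).
apply: (P_injF (x := fun j => if V j then 0 else x j)) => i Vi.
  by rewrite Vi.
rewrite -[RHS](x0 i) [RHS]big_mkcond /=; apply: eq_bigr => k _.
by rewrite (negPf Vi); case: (V k); rewrite ?mulr0.
Qed.

Let inside_sum i (x : 'I_m -> R) :
  \sum_j inside i j * x j = \sum_(j | V i == V j) P i j * x j.
Proof.
rewrite [RHS]big_mkcond; apply: eq_bigr => j _.
by rewrite mxE; case: eqP; rewrite ?mul0r.
Qed.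

(* every homotopy 1 + t (inside - 1) with t < 1 is strictly diagonally dominant *)
Let inside_gt0 : 0 < \det inside.
Proof.
rewrite -[inside](addrNK 1%:M) addrC; apply: det_path; last by rewrite det1.
(* At [t = 1] strict dominance is lost and [inside_inj] takes over. *)
move=> t /andP[t0]; rewrite le_eqVlt => /orP[/eqP -> | t1].
  rewrite scale1r addrC addrNK; apply/det_neq0P => x x0; apply: inside_inj => i.
  by rewrite -[RHS](x0 i) inside_sum.
apply/det_neq0P => x x0 j0.
have [i _ imax] : exists2 i, i \in 'I_m & forall j, `|x j| <= `|x i|.
  case: (@arg_maxP _ _ _ j0 xpredT (fun j => `|x j|) isT) => i _ h; exists i => // j; exact: h.
suff xi0 : x i = 0.
  by apply/eqP; rewrite -normr_le0 -(normr0 R) -xi0.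
have xi : x i = - t * \sum_(j | (j != i) && (V j == V i)) P i j * x j.
  have := x0 i; under eq_bigr do rewrite !mxE.
  rewrite (bigD1 i) //= !eqxx P_diag subrr mulr0 addr0 mul1r => /eqP.
  rewrite addr_eq0 => /eqP ->; rewrite mulNr; congr (- _).
  rewrite mulr_sumr big_mkcondr /=; apply: eq_bigr => j ji.
  rewrite eq_sym in ji; rewrite (negPf ji) add0r subr0 [V j == V i]eq_sym.
  by case: eqP => _; rewrite ?mulr0 ?mul0r ?mulrA.
apply/eqP; rewrite -normr_eq0 eq_le normr_ge0 andbT.
have : `|x i| <= t * `|x i|.
  rewrite {1}xi normrM normrN (ger0_norm t0) ler_wpM2l //.
  apply: le_trans (ler_norm_sum _ _ _) _.
  apply: le_trans (_ : \sum_(j | (j != i) && (V j == V i)) `|P i j| * `|x i| <= _).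
    by apply: ler_sum => j _; rewrite normrM ler_wpM2l.
  by rewrite -mulr_suml ler_piMl.
by rewrite -subr_le0 -{1}[`|x i|]mul1r -mulrBl pmulr_rle0 // subr_gt0.
Qed.

(** The second deformation scales [across] from 0 to 1. A kernel vector at time [s] gives
    [a = - s b] for its images under the two parts, while [a] and [b] are orthogonal; hence [a]
    vanishes and [inside_inj] applies. *)
Lemma det_gt0_orthogonal : 0 < \det P.
Proof.
have -> : P = inside + across.
  by apply/matrixP => i j; rewrite !mxE; case: eqP; rewrite ?addr0 ?add0r.
apply: det_path => // s /andP[s0 _]; apply/det_neq0P => x x0.
pose a i := \sum_(j | V i == V j) P i j * x j.
pose b i := \sum_(j | V i != V j) P i j * x j.
have ab i : a i = - s * b i.
  apply/eqP; rewrite mulNr -addr_eq0 -[X in _ == X](x0 i); apply/eqP.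
  rewrite [a i]big_mkcond [b i]big_mkcond mulr_sumr -big_split /=.
  apply: eq_bigr => j _; rewrite !mxE; case: eqP => _; rewrite ?mulr0 ?addr0 //.
  by rewrite !add0r mulrA.
(* In each row [a i] and [b i] are the part over [V] and the part over its complement, in an order
   depending on the row; the product does not see the order. *)
have sum_ab : \sum_i a i * b i = 0.
  transitivity (\sum_i (\sum_(j | V j) P i j * x j) * (\sum_(k | ~~ V k) P i k * x k)).
    apply: eq_bigr => i _; rewrite /a /b; case: (V i).
      by congr (_ * _); apply: eq_bigl => j; case: (V j).
    by rewrite mulrC; congr (_ * _); apply: eq_bigl => j; case: (V j).
  under eq_bigr do rewrite mulr_suml; rewrite exchange_big /=; apply: big1 => j Vj.
  under eq_bigr do rewrite mulr_sumr; rewrite exchange_big /=; apply: big1 => k Vk.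
  have /(congr1 ( *%R (x j * x k))) : \sum_i P i j * P i k = 0.
    by apply: P_orth; rewrite Vj (negPf Vk).
  rewrite mulr0 mulr_sumr; apply: etrans; apply: eq_bigr => i _.
  by rewrite mulrACA mulrC.
apply: inside_inj => i; rewrite -/(a i).
rewrite ab; have [-> | sn] := eqVneq s 0; first by rewrite oppr0 mul0r.
suff -> : b i = 0 by rewrite mulr0.
have : \sum_i b i * b i = 0.
  apply/eqP; rewrite -(mulrI_eq0 _ (mulfI sn)) mulr_sumr -oppr_eq0 -sumrN; apply/eqP.
  by rewrite -[RHS]sum_ab; apply: eq_bigr => k _; rewrite ab -!mulNr mulrA.
move/eqP; rewrite psumr_eq0 => [/allP /(_ i (mem_index_enum i)) | k _].
  by rewrite /= mulf_eq0 orbb => /eqP.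
by rewrite -expr2 sqr_ge0.
Qed.

End PositiveDeterminant.

(** * Equality of the squares of the two reflected minors *)

Section ReflectedMinors.
Variables (R : realFieldType) (p n : nat).

Lemma row_sqr_eq0 m (u : 'rV[R]_m) : (u *m u^T == 0) = (u == 0).
Proof.
apply/eqP/eqP => [/matrixP/(_ 0 0) | ->]; last by rewrite mul0mx.
rewrite !mxE => /eqP; rewrite psumr_eq0 => [/allP h | i _]; last first.
  by rewrite mxE -expr2 sqr_ge0.
apply/rowP => i; have := h i (mem_index_enum i).
by rewrite !mxE mulf_eq0 orbb => /eqP.
Qed.

Lemma row_sqr_ge0 m (u : 'rV[R]_m) : 0 <= (u *m u^T) 0 0.
Proof. by rewrite mxE sumr_ge0 // => i _; rewrite mxE -expr2 sqr_ge0. Qed.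

(** In the application the columns are those of one copy. [A] holds the edges off the path, [a1] and
    [a2] the m_j with [j] odd and even, [Pi] projects onto the face columns, and [h0] is the
    indicator of the vertex columns. *)
Variables (A : 'M[R]_(p, p + n)) (a1 a2 : 'M[R]_(n, p + n)).
Variables (Pi : 'M[R]_(p + n)) (h0 : 'cV[R]_(p + n)).

Let X : 'M_(p + n) := col_mx A a1.
Let Y : 'M_(p + n) := col_mx A a2.
Let T := a1 *m (1%:M - Pi).
Let L := A^T *m A + a1^T *m a1 + a2^T *m a2.
Let Up : 'M[R]_n := \matrix_(i, j) (i <= j)%:R.
Let Lo := Up^T.
Let J : 'M[R]_n := const_mx 1.

Hypothesis Pi_idem : Pi *m Pi = Pi.
Hypothesis Pi_sym : Pi^T = Pi.
Hypothesis a2T : a2 *m (1%:M - Pi) = - T.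
Hypothesis orthL : Pi *m L *m (1%:M - Pi) = 0.
(** Partial sums along the path: in a face column, the two path edges at an inner even vertex have
    equal entries and the first path edge has entry zero. *)
Hypothesis shift : Lo *m a1 *m Pi = (Lo - 1%:M) *m a2 *m Pi.
Hypothesis Pi_h0 : Pi *m h0 = 0.
Hypothesis A_h0 : A *m h0 = 0.
Hypothesis a1_h0 : a1 *m h0 = const_mx 1.
Hypothesis a2_h0 : a2 *m h0 = const_mx (-1).
Hypothesis X_det : \det X != 0.

Let L_sym : L^T = L.
Proof. by rewrite /L !linearD /= !trmx_mul !trmxK. Qed.

Let XTX : X^T *m X = A^T *m A + a1^T *m a1.
Proof. by rewrite /X tr_col_mx mul_row_col. Qed.

Let PiL : Pi *m L = L *m Pi.
Proof.
have E : Pi *m L = Pi *m L *m Pi.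
  by apply/eqP; rewrite -subr_eq0 -{1}[Pi *m L]mulmx1 -mulmxBr orthL.
by have := congr1 trmx E; rewrite !trmx_mul L_sym Pi_sym mulmxA -E => ->.
Qed.

Let L_pos (u : 'rV[R]_(p + n)) : u *m L *m u^T = 0 -> u = 0.
Proof.
have -> : L = X^T *m X + a2^T *m a2 by rewrite XTX.
rewrite mulmxDr mulmxDl !mulmxA.
have sq m (B : 'M[R]_(m, p + n)) : u *m B^T *m B *m u^T = (u *m B^T) *m (u *m B^T)^T.
  by rewrite trmx_mul trmxK !mulmxA.
rewrite !sq => /matrixP/(_ 0 0); rewrite mxE [RHS]mxE => /eqP.
rewrite paddr_eq0 ?row_sqr_ge0 // => /andP[/eqP uX _].
have /eqP : (u *m X^T) *m (u *m X^T)^T = 0.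
  by apply/matrixP => i j; rewrite !ord1 [RHS]mxE.
rewrite row_sqr_eq0 => /eqP uX0; apply/eqP; apply: contraNT X_det => u0.
by rewrite -det_tr; apply/det0P; exists u.
Qed.

Let L_unit : L \in unitmx.
Proof.
rewrite unitmxE unitfE; apply/det0P => -[v v0 vL]; case/negP: v0; apply/eqP.
by apply: L_pos; rewrite vL mul0mx.
Qed.

Let g_split m (g : 'M[R]_(m, p + n)) : g *m Pi = 0 -> g = g *m (1%:M - Pi).
Proof. by move=> gPi; rewrite mulmxBr mulmx1 gPi subr0. Qed.

(* column operations remove the part of [b] lying in the range of [Pi] *)
Let det_kill (b f : 'M[R]_(p + n, n)) (g : 'M[R]_(n, p + n)) (H : 'M[R]_n) :
  Pi *m f = f -> g *m Pi = 0 -> \det (block_mx L (b + f) g H) = \det (block_mx L b g H).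
Proof.
move=> fPi gPi; pose z := invmx L *m f.
have Lz : L *m z = f by rewrite mulKVmx.
have gz : g *m z = 0.
  have iL : invmx L *m Pi = Pi *m invmx L.
    by apply: (can_inj (mulKmx L_unit)); rewrite mulKVmx // mulmxA -PiL -mulmxA mulmxV // mulmx1.
  by rewrite /z -fPi (mulmxA _ Pi) iL !mulmxA gPi !mul0mx.
have -> : block_mx L b g H = block_mx L (b + f) g H *m block_mx 1%:M (- z) 0 1%:M.
  rewrite mulmx_block !mulmx1 !mulmx0 !addr0 !mulmxN Lz gz.
  by rewrite oppr0 add0r addrC addrK.
by rewrite det_mulmx det_ublock !det1 !mulr1.
Qed.

(** The border of [D]: column [j], counted from 0, is the chain -m_1 + m_2 - ... + m_{2j} -
    m_{2j+1}. By [shift] it is orthogonal to the face columns, which is [g1Pi]. *)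
Let w1 := - Up.
Let w2 := Up - 1%:M.
Let D : 'M_(p + n + n) := block_mx X (col_mx 0 w1) a2 w2.
Let g1 := - (Lo *m a1) + (Lo - 1%:M) *m a2.

Let g1Pi : g1 *m Pi = 0.
Proof. by rewrite /g1 mulmxDl mulNmx shift addNr. Qed.

Let g1T : g1 = - ((Lo *+ 2 - 1%:M) *m T).
Proof.
rewrite (g_split g1Pi) /g1 mulmxDl mulNmx -!mulmxA a2T mulmxN -/T -opprD -mulmxDl.
by rewrite mulr2n addrA.
Qed.

(** For a kernel vector [(x, y)], [shift] makes the face part of the image of [x] under [L] vanish,
    hence that of [x]. On vertex columns [a2] is [- a1], and the two border equations then differ
    exactly by [y]. *)
Let D_det : \det D != 0.
Proof.
rewrite -det_tr; apply/negP => /det0P [v v0].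
rewrite /D tr_block_mx -[v]hsubmxK mul_row_block /X !tr_col_mx !mul_mx_row.
set x := lsubmx v; set y := rsubmx v => vD.
have [] : row_mx (x *m A^T + y *m 0^T) (x *m a1^T + y *m w1^T) = 0 /\
          x *m a2^T + y *m w2^T = 0.
  by move: vD; rewrite add_row_mx -[0 in RHS]row_mx0 => /eq_row_mx.
rewrite -[0 in RHS]row_mx0 => /eq_row_mx []; rewrite trmx0 mulmx0 addr0 => xA xa1 xa2.
have w1T : w1^T = - Lo by rewrite /w1 linearN.
have w2T : w2^T = Lo - 1%:M by rewrite /w2 linearB /= trmx1.
have xa1E : x *m a1^T = y *m Lo.
  by apply/eqP; rewrite -subr_eq0 -mulmxN -w1T xa1.
have xa2E : x *m a2^T = - (y *m (Lo - 1%:M)).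
  by apply/eqP; rewrite -subr_eq0 opprK -w2T xa2.
have xPi : x *m Pi = 0.
  have xL : x *m L *m Pi = 0.
    rewrite /L !mulmxDr !mulmxA xA mul0mx add0r xa1E xa2E mulNmx mulmxBl.
    by rewrite -!(mulmxA y) shift subrr.
  by apply: L_pos; rewrite -(mulmxA x) PiL mulmxA xL mul0mx.
have xE := g_split xPi.
have xa2E' : x *m a2^T = - (x *m a1^T).
  rewrite xE -!mulmxA; have -> : (1%:M - Pi) *m a2^T = (a2 *m (1%:M - Pi))^T.
    by rewrite trmx_mul linearB /= trmx1 Pi_sym.
  by rewrite a2T linearN /= mulmxN /T trmx_mul linearB /= trmx1 Pi_sym.
have y0 : y = 0.
  by move: xa2E; rewrite xa2E' xa1E mulmxBr mulmx1 opprB => /eqP; rewrite eq_sym -subr_eq0 opprK addrNK => /eqP.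
have /eqP : x *m X^T = 0 by rewrite /X tr_col_mx mul_mx_row xA xa1E y0 mul0mx row_mx0.
have xX : x = 0.
  apply/eqP; apply: contraNT X_det => x0; rewrite -det_tr; apply/det0P; exists x => //.
  by rewrite /X tr_col_mx mul_mx_row xA xa1E y0 mul0mx row_mx0.
by case/negP: v0; rewrite -[v]hsubmxK -/x -/y xX y0 row_mx0.
Qed.

Let H1 : D^T *m block_mx X 0 a2 1%:M = block_mx L a2^T g1 (Lo - 1%:M).
Proof.
rewrite /D tr_block_mx mulmx_block XTX !mulmx0 !mulmx1 add0r.
by rewrite /X !tr_col_mx !mul_row_col trmx0 mul0mx add0r /w1 /w2 linearN linearB /= trmx1 mulNmx add0r.
Qed.

(** Multiplying by the transpose of [D] brings in the Gram matrix [L]. As [g1] has no face part,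
    [det_kill] strips the upper right block of its face part, so that only [T] remains. *)
Let det1E : \det D * \det X = \det (block_mx L (- T^T) g1 (Lo - 1%:M)).
Proof.
have -> : \det X = \det (block_mx X 0 a2 1%:M) by rewrite det_lblock det1 mulr1.
rewrite -[\det D]det_tr -det_mulmx H1.
have -> : a2^T = - T^T + Pi *m a2^T.
  have -> : - T^T = (a2 *m (1%:M - Pi))^T by rewrite a2T linearN.
  by rewrite trmx_mul linearB /= trmx1 Pi_sym mulmxBl mul1mx addrNK.
by rewrite det_kill ?mulmxA ?Pi_idem.
Qed.

(** The same border read from the other end: column [j] is m_{2j+2} - m_{2j+3} + ... + m_{2n}. It
    arises from that of [D] by a change of sign and the gradient of the constant 1 on the vertex
    columns, as [DX] checks. *)
Let v1 := Up - J.
Let v2 := J - Up + 1%:M.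
Let h : 'M_(p + n, n) := h0 *m const_mx 1.
Let g2 := v1^T *m a1 + v2^T *m a2.

Let const1 m (a : R) : (const_mx a : 'cV_m) *m (const_mx 1 : 'rV_n) = const_mx a.
Proof. by apply/matrixP => i j; rewrite !mxE big_ord1 !mxE mulr1. Qed.

Let DX : D *m block_mx 1%:M (- h) 0 (- 1%:M) = block_mx X (col_mx 0 v1) a2 v2.
Proof.
have Xh : X *m h = col_mx 0 J by rewrite /h mulmxA mul_col_mx A_h0 a1_h0 mul_col_mx mul0mx const1.
have ah : a2 *m h = - J.
  by rewrite /h mulmxA a2_h0 const1; apply/matrixP => i j; rewrite !mxE.
rewrite /D mulmx_block !mulmx1 !mulmx0 !addr0 !mulmxN !mulmx1 Xh ah opprK.
rewrite !opp_col_mx add_col_mx oppr0 addr0 /w1 /w2 opprK opprB.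
by rewrite [- J + _]addrC [1%:M - Up]addrC addrA.
Qed.

(** A squared determinant is a Gram determinant, which ignores the order of the rows; so the roles
    of [a1] and [a2] can be exchanged. *)
Let detD2 : \det D ^+ 2 = \det (block_mx Y (col_mx 0 v2) a1 v1) ^+ 2.
Proof.
have -> : \det D ^+ 2 = \det (block_mx X (col_mx 0 v1) a2 v2) ^+ 2.
  rewrite -DX det_mulmx det_ublock det1 mul1r -scaleN1r detZ det1 mulr1.
  by rewrite exprMn -exprM mulnC exprM sqrrN expr1n expr1n mulr1.
have sq m (M : 'M[R]_m) : \det M ^+ 2 = \det (M^T *m M) by rewrite det_mulmx det_tr.
rewrite !sq !tr_block_mx !mulmx_block /X /Y !tr_col_mx !mul_row_col !trmx0 !mulmx0 !mul0mx !add0r.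
congr (\det (block_mx _ _ _ _)); [by rewrite -!addrA; congr (_ + _); rewrite addrC | by rewrite addrC ..].
Qed.

(** The image of [h0] under [L] has no face part, since [L] commutes with [Pi]. As [A] kills [h0],
    this says that [a1] and [a2] have equal column sums on the faces, which allows starting from the
    far end. *)
Let g2Pi : g2 *m Pi = 0.
Proof.
have JE : J *m a1 *m Pi = J *m a2 *m Pi.
  have : h0^T *m L *m Pi = 0.
    by rewrite -mulmxA -PiL mulmxA -[Pi]Pi_sym -trmx_mul Pi_h0 trmx0 mul0mx.
  rewrite /L !mulmxDr !mulmxA -!trmx_mul A_h0 a1_h0 a2_h0 trmx0 mul0mx add0r !trmx_const.
  rewrite mulmxDl => E.
  have JJ : J = (const_mx 1 : 'cV[R]_n) *m (const_mx 1 : 'rV[R]_n) by rewrite const1.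
  rewrite JJ -!mulmxA; congr (_ *m _); rewrite !mulmxA.
  apply/eqP; rewrite -subr_eq0 -E; apply/eqP; congr (_ + _).
  by rewrite -!mulNmx; congr (_ *m _ *m _); apply/matrixP => i j; rewrite !mxE.
rewrite /g2 /v1 /v2 linearB linearD linearB /= trmx1 [J^T]trmx_const -/Lo -/J.
have -> : ((Lo - J) *m a1 + (J - Lo + 1%:M) *m a2) *m Pi =
    (Lo *m a1 *m Pi - J *m a1 *m Pi) + (J - Lo + 1%:M) *m a2 *m Pi.
  by rewrite mulmxDl !mulmxBl.
rewrite shift JE -!mulmxBl -!mulmxDl.
have -> : Lo - 1%:M - J + (J - Lo + 1%:M) = 0.
  by apply/matrixP => i j; rewrite !mxE; ring.
by rewrite !mul0mx.
Qed.

Let LoUp : Lo + Up = J + 1%:M.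
Proof.
apply/matrixP => i j; rewrite !mxE -val_eqE /=.
by case: ltngtP; rewrite ?addr0 ?add0r.
Qed.

Let G := Up *+ 2 - 1%:M.

Let GT : G^T = Lo *+ 2 - 1%:M.
Proof. by rewrite /G linearB /= trmx1 linearMn. Qed.

Let g2T : g2 = - (G *m T).
Proof.
rewrite (g_split g2Pi) /g2 mulmxDl -!mulmxA a2T mulmxN -/T -mulmxBl -mulNmx; congr (_ *m _).
rewrite /v1 /v2 linearB linearD linearB /= trmx1 [J^T]trmx_const -/Lo -/J /G.
have -> : Lo = J + 1%:M - Up by rewrite -LoUp addrK.
by apply/matrixP => i j; rewrite !mxE; ring.
Qed.

Let H2 : (block_mx Y (col_mx 0 v2) a1 v1)^T *m block_mx Y 0 a1 1%:M =
  block_mx L a1^T g2 (1%:M - Up).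
Proof.
rewrite tr_block_mx mulmx_block !mulmx0 !mulmx1 add0r /Y !tr_col_mx !mul_row_col trmx0 mul0mx !add0r.
congr block_mx; first by rewrite /L -!addrA; congr (_ + _); rewrite addrC.
  by rewrite /g2 addrC.
rewrite /v1 linearB /= [J^T]trmx_const -/Lo -/J.
by rewrite -[Lo](addrK Up) LoUp addrAC [J + _]addrC addrK.
Qed.

Let det2E : \det (block_mx Y (col_mx 0 v2) a1 v1) * \det Y =
  \det (block_mx L T^T g2 (1%:M - Up)).
Proof.
have -> : \det Y = \det (block_mx Y 0 a1 1%:M) by rewrite det_lblock det1 mulr1.
rewrite -[in X in X * _]det_tr -det_mulmx H2.
have -> : a1^T = T^T + Pi *m a1^T.
  by rewrite /T trmx_mul linearB /= trmx1 Pi_sym mulmxBl mul1mx addrNK.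
by rewrite det_kill ?mulmxA ?Pi_idem.
Qed.

Let G_det : \det G != 0.
Proof.
rewrite -det_tr det_trig => [|]; last first.
  apply/is_trig_mxP => i j ij; rewrite !mxE -val_eqE /= (gtn_eqF ij) leqNgt ij /=.
  by rewrite !addr0 subr0.
apply/prodf_neq0 => i _; rewrite !mxE leqnn eqxx /= addrK.
exact: oner_neq0.
Qed.

(** Transposing the first matrix and conjugating by [block_mx 1%:M 0 0 G] gives the second, because
    [G] commutes with [Up] and [g1], [g2] are [- T] multiplied by the transpose of [G] and by [G].
    The sign of the last columns costs a sign only, whence the squares. *)
Let det_eq : \det (block_mx L (- T^T) g1 (Lo - 1%:M)) ^+ 2 =
  \det (block_mx L T^T g2 (1%:M - Up)) ^+ 2.
Proof.
have -> : \det (block_mx L T^T g2 (1%:M - Up)) ^+ 2 =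
    \det (block_mx L (- T^T) g2 (Up - 1%:M)) ^+ 2.
  have <- : block_mx L T^T g2 (1%:M - Up) *m block_mx 1%:M 0 0 (- 1%:M) =
      block_mx L (- T^T) g2 (Up - 1%:M).
    by rewrite mulmx_block !mulmx1 !mulmx0 !addr0 !add0r !mulmxN !mulmx1 opprB.
  rewrite det_mulmx det_ublock det1 mul1r -[- 1%:M]scaleN1r detZ det1 mulr1.
  by rewrite exprMn -exprM mulnC exprM sqrrN expr1n expr1n mulr1.
congr (_ ^+ 2); rewrite -det_tr tr_block_mx L_sym linearN /= trmxK.
have -> : (Lo - 1%:M)^T = Up - 1%:M by rewrite linearB /= trmx1 /Lo trmxK.
have -> : g1^T = - (T^T *m G) by rewrite g1T linearN /= trmx_mul -GT trmxK.
have GU : G *m (Up - 1%:M) = (Up - 1%:M) *m G.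
  rewrite /G mulr2n !mulmxBl !mulmxBr !mulmxDl !mulmxDr !mulmx1 !mul1mx.
  by move: (Up *m Up) => M; apply/matrixP => i j; rewrite !mxE; ring.
have : \det (block_mx 1%:M 0 0 G *m block_mx L (- (T^T *m G)) (- T) (Up - 1%:M)) =
    \det (block_mx L (- T^T) g2 (Up - 1%:M) *m block_mx 1%:M 0 0 G).
  rewrite !mulmx_block !mulmx1 !mul1mx !mulmx0 !mul0mx !addr0 !add0r GU g2T.
  by rewrite mulmxN mulNmx.
by rewrite !det_mulmx !det_ublock !det1 !mul1r mulrC => /(mulIf G_det).
Qed.

Lemma reflected_minors_sqr : \det X ^+ 2 = \det Y ^+ 2.
Proof.
have D2 : \det D ^+ 2 != 0 by rewrite expf_eq0.
apply: (mulfI D2); rewrite -exprMn det1E det_eq -det2E exprMn.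
by rewrite detD2.
Qed.

End ReflectedMinors.

(** * Plane graphs *)

Section Incidence.
Variables (V F : finType) (G : drawing V F) (R : realFieldType).

Definition oedges (ori : rel V) : {set V * V} :=
  [set e | adj G e.1 e.2 && ori e.1 e.2].

Definition vertex_bd (e : V * V) (x : V) : R := (e.2 == x)%:R - (e.1 == x)%:R.

Definition face_bd (e : V * V) (f : F) : R :=
  (lface G e.1 e.2 == f)%:R - (lface G e.2 e.1 == f)%:R.

Lemma bdfN e f : face_bd (e.2, e.1) f = - face_bd e f.
Proof. by rewrite /face_bd /= opprB. Qed.

End Incidence.

Section PlaneGraph.
Variables (V F : finType) (G : drawing V F) (R : realFieldType).
Hypothesis planeG : plane_graph G.
Variable ori : rel V.
Hypothesis oriN : forall u v, adj G u v -> ori v u = ~~ ori u v.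

Local Notation bdv := (@vertex_bd V R).
Local Notation bdf := (@face_bd V F G R).
Local Notation oedges := (oedges G ori).

Lemma adjC u v : adj G u v = adj G v u.
Proof. exact: plane_sym. Qed.

Lemma adj_neq u v : adj G u v -> u != v.
Proof. by apply: contraTneq => ->; rewrite (plane_irr planeG). Qed.

Lemma rot_adj u v : adj G u v -> adj G u (rot G u v).
Proof. exact: plane_rot_closed. Qed.

Lemma rot_iter_adj u v k : adj G u v -> adj G u (iter k (rot G u) v).
Proof. by move=> uv; elim: k => //= k; apply: rot_adj. Qed.

Lemma rot_iter u v w : adj G u v -> adj G u w -> exists k, w = iter k (rot G u) v.
Proof.
move=> uv uw; have := plane_rot_trans planeG uv uw.
by move/iter_findex => <-; exists (findex (rot G u) v w).
Qed.

Lemma rot_surj u w : adj G u w -> exists2 v, adj G u v & rot G u v = w.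
Proof.
move=> uw; have [k wE] := rot_iter (rot_adj uw) uw.
by exists (iter k (rot G u) w); rewrite ?rot_iter_adj // [RHS]wE -iterSr.
Qed.

Lemma rot_imset u : rot G u @: [set v | adj G u v] = [set v | adj G u v].
Proof.
apply/setP => w; apply/imsetP/idP => [[v] | ]; rewrite !inE => uv.
  by move->; apply: rot_adj.
by have [v uv' vw] := rot_surj uv; exists v; rewrite ?inE.
Qed.

Lemma rot_inj u : {in [pred v | adj G u v] &, injective (rot G u)}.
Proof.
have /imset_injP inj : #|rot G u @: [set v | adj G u v]| == #|[set v | adj G u v]|.
  by rewrite rot_imset.
by move=> v w uv uw; apply: inj; rewrite inE.
Qed.

Lemma sum_rot u (h : V -> R) :
  \sum_(v | adj G u v) h (rot G u v) = \sum_(v | adj G u v) h v.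
Proof.
have E (k : V -> R) : \sum_(v | adj G u v) k v = \sum_(v in [set v | adj G u v]) k v.
  by apply: eq_bigl => v; rewrite inE.
rewrite [RHS]E -(rot_imset u) big_imset ?E //= => v w.
by rewrite !inE => uv uw; apply: rot_inj.
Qed.

Lemma rot_const (T : Type) u (h : V -> T) :
  (forall v, adj G u v -> h v = h (rot G u v)) ->
  forall v w, adj G u v -> adj G u w -> h v = h w.
Proof.
move=> hrot v w uv uw; have [k ->] := rot_iter uv uw.
by elim: k => //= k IH; rewrite -hrot // rot_iter_adj.
Qed.

Lemma lface_rot u v : adj G u v -> lface G v (rot G v u) = lface G u v.
Proof. exact: plane_face. Qed.

(** Passes from one chosen orientation per edge to all darts, on which the rotation acts by
    permutations. *)
Lemma sum_oedges (k h : V * V -> R) :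
  (forall e, adj G e.1 e.2 -> h (e.2, e.1) = - h e) ->
  \sum_(e in oedges) (k e - k (e.2, e.1)) * h e =
  \sum_(e | adj G e.1 e.2) k e * h e.
Proof.
move=> hN; rewrite [RHS](bigID (fun e => ori e.1 e.2)) /=.
have -> : \sum_(e | adj G e.1 e.2 && ~~ ori e.1 e.2) k e * h e =
   \sum_(e in oedges) - k (e.2, e.1) * h e.
  rewrite (reindex_inj (h := fun e : V * V => (e.2, e.1))) /=; last first.
    by case=> [a b] [c d] /= [-> ->].
  apply: eq_big => [[u v] | [u v] /andP[uv _]] /=.
    rewrite inE /= adjC; case uv: (adj G u v) => //=.
    by rewrite (oriN uv) negbK.
  by rewrite -mulrNN; congr (_ * _); rewrite (hN (u, v)) ?opprK // adjC.
have -> : \sum_(e | adj G e.1 e.2 && ori e.1 e.2) k e * h e =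
   \sum_(e in oedges) k e * h e by apply: eq_bigl => e; rewrite inE.
by rewrite -big_split; apply: eq_bigr => e _; rewrite mulrBl mulNr.
Qed.

Lemma sum_bdv (h : V * V -> R) x :
  (forall e, adj G e.1 e.2 -> h (e.2, e.1) = - h e) ->
  \sum_(e in oedges) bdv e x * h e = \sum_(u | adj G x u) h (u, x).
Proof.
move=> hN; rewrite (sum_oedges (fun e => (e.2 == x)%:R) hN).
transitivity (\sum_(e | adj G e.1 e.2 && (e.2 == x)) h e).
  rewrite [RHS]big_mkcondr /=; apply: eq_bigr => e _.
  by case: eqP; rewrite ?mul1r ?mul0r.
rewrite (reindex_onto (fun u => (u, x)) fst) /= => [ | [u v] /andP[_ /eqP <-] //].
by apply: eq_bigl => u; rewrite !eqxx !andbT adjC.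
Qed.

Lemma sum_bdf (h : V * V -> R) f :
  (forall e, adj G e.1 e.2 -> h (e.2, e.1) = - h e) ->
  \sum_(e in oedges) bdf e f * h e =
  \sum_(e | adj G e.1 e.2 && (lface G e.1 e.2 == f)) h e.
Proof.
move=> hN; rewrite (sum_oedges (fun e => (lface G e.1 e.2 == f)%:R) hN).
rewrite big_mkcondr /=; apply: eq_bigr => e _.
by case: eqP; rewrite ?mul1r ?mul0r.
Qed.

(** The face on the left when arriving at [x] from [u] is the face on the left when leaving along
    the next edge, so the terms cancel under the rotation at [x]. *)
Lemma bd_orth x f : \sum_(e in oedges) bdv e x * bdf e f = 0.
Proof.
rewrite sum_bdv => [ | e _]; last exact: bdfN.
rewrite sumrB -(sum_rot x (fun u => (lface G x u == f)%:R)) -sumrB.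
by apply: big1 => u xu; rewrite /= lface_rot ?subrr // adjC.
Qed.

End PlaneGraph.

(** * Exactness of gradients and face boundaries on a connected plane graph *)

Section Exactness.
Variables (V F : finType) (G : drawing V F) (R : realFieldType).
Hypothesis planeG : plane_graph G.
Hypothesis conn : n_comp (adj G) predT = 1.
Hypothesis no_isolated : forall u, exists v, adj G u v.
Variable ori : rel V.
Hypothesis oriN : forall u v, adj G u v -> ori v u = ~~ ori u v.

Local Notation bdv := (@vertex_bd V R).
Local Notation bdf := (@face_bd V F G R).
Local Notation oedges := (oedges G ori).

Lemma vertex_const (T : Type) (h : V -> T) :
  (forall u v, adj G u v -> h u = h v) -> forall u v, h u = h v.
Proof.
have sym : connect_sym (adj G).
  by apply: sym_connect_sym; exact: plane_sym.
move=> hadj u v; have : connect (adj G) u v.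
  rewrite -(root_connect sym); apply/eqP.
  have /card_le1_eqP : (#|[predI roots (adj G) & predT]| <= 1)%N.
    by rewrite -[X in (X <= 1)%N]/(n_comp (adj G) predT) conn.
  by apply; rewrite !inE andbT roots_root.
case/connectP => p; elim: p u => [u _ -> // | w p IH u /= /andP[uw wp] vE].
by rewrite (hadj _ _ uw); exact: IH.
Qed.

(** [plane_conn] links faces only through vertices. The hypothesis and the rotation make [h]
    constant on the faces around one vertex, and so its value travels along such links. *)
Lemma face_const (T : Type) (h : F -> T) :
  (forall u v, adj G u v -> h (lface G u v) = h (lface G v u)) ->
  forall f g, h f = h g.
Proof.
move=> hadj f g.
pose Q (x : V + F) := match x with
  | inl u => forall v, adj G u v -> h (lface G u v) = h g
  | inr f => h f = h g end.
have around u v w : adj G u v -> adj G u w -> h (lface G u v) = h (lface G u w).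
  apply: (rot_const planeG (h := fun v => h (lface G u v))) => {}v uv.
  by rewrite hadj // lface_rot // (adjC planeG).
have step x y : vertex_face_rel G x y -> Q x -> Q y.
  have on u k : vertex_on G k u -> exists2 v, adj G u v & lface G u v = k.
    case/orP => [/existsP[v /andP[uv /eqP uvk]] | /andP[/eqP d0 _]]; first by exists v.
    have [v uv] := no_isolated u; move/eqP: d0.
    by rewrite cards_eq0 => /eqP/setP/(_ v); rewrite !inE uv.
  case: x y => [u | k] [v | l] //=.
  - move=> uv Qu w vw; have vu : adj G v u by rewrite (adjC planeG).
    by rewrite -(around v u w) // -hadj // Qu.
  - by case/on => w uw <- Qu; rewrite Qu.
  - by case/on => w vw <- Qk t vt; rewrite (around v t w).
have /connectP[p gp pE] : connect (vertex_face_rel G) (inr g) (inr f).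
  exact: plane_conn.
suff : Q (inr f) by [].
rewrite pE; have : Q (inr g) by [].
elim: p (inr g : V + F) gp {pE} => //= y p IH x /andP[xy yp] Qx.
by apply: IH yp _; apply: step xy Qx.
Qed.

Lemma edges_oedges : edges [set: V] (adj G) = [set [set e.1; e.2] | e in oedges].
Proof.
apply/setP => d; apply/imset2P/imsetP => [[u v _] | [[u v]]].
  rewrite !inE /= => uv ->; have [o | o] := boolP (ori u v).
    by exists (u, v); rewrite ?inE ?uv.
  by exists (v, u); rewrite ?inE /= 1?setUC // adjC // uv oriN.
by rewrite inE /= => /andP[uv _] ->; exists u v; rewrite ?inE.
Qed.

Lemma oedges_set_inj : {in oedges &, injective (fun e => [set e.1; e.2])}.
Proof.
move=> [a b] [c d]; rewrite !inE /= => /andP[ab oab] /andP[cd ocd] E.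
have ac : (a == c) || (a == d) by have := set21 a b; rewrite E !inE.
have bc : (b == c) || (b == d) by have := set22 a b; rewrite E !inE.
have nab := adj_neq planeG ab.
case/orP: ac => /eqP aE; case/orP: bc => /eqP bE.
- by rewrite aE bE eqxx in nab.
- by rewrite aE bE.
- by move: oab; rewrite aE bE (oriN cd) ocd.
- by rewrite aE bE eqxx in nab.
Qed.

Lemma card_oedges : #|oedges| = #|edges [set: V] (adj G)|.
Proof. by rewrite edges_oedges card_in_imset //; exact: oedges_set_inj. Qed.

Lemma card_oedges_euler : (#|V| + #|F| = #|oedges| + 2)%N.
Proof. by rewrite (plane_euler planeG) card_oedges conn -addnA. Qed.

Lemma oedges_both (P : V -> V -> Prop) : (forall u v, P u v -> P v u) ->
  (forall e, e \in oedges -> P e.1 e.2) -> forall u v, adj G u v -> P u v.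
Proof.
move=> PC Pe u v uv; have [o | o] := boolP (ori u v).
  by apply: (Pe (u, v)); rewrite inE uv.
by apply/PC/(Pe (v, u)); rewrite inE /= adjC // uv oriN.
Qed.

Section Base.
Variable x0 : V.

Let vs : {set V} := [set~ x0].
Let fs : {set F} := [set~ outer G].

(** Leaving out one vertex and the outer face makes each family independent; Euler's formula for one
    component says that they are then complementary in number. *)
Let card_vf : #|oedges| = (#|vs| + #|fs|)%N.
Proof.
have := card_oedges_euler; rewrite !cardsC1.
have : (0 < #|V|)%N by apply/card_gt0P; exists x0.
have : (0 < #|F|)%N by apply/card_gt0P; exists (outer G).
by case: #|V| => // v; case: #|F| => // f _ _; rewrite addSn addnS addn2 => -[].
Qed.

Let sum_bdv_fun (b : V -> R) e : (forall j, j \notin vs -> b j = 0) ->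
  \sum_(j in vs) bdv e j * b j = b e.2 - b e.1.
Proof.
move=> b0; have -> : \sum_(j in vs) bdv e j * b j = \sum_j bdv e j * b j.
  by rewrite big_mkcond; apply: eq_bigr => j _; case: ifPn => // /b0 ->; rewrite mulr0.
have D u : \sum_j (u == j)%:R * b j = b u.
  rewrite (bigD1 u) //= eqxx mul1r big1 ?addr0 // => j /negPf.
  by rewrite eq_sym => ->; rewrite mul0r.
by under eq_bigr do rewrite mulrBl; rewrite sumrB !D.
Qed.

Let sum_bdf_fun (c : F -> R) e : (forall j, j \notin fs -> c j = 0) ->
  \sum_(j in fs) bdf e j * c j = c (lface G e.1 e.2) - c (lface G e.2 e.1).
Proof.
move=> c0; have -> : \sum_(j in fs) bdf e j * c j = \sum_j bdf e j * c j.
  by rewrite big_mkcond; apply: eq_bigr => j _; case: ifPn => // /c0 ->; rewrite mulr0.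
have D u : \sum_j (u == j)%:R * c j = c u.
  rewrite (bigD1 u) //= eqxx mul1r big1 ?addr0 // => j /negPf.
  by rewrite eq_sym => ->; rewrite mul0r.
by under eq_bigr do rewrite mulrBl; rewrite sumrB !D.
Qed.

Let restrict_fun (T : finType) (A : {set T}) (x : T -> R) :
  exists2 x' : T -> R, {in A, x' =1 x} & forall j, j \notin A -> x' j = 0.
Proof.
by exists (fun j => if j \in A then x j else 0) => j => [-> | /negPf ->].
Qed.

Let bdv_inj (x : V -> R) :
  (forall e, e \in oedges -> \sum_(j in vs) bdv e j * x j = 0) ->
  forall j, j \in vs -> x j = 0.
Proof.
have [x' xE x'0] := restrict_fun vs x.
move=> h j jv; rewrite -xE // -(x'0 x0) ?inE ?eqxx //.
apply: vertex_const => u v; move: u v; apply: oedges_both => [u v -> // | e eo].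
apply/esym/eqP; rewrite -subr_eq0 -sum_bdv_fun // -[X in _ == X](h e eo); apply/eqP.
by apply: eq_bigr => k kv; rewrite xE.
Qed.

Let bdf_inj (x : F -> R) :
  (forall e, e \in oedges -> \sum_(j in fs) bdf e j * x j = 0) ->
  forall j, j \in fs -> x j = 0.
Proof.
have [x' xE x'0] := restrict_fun fs x.
move=> h j jv; rewrite -xE // -(x'0 (outer G)) ?inE ?eqxx //.
apply: face_const; apply: oedges_both => [u v -> // | e eo].
apply/eqP; rewrite -subr_eq0 -sum_bdf_fun // -[X in _ == X](h e eo); apply/eqP.
by apply: eq_bigr => k kv; rewrite xE.
Qed.

(** Zero circulation around the bounded faces is orthogonality to an independent family of face
    columns, so [orthogonal_exact] applies; [x0] normalises the potential. *)
Lemma exact_gradient (h : V * V -> R) :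
  (forall e, adj G e.1 e.2 -> h (e.2, e.1) = - h e) ->
  (forall f, f != outer G ->
     \sum_(e | adj G e.1 e.2 && (lface G e.1 e.2 == f)) h e = 0) ->
  exists2 b : V -> R, b x0 = 0 & forall u v, adj G u v -> h (u, v) = b v - b u.
Proof.
move=> hN h0.
have [b bE] : exists b : V -> R, forall e, e \in oedges -> h e = \sum_(j in vs) bdv e j * b j.
  apply: orthogonal_exact bdv_inj bdf_inj _ _ => //.
    by move=> j k _ _; exact: bd_orth.
  move=> k; rewrite !inE => kf; rewrite -[RHS](h0 _ kf) -(sum_bdf planeG oriN) //.
  by apply: eq_bigr => e _; rewrite mulrC.
have [b' b'E b'0] := restrict_fun vs b; exists b'; first by rewrite b'0 ?inE ?eqxx.
move=> u v uv; have [o | o] := boolP (ori u v).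
  rewrite bE ?inE /= ?uv // -(sum_bdv_fun (u, v)) //.
  by apply: eq_bigr => j jv; rewrite b'E.
rewrite (hN (v, u)) /= ?(adjC planeG v) // -opprB; congr (- _).
rewrite bE ?inE /= ?(adjC planeG v) ?uv ?(oriN uv) // -(sum_bdv_fun (v, u)) //.
by apply: eq_bigr => j jv; rewrite b'E.
Qed.

Lemma exact_boundary (h : V * V -> R) :
  (forall e, adj G e.1 e.2 -> h (e.2, e.1) = - h e) ->
  (forall x, \sum_(u | adj G x u) h (u, x) = 0) ->
  exists2 c : F -> R, c (outer G) = 0 &
    forall u v, adj G u v -> h (u, v) = c (lface G u v) - c (lface G v u).
Proof.
move=> hN h0.
have [c cE] : exists c : F -> R, forall e, e \in oedges -> h e = \sum_(j in fs) bdf e j * c j.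
  apply: orthogonal_exact bdf_inj bdv_inj _ _; first by rewrite addnC.
    move=> j k _ _; under eq_bigr do rewrite mulrC; exact: bd_orth.
  move=> k _; rewrite -[RHS](h0 k) -(sum_bdv planeG oriN) //.
  by apply: eq_bigr => e _; rewrite mulrC.
have [c' c'E c'0] := restrict_fun fs c; exists c'; first by rewrite c'0 ?inE ?eqxx.
move=> u v uv; have [o | o] := boolP (ori u v).
  rewrite cE ?inE /= ?uv // -(sum_bdf_fun (u, v)) //.
  by apply: eq_bigr => j jv; rewrite c'E.
rewrite (hN (v, u)) /= ?(adjC planeG v) // -opprB; congr (- _).
rewrite cE ?inE /= ?(adjC planeG v) ?uv ?(oriN uv) // -(sum_bdf_fun (v, u)) //.
by apply: eq_bigr => j jv; rewrite c'E.
Qed.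

End Base.

End Exactness.

(** * Cut vertices and the number of edges of a pendant part *)

Section Separation.
Variables (V F : finType) (G : drawing V F).
Hypothesis planeG : plane_graph G.
Hypothesis conn : n_comp (adj G) predT = 1.
Hypothesis no_isolated : forall u, exists v, adj G u v.
Variable ori : rel V.
Hypothesis oriN : forall u v, adj G u v -> ori v u = ~~ ori u v.

Local Notation R := rat.
Local Notation bdv := (@vertex_bd V R).
Local Notation bdf := (@face_bd V F G R).
Local Notation oedges := (oedges G ori).
Let adjC := adjC planeG.

(* The darts of [f] satisfying [Q] bound a 1-cycle; writing it as the boundary of
   [c], the function [c (lface d) - [d is one of them]] is constant on all darts. *)
Lemma face_orbit (f : F) (Q : V -> V -> bool) :
  (forall u v, adj G u v -> lface G u v = f -> Q u v = Q v (rot G v u)) ->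
  forall u v u' v', adj G u v -> lface G u v = f ->
    adj G u' v' -> lface G u' v' = f -> Q u v = Q u' v'.
Proof.
move=> Qrot u v u' v' uv uvf uv' uvf'.
pose X u v : R := ((lface G u v == f) && Q u v)%:R.
have Xrot x y : adj G x y -> X y x = X x (rot G x y).
  move=> xy; rewrite /X lface_rot // 1?adjC //.
  by case: eqP => // yxf; rewrite Qrot // adjC.
have [||c _ cE] := exact_boundary planeG conn no_isolated oriN u
    (h := fun e => X e.1 e.2 - X e.2 e.1).
- by move=> e _; rewrite opprB.
- move=> x /=; rewrite sumrB -(sum_rot planeG x (X x)) -sumrB big1 // => y xy.
  by rewrite Xrot // subrr.
pose g u v := c (lface G u v) - X u v.
have gC x y : adj G x y -> g x y = g y x.
  by move=> xy; have := cE x y xy; rewrite /g /=; lra.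
have gR v0 x y : adj G v0 x -> adj G v0 y -> g v0 x = g v0 y.
  apply: (rot_const planeG (h := g v0)) => z vz.
  by rewrite gC // /g Xrot // lface_rot // adjC.
pose k x := if [pick y | adj G x y] is Some y then g x y else 0.
have kE x y : adj G x y -> k x = g x y.
  rewrite /k; case: pickP => [z xz xy | /(_ y) -> //]; exact: gR.
have /eqP : g u v = g u' v'.
  rewrite -!kE //; apply: (vertex_const planeG conn) => x y xy.
  by rewrite (kE x y) // (kE y x) 1?adjC // gC.
rewrite /g uvf uvf' /X uvf uvf' !eqxx /= => /eqP /addrI /oppr_inj /eqP.
by rewrite eqr_nat; case: (Q u v); case: (Q u' v').
Qed.

(** Give 1 to the darts from [v] into [S]. A bounded face enters and leaves [v] through neighbours
    on which [S] agrees, so its circulation is zero and the cochain is a gradient. The potential is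
    0 at [v], 1 on the neighbours in [S], and changes only at [v]; [Y] is its support. *)
Lemma side_cut v (S : pred V) :
  (forall u, adj G v u -> lface G u v != outer G -> S u = S (rot G v u)) ->
  exists Y : {set V}, [/\ v \notin Y, (forall u, adj G v u -> (u \in Y) = S u) &
    forall x y, adj G x y -> x != v -> y != v -> (x \in Y) = (y \in Y)].
Proof.
move=> Srot.
have [||b bv bE] := exact_gradient planeG conn no_isolated oriN v
    (h := fun e => ((e.1 == v) && S e.2)%:R - ((e.2 == v) && S e.1)%:R : R).
- by move=> e _; rewrite opprB.
- move=> f fo; rewrite sumrB.
  have -> : \sum_(e | adj G e.1 e.2 && (lface G e.1 e.2 == f)) ((e.1 == v) && S e.2)%:R =
      \sum_(u | adj G v u) ((lface G v u == f) && S u)%:R :> R.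
    rewrite (bigID (fun e => e.1 == v)) /= [X in _ + X]big1 ?addr0; last first.
      by move=> e /andP[_ /negPf ->].
    rewrite (reindex_onto (fun u => (v, u)) snd) /= => [|[x y] /andP[_ /eqP /= <-] //].
    rewrite [RHS](bigID (fun u => lface G v u == f)) /= [X in _ + X]big1 ?addr0; last first.
      by move=> u /andP[_ /negPf ->].
    apply: eq_big => u; first by rewrite !eqxx !andbT.
    by rewrite eqxx => /andP[/andP[/andP[_ ->] _] _].
  have -> : \sum_(e | adj G e.1 e.2 && (lface G e.1 e.2 == f)) ((e.2 == v) && S e.1)%:R =
      \sum_(u | adj G v u) ((lface G u v == f) && S u)%:R :> R.
    rewrite (bigID (fun e => e.2 == v)) /= [X in _ + X]big1 ?addr0; last first.
      by move=> e /andP[_ /negPf ->].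
    rewrite (reindex_onto (fun u => (u, v)) fst) /= => [|[x y] /andP[_ /eqP /= <-] //].
    rewrite [RHS](bigID (fun u => lface G u v == f)) /= [X in _ + X]big1 ?addr0; last first.
      by move=> u /andP[_ /negPf ->].
    apply: eq_big => u; first by rewrite !eqxx !andbT adjC.
    by rewrite eqxx => /andP[/andP[/andP[_ ->] _] _].
  rewrite -(sum_rot planeG v (fun u => ((lface G v u == f) && S u)%:R)) -sumrB.
  rewrite big1 // => u vu; rewrite lface_rot 1?adjC //.
  case: eqP => [uvf | _]; last by rewrite subrr.
  by rewrite (Srot u) ?subrr ?uvf.
exists [set x | b x != 0]; split=> [|u vu|x y xy xv yv].
- by rewrite inE bv eqxx.
- have := bE v u vu; rewrite /= eqxx eq_sym (negPf (adj_neq planeG vu)) /= subr0 bv subr0.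
  by rewrite inE => <-; rewrite pnatr_eq0 eqb0 negbK.
- have /eqP := bE x y xy; rewrite /= (negPf xv) (negPf yv) /= subrr eq_sym subr_eq0.
  by rewrite !inE => /eqP ->.
Qed.

(** At a corner of the boundary walk lying at [v] the predicate [S] does not change; at any other
    corner the middle vertex alone decides, so [face_orbit] applies. *)
Lemma side_face v (S : pred V) (Y : {set V}) :
  (forall u, adj G v u -> lface G u v != outer G -> S u = S (rot G v u)) ->
  v \notin Y -> (forall u, adj G v u -> (u \in Y) = S u) ->
  (forall x y, adj G x y -> x != v -> y != v -> (x \in Y) = (y \in Y)) ->
  forall u w u' w', adj G u w -> adj G u' w' -> lface G u w = lface G u' w' ->
  lface G u w != outer G ->
  (u \in Y) || (w \in Y) = (u' \in Y) || (w' \in Y).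
Proof.
move=> Srot vY YS Yadj u w u' w' uw uw' E fo.
apply: (face_orbit (f := lface G u w) (Q := fun x y => (x \in Y) || (y \in Y))) => //.
move=> x y xy xyf; have yr := rot_adj planeG (etrans (adjC y x) xy).
have [yv | yv] := eqVneq y v.
  subst y; rewrite (negPf vY) orbF /= YS 1?adjC // YS // Srot // 1?adjC //.
  by rewrite xyf.
have sideE z : adj G y z -> (z \in Y) || (y \in Y) = (y \in Y).
  move=> yz; have [zv | zv] := eqVneq z v; first by rewrite zv (negPf vY).
  by rewrite (Yadj z y) ?orbb // adjC.
by rewrite sideE 1?adjC // orbC sideE.
Qed.

Definition touching (Y : {set V}) : {set V * V} :=
  [set e in oedges | (e.1 \in Y) || (e.2 \in Y)].

(** With more edges, some non-zero vector on them would be orthogonal to the columns of [Y] and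
    [F']. It would be the gradient of a potential vanishing at [z], and its energy would be zero. *)
Lemma card_touching (Y : {set V}) z (F' : {set F}) f0 :
  z \notin Y ->
  (forall x y, adj G x y -> x \in Y -> y \notin Y -> y = z) ->
  (forall x y, adj G x y -> (x \in Y) || (y \in Y) ->
     lface G x y != f0 -> lface G x y \in F') ->
  (#|touching Y| <= #|Y| + #|F'|)%N.
Proof.
move=> zY Yz YF; rewrite leqNgt; apply/negP => lt.
pose B := [set s : V + F | match s with inl x => x \in Y | inr f => f \in F' end].
have cardB : #|B| = (#|Y| + #|F'|)%N.
  rewrite -!sum1_card big_sumType /=.
  by congr (_ + _)%N; apply: eq_bigl => s; rewrite inE.
pose M (e : V * V) s := match s with inl x => bdv e x | inr f => bdf e f end.
have [|y [[e0 e0Y ye0] yB]] := @exists_left_kernel rat _ _ (touching Y) B M.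
  by rewrite cardB.
pose h e := if e \in touching Y then y e
            else if (e.2, e.1) \in touching Y then - y (e.2, e.1) else 0.
have tN e : adj G e.1 e.2 -> e \in touching Y -> (e.2, e.1) \notin touching Y.
  by move=> a; rewrite !inE /= (adjC e.2) a (oriN a) /= => /andP[-> _].
have hN e : adj G e.1 e.2 -> h (e.2, e.1) = - h e.
  move=> a; rewrite /h /=; have -> : (e.1, e.2) = e by case: e {a}.
  case: ifP => [t | _]; last by case: ifP; rewrite ?oppr0.
  have a' : adj G (e.2, e.1).1 (e.2, e.1).2 by rewrite /= adjC.
  have := tN _ a' t; rewrite /=; have -> : (e.1, e.2) = e by case: e {a a' t}.
  by move/negPf ->; rewrite opprK.
have hO e : e \in oedges -> h e = if e \in touching Y then y e else 0.
  move=> eo; rewrite /h; case: ifP => // _; rewrite inE.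
  move: eo; rewrite !inE /= => /andP[a o].
  by rewrite (oriN a) o andbF.
have sumh (k : V * V -> R) : \sum_(e in oedges) k e * h e = \sum_(e in touching Y) y e * k e.
  rewrite [RHS]big_mkcond [LHS]big_mkcond; apply: eq_bigr => e _.
  have [eo | eo] := boolP (e \in oedges); last by rewrite inE (negPf eo).
  by rewrite hO //; case: ifP => _; rewrite ?mulr0 // mulrC.
have hF f : \sum_(e in oedges) bdf e f * h e = 0.
  have hF1 k : k != f0 -> \sum_(e in oedges) bdf e k * h e = 0.
    move=> kf; rewrite sumh; have [kF | kF] := boolP (k \in F').
      by apply: (yB (inr k)); rewrite inE.
    apply: big1 => [[a b]]; rewrite !inE /= => /andP[/andP[ab _] abY].
    rewrite /bdf /=; case: eqP => [E | _].
      by case/negP: kF; rewrite -E YF // E.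
    case: eqP => [E | _]; last by rewrite subrr mulr0.
    by case/negP: kF; rewrite -E YF 1?adjC 1?orbC // E.
  (* The face columns add up to zero, so orthogonality to all other faces implies it for [f0]. *)
  have [-> | ] := eqVneq f f0; last exact: hF1.
  have : \sum_k \sum_(e in oedges) bdf e k * h e = 0.
    rewrite exchange_big /=; apply: big1 => e _; rewrite -mulr_suml /bdf sumrB.
    have S1 (k : F) : \sum_j (k == j)%:R = 1 :> R.
      by rewrite (bigD1 k) //= eqxx big1 ?addr0 // => j /negPf; rewrite eq_sym => ->.
    by rewrite !S1 subrr mul0r.
  rewrite (bigD1 f0) //=; rewrite [X in _ + X]big1 ?addr0 //.
have [|f fo|b bz bE] := exact_gradient planeG conn no_isolated oriN z (h := h).
- exact: hN.
- by rewrite -(sum_bdf planeG oriN).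
(* The energy is the sum over [x] of [b x] times the divergence of [h] at [x]. It vanishes on [Y] by
   the choice of [y], at [z] because [b z = 0], and elsewhere because no edge carrying [h] ends
   there. *)
have hb0 : \sum_(e in oedges) h e * h e = 0.
  transitivity (\sum_(e in oedges) (\sum_x bdv e x * b x) * h e).
    apply: eq_bigr => [[u v]]; rewrite inE => /andP[uv _]; rewrite {1}bE //; congr (_ * _).
    have D w : \sum_j (w == j)%:R * b j = b w.
      rewrite (bigD1 w) //= eqxx mul1r big1 ?addr0 // => j /negPf.
      by rewrite eq_sym => ->; rewrite mul0r.
    by rewrite /bdv; under [RHS]eq_bigr do rewrite mulrBl; rewrite sumrB !D.
  under eq_bigr do rewrite mulr_suml; rewrite exchange_big /=; apply: big1 => x _.
  under eq_bigr do rewrite mulrAC mulrC; rewrite -mulr_sumr.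
  have [xY | xY] := boolP (x \in Y).
    have -> : \sum_(e in oedges) bdv e x * h e = 0; last by rewrite mulr0.
    by rewrite sumh; apply: (yB (inl x)); rewrite inE.
  have [-> | xz] := eqVneq x z; first by rewrite bz mul0r.
  rewrite sumh big1 ?mulr0 // => [[u v]]; rewrite !inE /= => /andP[/andP[uv _] uvY].
  rewrite /bdv /= [u == x]negbTE 1?[v == x]negbTE ?subrr ?mulr0 //.
    apply/eqP => E; subst v; case/orP: uvY => [uY | ]; last by rewrite (negPf xY).
    by rewrite (Yz _ _ uv uY xY) eqxx in xz.
  apply/eqP => E; subst u; case/orP: uvY => [ | vY]; first by rewrite (negPf xY).
  by rewrite (Yz v x) ?eqxx // adjC in xz.
case/negP: ye0; apply/eqP; have e0o : e0 \in oedges by move: e0Y; rewrite inE => /andP[].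
by have := sum_sqr_eq0 hb0 e0o; rewrite hO // e0Y.
Qed.

End Separation.

(** * The matrix of the double graph *)

Section BoundaryPath.
Variables (V F : finType) (G : drawing V F) (n : nat) (w : nat -> V).

Record boundary_path : Prop := BoundaryPath {
  path_gt0 : (0 < n)%N;
  path_inj : {in [pred j | (j <= n.*2)%N] &, injective w};
  path_adj : forall j, (j < n.*2)%N -> adj G (w j) (w j.+1);
  path_even : forall i u, (i <= n)%N -> adj G (w i.*2) u ->
    ((0 < i)%N /\ u = w i.*2.-1) \/ ((i < n)%N /\ u = w i.*2.+1);
  path_outer : forall j, (j < n.*2)%N ->
    lface G (w j) (w j.+1) = outer G \/ lface G (w j.+1) (w j) = outer G;
  path_outer0 : lface G (w 0%N) (w 1%N) = outer G /\ lface G (w 1%N) (w 0%N) = outer G;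
  path_outern : lface G (w n.*2.-1) (w n.*2) = outer G /\
    lface G (w n.*2) (w n.*2.-1) = outer G
}.

Definition evens : {set V} := [set w i.*2 | i : 'I_n.+1].

Definition path_edge (e : V * V) : bool :=
  [exists j : 'I_n.*2, e == (w j, w j.+1)].

(** Vertices off the path come after it, in an arbitrary order; since the rank is injective,
    comparing ranks orients every edge. *)
Definition path_rank (u : V) : nat :=
  if [pick j : 'I_n.*2.+1 | w j == u] is Some j then j : nat
  else n.*2.+1 + enum_rank u.

(* orients the path edges forward *)
Definition path_ori : rel V := fun u v => (path_rank u < path_rank v)%N.

End BoundaryPath.

Section GluedMatrix.
Variables (V F : finType) (G : drawing V F) (n : nat) (w : nat -> V).
Variable R : realFieldType.

Definition incidence (e : V * V) (z : V + F) : R :=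
  match z with inl x => vertex_bd R e x | inr f => face_bd G R e f end.

(** On m_j this is (-1)^j, as m_j points forward and starts at v_{j-1}. *)
Definition path_sign (e : V * V) : R := if e.1 \in evens n w then -1 else 1.

(* The edge-vertices of the double graph: [(e, false)] lies in the first copy and
   [(e, true)] in the second one; the path edges occur in the first copy only. *)
Definition rows : {set V * V * bool} :=
  [set r | (r.1 \in oedges G (path_ori n w)) && (r.2 ==> ~~ path_edge n w r.1)].

Definition half_cols : {set V + F} :=
  [set z | match z with inl x => x \notin evens n w | inr f => f != outer G end].

Definition cols : {set (V + F) * bool} := [set c | c.1 \in half_cols].

Definition primal (c : (V + F) * bool) : bool :=
  match c.1 with inl _ => ~~ c.2 | inr _ => c.2 end.

Definition pcols : {set (V + F) * bool} := [set c in cols | primal c].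
Definition dcols : {set (V + F) * bool} := [set c in cols | ~~ primal c].

(* The signs alternate along the path, which makes the vertices of the first copy
   and the faces of the second one orthogonal to all other columns. *)
Definition glued_entry (r : V * V * bool) (c : (V + F) * bool) : R :=
  if path_edge n w r.1 then (if c.2 then path_sign r.1 else 1) * incidence r.1 c.1
  else (r.2 == c.2)%:R * incidence r.1 c.1.

Definition vertex_part (x : (V + F) * bool -> R) s u : R :=
  if u \in evens n w then 0 else x (inl u, s).
Definition face_part (x : (V + F) * bool -> R) s f : R :=
  if f == outer G then 0 else x (inr f, s).
Definition vertex_diff (p : V -> R) (e : V * V) : R := p e.2 - p e.1.
Definition face_diff (q : F -> R) (e : V * V) : R :=
  q (lface G e.1 e.2) - q (lface G e.2 e.1).

End GluedMatrix.

(** * Orthogonality and independence of the primal and dual columns *)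

Section Glued.
Variables (V F : finType) (G : drawing V F) (n : nat) (w : nat -> V).
Variable R : realFieldType.
Hypothesis planeG : plane_graph G.
Hypothesis bp : boundary_path G n w.

Local Notation ori := (path_ori n w).
Local Notation oe := (oedges G ori).
Local Notation evens := (evens n w).
Local Notation me := (path_edge n w).
Local Notation bdv := (@vertex_bd V R).
Local Notation bdf := (@face_bd V F G R).
Let n_gt0 : (0 < n)%N := path_gt0 bp.
Let adjC := adjC planeG.

Lemma path_rankE j : (j <= n.*2)%N -> path_rank n w (w j) = j.
Proof.
move=> jn; rewrite /path_rank; case: pickP => [k /eqP wk | /(_ (Ordinal (jn : j < n.*2.+1)%N))].
  by apply: (path_inj bp) => //; rewrite inE -ltnS.
by rewrite /= eqxx.
Qed.

Lemma path_rank_inj : injective (path_rank n w).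
Proof.
move=> u v; rewrite /path_rank.
case: pickP => [j /eqP <- | uN]; case: pickP => [k /eqP <- | vN].
- by move->.
- by move=> E; have := ltn_ord j; rewrite E; lia.
- by move=> E; have := ltn_ord k; rewrite -E; lia.
- by move/addnI/ord_inj/enum_rank_inj.
Qed.

Lemma path_oriN u v : adj G u v -> ori v u = ~~ ori u v.
Proof.
move=> uv; rewrite /path_ori -leqNgt ltn_neqAle.
by case: eqP => [/path_rank_inj E | //]; have := adj_neq planeG uv; rewrite E eqxx.
Qed.
Let oriN := path_oriN.

Lemma path_edge_oe j : (j < n.*2)%N -> (w j, w j.+1) \in oe.
Proof. by move=> jn; rewrite inE (path_adj bp) //= /path_ori !path_rankE //; lia. Qed.

Lemma path_edgeP e : reflect (exists2 j, (j < n.*2)%N & e = (w j, w j.+1)) (me e).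
Proof.
apply: (iffP existsP) => [[j /eqP ->] | [j jn ->]]; first by exists j.
by exists (Ordinal jn).
Qed.

Lemma evensP x : reflect (exists2 i, (i <= n)%N & x = w i.*2) (x \in evens).
Proof.
apply: (iffP imsetP) => [[i _ ->] | [i iN ->]]; first by exists i; rewrite // -ltnS.
by exists (Ordinal (iN : i < n.+1)%N).
Qed.

Lemma even_in j : (j <= n.*2)%N -> (w j \in evens) = ~~ odd j.
Proof.
move=> jn; apply/evensP/idP => [[i iN /(path_inj bp)] | oj].
  by rewrite !inE => -> //; rewrite ?odd_double //; lia.
by exists j./2; [lia | rewrite -[in LHS](odd_double_half j) (negPf oj)].
Qed.

Lemma even_nbr x y : x \in evens -> adj G x y -> me (x, y) || me (y, x).
Proof.
move=> /evensP[i iN ->] xy; case: (path_even bp iN xy) => [[i0 ->] | [iN' ->]].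
  apply/orP; right; apply/path_edgeP; exists i.*2.-1; [lia | by rewrite prednK //; lia].
by apply/orP; left; apply/path_edgeP; exists i.*2; first lia.
Qed.

Lemma path_edge_ori e : me e -> ori e.1 e.2.
Proof. by case/path_edgeP => j jn ->; have := path_edge_oe jn; rewrite inE => /andP[]. Qed.

Lemma oe_even e : e \in oe -> ~~ me e -> (e.1 \notin evens) && (e.2 \notin evens).
Proof.
case: e => u v; rewrite inE /= => /andP[uv o] m; apply/andP; split; apply/negP => /even_nbr.
  move=> /(_ v uv) /orP[]; first by rewrite (negPf m).
  by move/path_edge_ori; rewrite /= oriN // o.
move=> /(_ u); rewrite adjC => /(_ uv) /orP[]; last by rewrite (negPf m).
by move/path_edge_ori; rewrite /= oriN // o.
Qed.

Lemma path_rot i : (0 < i < n)%N ->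
  rot G (w i.*2) (w i.*2.-1) = w i.*2.+1 /\ rot G (w i.*2) (w i.*2.+1) = w i.*2.-1.
Proof.
case/andP => i0 iN; have a1 : adj G (w i.*2) (w i.*2.-1).
  by rewrite adjC -{2}(prednK (n := i.*2)) ?(path_adj bp) //; lia.
have a2 : adj G (w i.*2) (w i.*2.+1) by apply: (path_adj bp); lia.
have neq : w i.*2.-1 <> w i.*2.+1 by move/(path_inj bp); rewrite !inE; lia.
have fix_const v v' : adj G (w i.*2) v -> adj G (w i.*2) v' ->
    rot G (w i.*2) v = v -> v = v'.
  move=> av av' rv; have [k ->] := rot_iter planeG av av'.
  by elim: k => //= k <-.
split.
  have := rot_adj planeG a1; case/(path_even bp (ltnW iN)) => [[_ E] | [_ //]].
  by case: neq; apply: fix_const E.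
have := rot_adj planeG a2; case/(path_even bp (ltnW iN)) => [[_ //] | [_ E]].
by case: neq; apply/esym; apply: fix_const E.
Qed.

Lemma path_lface i : (0 < i < n)%N ->
  lface G (w i.*2) (w i.*2.+1) = lface G (w i.*2.-1) (w i.*2) /\
  lface G (w i.*2.+1) (w i.*2) = lface G (w i.*2) (w i.*2.-1).
Proof.
move=> i0n; have [r1 r2] := path_rot i0n; case/andP: i0n => i0 iN.
have a1 : adj G (w i.*2.-1) (w i.*2).
  by rewrite -{2}(prednK (n := i.*2)) ?(path_adj bp) //; lia.
have a2 : adj G (w i.*2.+1) (w i.*2) by rewrite adjC (path_adj bp) //; lia.
by rewrite -{1}r1 -{3}r2 !lface_rot.
Qed.


Lemma sum_path_edges (H : V * V -> R) :
  \sum_(e in oe | me e) H e = \sum_(j < n.*2) H (w j, w j.+1).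
Proof.
have inj : injective (fun j : 'I_n.*2 => (w j, w j.+1)).
  move=> j k [/(path_inj bp) E _]; apply/val_inj/E; rewrite inE; exact: ltnW.
rewrite -(big_imset _ (in2W inj)); apply: eq_bigl => e; apply/andP/imsetP.
  by case=> _ /path_edgeP[j jn ->]; exists (Ordinal jn).
by case=> j _ ->; rewrite path_edge_oe //; split=> //; apply/path_edgeP; exists j.
Qed.

Lemma sum_pairs m (H : nat -> R) :
  \sum_(j < m.*2) H j = \sum_(i < m) (H i.*2 + H i.*2.+1).
Proof.
elim: m => [|m IH]; first by rewrite !big_ord0.
by rewrite doubleS !big_ord_recr /= IH addrA.
Qed.

Lemma sum_shifted_pairs m (H : nat -> R) :
  \sum_(j < m.+1.*2) H j =
  H 0%N + \sum_(i < m) (H i.*2.+1 + H i.*2.+2) + H m.*2.+1.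
Proof.
elim: m => [|m IH]; first by rewrite !big_ord_recr !big_ord0 /= add0r addr0.
by rewrite doubleS 2!big_ord_recr /= IH big_ord_recr /= !addrA.
Qed.

Local Notation entry := (glued_entry G n w R).
Local Notation rows := (rows G n w).
Local Notation cols := (cols G n w).
Local Notation pcols := (pcols G n w).
Local Notation dcols := (dcols G n w).
Local Notation sg := (path_sign n w R).
Local Notation incidence := (incidence G R).

Lemma sum_pair_bool (T : finType) (A : {set T * bool}) (H : T * bool -> R) :
  \sum_(r in A) H r = \sum_t ((if (t, false) \in A then H (t, false) else 0) +
                              (if (t, true) \in A then H (t, true) else 0)).
Proof.
transitivity (\sum_t \sum_s if (t, s) \in A then H (t, s) else 0).
  by rewrite pair_bigA big_mkcond; apply: eq_bigr => -[].
by apply: eq_bigr => t _; rewrite big_bool addrC.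
Qed.

Lemma sum_rows (H : V * V * bool -> R) :
  \sum_(r in rows) H r =
  \sum_(e in oe) H (e, false) + \sum_(e in oe | ~~ me e) H (e, true).
Proof.
rewrite sum_pair_bool [X in _ = X + _]big_mkcond [X in _ = _ + X]big_mkcond -big_split.
by apply: eq_bigr => e _; rewrite !inE /= andbT.
Qed.

Lemma sum_pcols (H : (V + F) * bool -> R) :
  \sum_(c in pcols) H c =
  \sum_(x | x \notin evens) H (inl x, false) + \sum_(f | f != outer G) H (inr f, true).
Proof.
rewrite sum_pair_bool big_sumType /= [X in _ = X + _]big_mkcond [X in _ = _ + X]big_mkcond.
congr (_ + _); apply: eq_bigr => z _; rewrite !inE /= ?andbF ?andbT.
  by rewrite addr0.
by rewrite add0r.
Qed.

Lemma sum_dcols (H : (V + F) * bool -> R) :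
  \sum_(c in dcols) H c =
  \sum_(x | x \notin evens) H (inl x, true) + \sum_(f | f != outer G) H (inr f, false).
Proof.
rewrite sum_pair_bool big_sumType /= [X in _ = X + _]big_mkcond [X in _ = _ + X]big_mkcond.
congr (_ + _); apply: eq_bigr => z _; rewrite !inE /= ?andbF ?andbT.
  by rewrite add0r.
by rewrite addr0.
Qed.

Lemma sum_vpart (x : (V + F) * bool -> R) s e :
  \sum_(u | u \notin evens) bdv e u * x (inl u, s) = vertex_diff (vertex_part n w x s) e.
Proof.
transitivity (\sum_u bdv e u * vertex_part n w x s u).
  rewrite big_mkcond; apply: eq_bigr => u _; rewrite /vertex_part.
  by case: (u \in evens); rewrite ?mulr0.
have D k : \sum_u (k == u)%:R * vertex_part n w x s u = vertex_part n w x s k.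
  rewrite (bigD1 k) //= eqxx mul1r big1 ?addr0 // => j /negPf.
  by rewrite eq_sym => ->; rewrite mul0r.
by under eq_bigr do rewrite mulrBl; rewrite sumrB !D.
Qed.

Lemma sum_fpart (x : (V + F) * bool -> R) s e :
  \sum_(f | f != outer G) bdf e f * x (inr f, s) = face_diff G (face_part G x s) e.
Proof.
transitivity (\sum_f bdf e f * face_part G x s f).
  rewrite big_mkcond; apply: eq_bigr => u _; rewrite /face_part.
  by case: (u == _); rewrite ?mulr0.
have D k : \sum_u (k == u)%:R * face_part G x s u = face_part G x s k.
  rewrite (bigD1 k) //= eqxx mul1r big1 ?addr0 // => j /negPf.
  by rewrite eq_sym => ->; rewrite mul0r.
by under eq_bigr do rewrite mulrBl; rewrite sumrB !D.
Qed.

Lemma pcols_entry (x : (V + F) * bool -> R) r :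
  \sum_(c in pcols) entry r c * x c =
  if me r.1 then vertex_diff (vertex_part n w x false) r.1 + sg r.1 * face_diff G (face_part G x true) r.1
  else if r.2 then face_diff G (face_part G x true) r.1 else vertex_diff (vertex_part n w x false) r.1.
Proof.
rewrite sum_pcols /entry -sum_vpart -sum_fpart; case: ifP => _ /=.
  congr (_ + _); first by apply: eq_bigr => u _; rewrite mul1r.
  by rewrite mulr_sumr; apply: eq_bigr => u _; rewrite mulrA.
case: r => e [] /=.
  rewrite big1 ?add0r => [|u _]; last by rewrite !mul0r.
  by apply: eq_bigr => f _; rewrite mul1r.
rewrite [X in _ + X]big1 ?addr0 => [|u _]; last by rewrite !mul0r.
by apply: eq_bigr => f _; rewrite mul1r.
Qed.

Lemma dcols_entry (x : (V + F) * bool -> R) r :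
  \sum_(c in dcols) entry r c * x c =
  if me r.1 then face_diff G (face_part G x false) r.1 + sg r.1 * vertex_diff (vertex_part n w x true) r.1
  else if r.2 then vertex_diff (vertex_part n w x true) r.1 else face_diff G (face_part G x false) r.1.
Proof.
rewrite sum_dcols /entry -sum_vpart -sum_fpart; case: ifP => _ /=.
  rewrite addrC; congr (_ + _); first by apply: eq_bigr => u _; rewrite mul1r.
  by rewrite mulr_sumr; apply: eq_bigr => u _; rewrite mulrA.
case: r => e [] /=.
  rewrite [X in _ + X]big1 ?addr0 => [|u _]; last by rewrite !mul0r.
  by apply: eq_bigr => f _; rewrite mul1r.
rewrite big1 ?add0r => [|u _]; last by rewrite !mul0r.
by apply: eq_bigr => f _; rewrite mul1r.
Qed.

Lemma sum_rows_false (y : V * V * bool -> R) z :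
  \sum_(r in rows) y r * entry r (z, false) = \sum_(e in oe) y (e, false) * incidence e z.
Proof.
rewrite sum_rows [X in _ + X]big1 ?addr0 => [|e /andP[_ /negPf m]]; last first.
  by rewrite /entry m /= mul0r mulr0.
by apply: eq_bigr => e _; rewrite /entry /= !mul1r; case: ifP.
Qed.

Lemma sum_rows_true (y : V * V * bool -> R) z :
  \sum_(r in rows) y r * entry r (z, true) =
  \sum_(e in oe) (if me e then sg e * y (e, false) else y (e, true)) * incidence e z.
Proof.
rewrite sum_rows (bigID me) /= [X in _ + X + _]big1 ?addr0 => [|e /andP[_ /negPf m]]; last first.
  by rewrite /entry m /= mul0r mulr0.
rewrite [RHS](bigID me) /=; congr (_ + _); apply: eq_bigr => e /andP[_ m].
  by rewrite /entry m /= mulrA [y _ * _]mulrC.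
by rewrite /entry (negPf m) /= mul1r.
Qed.

Lemma path_signE j : (j < n.*2)%N -> sg (w j, w j.+1) = if odd j then 1 else -1.
Proof. by move=> jn; rewrite /path_sign /= even_in 1?ltnW //; case: odd. Qed.

Lemma path_sign_sqr e : sg e * sg e = 1.
Proof. by rewrite /path_sign; case: ifP; rewrite ?mulrNN mulr1. Qed.

Lemma incidence_orth x f : \sum_(e in oe) bdv e x * bdf e f = 0.
Proof. exact: (bd_orth R planeG oriN). Qed.

Lemma path_edge_bdf j f : (0 < j < n.*2.-1)%N -> odd j ->
  bdf (w j.+1, w j.+2) f = bdf (w j, w j.+1) f.
Proof.
move=> j0 oj; have j2 : j.+1 = (j.+1)./2.*2 by lia.
have [] := @path_lface (j.+1)./2; first by lia.
by rewrite -j2 /= /bdf /= => -> ->.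
Qed.

(** The terms of m_{2i+1} and m_{2i+2} cancel: the two edges share their only endpoint that is a
    column and carry opposite signs. *)
Lemma sum_sign_bdv x y : x \notin evens -> y \notin evens ->
  \sum_(e in oe | me e) sg e * (bdv e x * bdv e y) = 0.
Proof.
move=> xe ye; rewrite sum_path_edges.
rewrite (sum_pairs n (fun j => sg (w j, w j.+1) *
  (bdv (w j, w j.+1) x * bdv (w j, w j.+1) y))); apply: big1 => i _.
have iN := ltn_ord i.
have ev k z : (k <= n)%N -> z \notin evens -> (w k.*2 == z) = false.
  by move=> kn ze; apply/eqP => E; case/evensP: ze; exists k.
rewrite !path_signE /=; [|lia|lia]; rewrite odd_double /= /bdv /=.
rewrite -[i.*2.+2]/(i.+1.*2).
rewrite (ev i x (ltnW iN) xe) (ev i y (ltnW iN) ye) (ev i.+1 x iN xe) (ev i.+1 y iN ye).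
by rewrite !sub0r !subr0 mulrNN mul1r mulN1r addNr.
Qed.

Lemma path_edge_bdf0 f :
  bdf (w 0%N, w 1%N) f = 0 /\ bdf (w n.*2.-1, w n.*2) f = 0.
Proof.
rewrite /bdf /=; have [-> ->] := path_outer0 bp; have [-> ->] := path_outern bp.
by rewrite subrr.
Qed.

(** Here the pairing is shifted by one: m_{2i+2} and m_{2i+3} meet at a vertex of degree two, so
    they have the same faces and opposite signs. The end edges m_1 and m_{2n} have the outer face on
    both sides. *)
Lemma sum_sign_bdf f g :
  \sum_(e in oe | me e) sg e * (bdf e f * bdf e g) = 0.
Proof.
pose H j := sg (w j, w j.+1) * (bdf (w j, w j.+1) f * bdf (w j, w j.+1) g).
have -> : \sum_(e in oe | me e) sg e * (bdf e f * bdf e g) = \sum_(j < n.-1.+1.*2) H j.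
  by rewrite sum_path_edges prednK.
rewrite sum_shifted_pairs /H.
have [-> _] := path_edge_bdf0 f.
have [_ E] := path_edge_bdf0 f.
have -> : n.-1.*2.+1 = n.*2.-1 by lia.
rewrite prednK ?E; last by lia.
rewrite !mul0r !mulr0 addr0 add0r; apply: big1 => i _; have iN := ltn_ord i.
have Ej h : bdf (w i.*2.+2, w i.*2.+3) h = bdf (w i.*2.+1, w i.*2.+2) h.
  by apply: path_edge_bdf; [lia | rewrite /= odd_double].
have S1 : sg (w i.*2.+1, w i.*2.+2) = 1 by rewrite path_signE /= ?odd_double //; lia.
have S2 : sg (w i.*2.+2, w i.*2.+3) = -1 by rewrite path_signE /= ?odd_double //; lia.
by rewrite !Ej S1 S2 mul1r mulN1r subrr.
Qed.

(** Two vertices, or two faces, lie in different copies and share only path rows, where the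
    alternating signs cancel. A vertex and a face lie in the same copy; the path signs there square
    to 1, and boundary and coboundary are orthogonal. *)
Lemma entry_orth c d : c \in pcols -> d \in dcols ->
  \sum_(r in rows) entry r c * entry r d = 0.
Proof.
have ef e z : entry (e, false) (z, false) = incidence e z.
  by rewrite /entry /= !mul1r; case: ifP.
case: c d => [[x|f] []] [[y|g] []]; rewrite !inE /= ?andbF // => xe ye.
- rewrite sum_rows_true /= -[RHS](sum_sign_bdv (x := x) (y := y)) 1?[RHS]big_mkcondr /=.
  + apply: eq_bigr => e _; case: ifP => m; first by rewrite ef /= mulrA.
    by rewrite /entry m /= !mul0r.
  + by move: xe; rewrite andbT.
  + by move: ye; rewrite andbT.
- rewrite sum_rows_false -[RHS](incidence_orth x g).
  by apply: eq_bigr => e _; rewrite ef.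
- rewrite sum_rows_true -[RHS](incidence_orth y f).
  apply: eq_bigr => e _; rewrite /entry /=; case: ifP => m; rewrite ?m.
    by rewrite mulrA path_sign_sqr mul1r mulrC.
  by rewrite mul1r mulrC.
- rewrite sum_rows_false -[RHS](sum_sign_bdf f g) [RHS]big_mkcondr /=.
  apply: eq_bigr => e _; rewrite /entry /=; case: ifP => m; first by rewrite -mulrA.
  by rewrite !mul0r.
Qed.

Local Notation half_cols := (half_cols G n w).
Local Notation vpart := (vertex_part n w).
Local Notation fpart := (face_part G).
Local Notation df := (face_diff G).

Lemma card_pair_bool (T : finType) (A : {set T * bool}) :
  #|A| = (#|[set t | (t, false) \in A]| + #|[set t | (t, true) \in A]|)%N.
Proof.
rewrite -!sum1_card big_mkcond.
transitivity (\sum_t \sum_s if (t, s) \in A then 1 else 0)%N.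
  by rewrite pair_bigA; apply: eq_bigr => -[].
rewrite exchange_big big_bool /= addnC; congr (_ + _)%N; rewrite -big_mkcond /=;
  by apply: eq_bigl => t; rewrite inE.
Qed.

Lemma card_evens : #|evens| = n.+1.
Proof.
rewrite card_imset ?card_ord // => i j /(path_inj bp) E.
by apply/val_inj/double_inj/E; rewrite inE leq_double -ltnS.
Qed.

Lemma card_path_edges : #|[set e in oe | me e]| = n.*2.
Proof.
have -> : [set e in oe | me e] = [set (w j, w j.+1) | j : 'I_n.*2].
  apply/setP => e; apply/setIdP/imsetP => [[_ /path_edgeP[j jn ->]] | [j _ ->]].
    by exists (Ordinal jn).
  by split; [apply: path_edge_oe _ _ | apply/path_edgeP; exists j].
rewrite card_imset ?card_ord // => j k [/(path_inj bp) E _].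
by apply/val_inj/E; rewrite inE ltnW.
Qed.

Lemma card_half_cols : (#|half_cols| + n.+2 = #|V| + #|F|)%N.
Proof.
have -> : #|half_cols| = (#|~: evens| + #|[set~ outer G]|)%N.
  rewrite -!sum1_card big_sumType /=.
  by congr (_ + _)%N; apply: eq_bigl => s; rewrite !inE.
rewrite cardsC1 -card_evens -(cardsC evens).
by have : (0 < #|F|)%N by [apply/card_gt0P; exists (outer G)]; lia.
Qed.

Lemma card_rows : (#|rows| + n.*2 = #|oe|.*2)%N.
Proof.
rewrite card_pair_bool -card_path_edges -addnn.
have -> : [set t | (t, false) \in rows] = oe by apply/setP => e; rewrite !inE /= andbT.
rewrite -addnA; congr (_ + _)%N; rewrite -(cardsID [set e | me e] oe) addnC.
by congr (_ + _)%N; apply: eq_card => e; rewrite !inE //= andbC.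
Qed.

Lemma card_cols : #|cols| = #|half_cols|.*2.
Proof.
by rewrite card_pair_bool -addnn; congr (_ + _)%N; apply: eq_card => e; rewrite !inE.
Qed.

Lemma card_pdcols : #|cols| = (#|pcols| + #|dcols|)%N.
Proof.
rewrite -(cardsID [set c | primal c] cols).
by congr (_ + _)%N; apply: eq_card => e; rewrite !inE // andbC.
Qed.

(* vanishing spreads along the path from its first edge *)
Lemma path_eq0 (p : V -> R) (q : F -> R) :
  (forall x, x \in evens -> p x = 0) ->
  (forall e, me e -> vertex_diff p e + sg e * df q e = 0) ->
  forall e, me e -> [/\ p e.1 = 0, p e.2 = 0 & df q e = 0].
Proof.
move=> pe eq0; have sg0 e : sg e != 0.
  by rewrite /path_sign; case: ifP; rewrite ?oppr_eq0 oner_eq0.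
have eqj j : (j < n.*2)%N ->
    p (w j.+1) - p (w j) + sg (w j, w j.+1) * df q (w j, w j.+1) = 0.
  by move=> jn; apply: (eq0 (w j, w j.+1)); apply/path_edgeP; exists j.
have pe0 i : (i <= n)%N -> p (w i.*2) = 0.
  by move=> iN; apply: pe; apply/evensP; exists i.
have odd0 i : (i < n)%N -> p (w i.*2.+1) = 0.
  elim: i => [_ | i IH iN].
    have := eqj 0%N ltac:(lia); rewrite (pe0 0%N) // /face_diff /=.
    by have [-> ->] := path_outer0 bp; rewrite subrr mulr0 addr0 subr0.
  have := eqj i.*2.+1 ltac:(lia); rewrite -[i.*2.+2]/(i.+1.*2) pe0 ?IH; [|lia|lia].
  rewrite subrr add0r => /eqP; rewrite mulf_eq0 (negPf (sg0 _)) /= => /eqP d0.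
  have := eqj i.+1.*2 ltac:(lia); rewrite pe0 1?subr0; last lia.
  have [lf1 lf2] := path_lface (i := i.+1) ltac:(lia).
  have -> : df q (w i.+1.*2, w i.+1.*2.+1) = df q (w i.*2.+1, w i.+1.*2).
    by rewrite /face_diff /= lf1 lf2.
  by rewrite d0 mulr0 addr0.
have all0 j : (j <= n.*2)%N -> p (w j) = 0.
  move=> jn; rewrite -(odd_double_half j); case oj: (odd j); last by apply: pe0; lia.
  by apply: odd0; lia.
move=> e /path_edgeP[j jn ->] /=; split; [by rewrite all0 // ltnW | by rewrite all0 |].
have := eqj j jn; rewrite !all0 ?(ltnW jn) // subrr add0r => /eqP.
by rewrite mulf_eq0 (negPf (sg0 _)) => /eqP.
Qed.

Hypothesis conn : n_comp (adj G) predT = 1.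

Lemma no_isolated u : exists v, adj G u v.
Proof.
have w01 : adj G (w 0%N) (w 1%N) by apply: (path_adj bp); lia.
have [->|uw] := eqVneq u (w 0%N); first by exists (w 1%N).
pose has_nbr x := [exists v, adj G x v].
have /existsP[v wv] : has_nbr (w 0%N) by apply/existsP; exists (w 1%N).
suff /existsP[v' uv] : has_nbr u by exists v'.
have -> : has_nbr u = has_nbr (w 0%N); last by apply/existsP; exists v.
apply: (vertex_const planeG conn) => x y xy.
have -> : has_nbr x by apply/existsP; exists y.
by apply/esym/existsP; exists x; rewrite adjC.
Qed.

Lemma primal_eq0 (p : V -> R) (q : F -> R) :
  (forall x, x \in evens -> p x = 0) ->
  (forall e, me e -> vertex_diff p e + sg e * df q e = 0) ->
  (forall e, e \in oe -> ~~ me e -> vertex_diff p e = 0) -> forall x, p x = 0.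
Proof.
move=> pe eq0 off x; rewrite -(pe (w 0%N)); last by apply/evensP; exists 0%N.
apply: (vertex_const planeG conn); apply: (oedges_both planeG oriN) => [u v -> //|e eo].
have [m | m] := boolP (me e).
  by have [-> -> _] := path_eq0 pe eq0 m.
by have /eqP := off e eo m; rewrite subr_eq0 eq_sym => /eqP.
Qed.

Lemma dual_eq0 (p : V -> R) (q : F -> R) :
  (forall x, x \in evens -> p x = 0) -> q (outer G) = 0 ->
  (forall e, me e -> vertex_diff p e + sg e * df q e = 0) ->
  (forall e, e \in oe -> ~~ me e -> df q e = 0) -> forall f, q f = 0.
Proof.
move=> pe qo eq0 off f; rewrite -qo.
apply: (face_const planeG no_isolated).
apply: (oedges_both planeG oriN) => [u v -> //|e eo].
have [m | m] := boolP (me e).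
  by have [_ _ /eqP] := path_eq0 pe eq0 m; rewrite subr_eq0 => /eqP.
by have /eqP := off e eo m; rewrite subr_eq0 => /eqP.
Qed.

Lemma vpart_even (x : (V + F) * bool -> R) s u : u \in evens -> vpart x s u = 0.
Proof. by rewrite /vertex_part => ->. Qed.

Lemma fpart_outer (x : (V + F) * bool -> R) s : fpart x s (outer G) = 0.
Proof. by rewrite /face_part eqxx. Qed.

Lemma rowP e s : (e, s) \in rows = (e \in oe) && (s ==> ~~ me e).
Proof. by rewrite inE. Qed.

Lemma pcols_inj (x : (V + F) * bool -> R) :
  (forall r, r \in rows -> \sum_(c in pcols) entry r c * x c = 0) ->
  forall c, c \in pcols -> x c = 0.
Proof.
move=> x0.
have eqM e : me e -> vertex_diff (vpart x false) e + sg e * df (fpart x true) e = 0.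
  move=> m; have := x0 (e, false); rewrite pcols_entry // m; apply.
  by rewrite rowP andbT; case/path_edgeP: m => j jn ->; exact: path_edge_oe _ _.
have p0 : forall u, vpart x false u = 0.
  apply: (primal_eq0 (@vpart_even x false) eqM) => e eo m.
  by have := x0 (e, false); rewrite pcols_entry // (negPf m) rowP andbT; apply.
have q0 : forall f, fpart x true f = 0.
  apply: (dual_eq0 (@vpart_even x false) (fpart_outer x true) eqM) => e eo m.
  by have := x0 (e, true); rewrite pcols_entry // (negPf m) rowP eo m; apply.
case=> [[u | f] []]; rewrite !inE /= ?andbF ?andbT // => z.
  by have := p0 u; rewrite /vertex_part (negPf z).
by have := q0 f; rewrite /face_part (negPf z).
Qed.

Lemma dcols_inj (x : (V + F) * bool -> R) :
  (forall r, r \in rows -> \sum_(c in dcols) entry r c * x c = 0) ->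
  forall c, c \in dcols -> x c = 0.
Proof.
move=> x0.
have eqM e : me e -> vertex_diff (vpart x true) e + sg e * df (fpart x false) e = 0.
  move=> m; have er : (e, false) \in rows.
    by rewrite rowP andbT; case/path_edgeP: m => j jn ->; exact: path_edge_oe _ _.
  (* In dual columns the sign sits on the vertex term; multiplying by it moves it to the face term,
     the form treated by [path_eq0]. *)
  have := congr1 ( *%R (sg e)) (x0 _ er); rewrite dcols_entry // m.
  by rewrite mulr0 mulrDr mulrA path_sign_sqr mul1r addrC.
have p0 : forall u, vpart x true u = 0.
  apply: (primal_eq0 (@vpart_even x true) eqM) => e eo m.
  by have := x0 (e, true); rewrite dcols_entry // (negPf m) rowP eo m; apply.
have q0 : forall f, fpart x false f = 0.
  apply: (dual_eq0 (@vpart_even x true) (fpart_outer x false) eqM) => e eo m.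
  by have := x0 (e, false); rewrite dcols_entry // (negPf m) rowP andbT; apply.
case=> [[u | f] []]; rewrite !inE /= ?andbF ?andbT // => z.
  by have := p0 u; rewrite /vertex_part (negPf z).
by have := q0 f; rewrite /face_part (negPf z).
Qed.

Lemma card_rows_cols : #|rows| = #|cols|.
Proof.
have := card_rows; have := card_half_cols; have := card_cols.
have := card_oedges_euler planeG conn oriN; lia.
Qed.

Lemma pcols_exact (y : V * V * bool -> R) :
  (forall d, d \in dcols -> \sum_(r in rows) y r * entry r d = 0) ->
  exists b, forall r, r \in rows -> y r = \sum_(c in pcols) entry r c * b c.
Proof.
apply: orthogonal_exact pcols_inj dcols_inj _; first by rewrite card_rows_cols card_pdcols.
exact: entry_orth.
Qed.

Lemma dcols_exact (y : V * V * bool -> R) :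
  (forall c, c \in pcols -> \sum_(r in rows) y r * entry r c = 0) ->
  exists b, forall r, r \in rows -> y r = \sum_(d in dcols) entry r d * b d.
Proof.
apply: orthogonal_exact dcols_inj pcols_inj _.
  by rewrite card_rows_cols card_pdcols addnC.
by move=> d c dd cp; under eq_bigr do rewrite mulrC; exact: entry_orth.
Qed.

End Glued.

(** * Signs of the bounded faces on the two sides of the path *)

Section FaceSign.
Variables (V F : finType) (G : drawing V F) (n : nat) (w : nat -> V).
Hypothesis planeG : plane_graph G.
Hypothesis bp : boundary_path G n w.

Let oriN := path_oriN planeG bp.
Let adjC := adjC planeG.

(** [S] consists of the neighbours met after [u] up to and including [v] in the rotation, [K] being
    the first time [v] is reached; so it changes only in stepping from [u] and from [v]. *)
Lemma rot_interval x u v : adj G x u -> adj G x v -> u != v ->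
  exists S : pred V, [/\ S u = false, S v, S (rot G x u), S (rot G x v) = false &
    forall y, adj G x y -> y != u -> y != v -> S y = S (rot G x y)].
Proof.
move=> xu xv uv.
have exK : exists k, iter k (rot G x) u == v.
  by have [k ->] := rot_iter planeG xu xv; exists k.
case: (ex_minnP exK) => K /eqP KE Kmin.
have K_gt0 : (0 < K)%N by case: K KE {Kmin} => // /eqP; rewrite /= (negPf uv).
have it k := rot_iter_adj planeG k xu.
exists (fun y => [exists k : 'I_K, y == iter k.+1 (rot G x) u]); split.
- apply/existsP => -[k /eqP uE]; have kK := ltn_ord k.
  have : (K <= K - k.+1)%N; last by lia.
  by apply: Kmin; rewrite {1}uE -iterD subnK // KE.
- by apply/existsP; exists (Ordinal (ltac:(lia) : K.-1 < K)%N); rewrite /= -iterS prednK // KE.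
- by apply/existsP; exists (Ordinal K_gt0).
- apply/existsP => -[k /eqP /= vE]; have kK := ltn_ord k.
  have : (K <= k)%N; last by lia.
  by apply/Kmin/eqP/esym/(rot_inj planeG (u := x)); rewrite ?inE.
- move=> y xy yu yv; apply/existsP/existsP => -[k /eqP yE]; have kK := ltn_ord k.
    have k1 : (k.+1 < K)%N.
      by rewrite ltn_neqAle kK andbT; apply: contraNneq yv => E; rewrite yE E KE.
    by exists (Ordinal k1); rewrite yE.
  have {}yE : y = iter k (rot G x) u by apply: (rot_inj planeG (u := x)); rewrite ?inE.
  case: k kK yE => [[|k] kn] /= kK yE; first by rewrite yE eqxx in yu.
  by exists (Ordinal (ltnW kK)); rewrite /= yE.
Qed.

Hypothesis conn : n_comp (adj G) predT = 1.
Let no_isol := no_isolated planeG bp conn.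

Definition dual_adj : rel F := fun f g =>
  [&& f != outer G, g != outer G &
      [exists u, exists v, [&& adj G u v, lface G u v == f & lface G v u == g]]].

Lemma dual_adj_sym : symmetric dual_adj.
Proof.
suff h f g : dual_adj f g -> dual_adj g f by move=> f g; apply/idP/idP; apply: h.
case/and3P=> fo go /existsP[u /existsP[v /and3P[uv /eqP uvf /eqP vug]]].
rewrite /dual_adj fo go /=; apply/existsP; exists v; apply/existsP; exists u.
by rewrite adjC uv uvf vug !eqxx.
Qed.

(** [side_cut] at w_{2i+1} gives a set [Y] that contains the other vertices of exactly one of the
    two parts of the path. Bounded faces sharing an edge touch [Y] simultaneously by [side_face], so
    no chain of them leads from one part to the other. *)
Lemma dual_separation (S : pred V) i :
  (i < n)%N ->
  (forall u, adj G (w i.*2.+1) u -> lface G u (w i.*2.+1) != outer G ->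
     S u = S (rot G (w i.*2.+1) u)) ->
  S (w i.*2) != S (w i.*2.+2) ->
  forall u v u' v' j l, (j <= i.*2)%N -> (i.*2 < l)%N -> (l < n.*2)%N ->
  ((u, v) = (w j, w j.+1)) \/ ((v, u) = (w j, w j.+1)) ->
  ((u', v') = (w l, w l.+1)) \/ ((v', u') = (w l, w l.+1)) ->
  lface G u v != outer G -> ~ connect dual_adj (lface G u v) (lface G u' v').
Proof.
move=> iN Sc Sneq u v u' v' j l ji il ln uvj uvl uvo.
have [Y [xY YS Yadj]] := side_cut planeG conn no_isol oriN Sc.
set x := w i.*2.+1 in Sc xY YS Yadj.
have face := side_face planeG conn no_isol oriN Sc xY YS Yadj.
have wx k : (k <= n.*2)%N -> k != i.*2.+1 -> w k != x.
  by move=> kn; apply: contraNneq => /(path_inj bp) -> //; rewrite inE; lia.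
have low k : (k <= i.*2)%N -> (w k \in Y) = S (w i.*2).
  move=> ki; rewrite -YS; last by rewrite adjC; apply: path_adj bp _ _; lia.
  have -> : k = (i.*2 - (i.*2 - k))%N by lia.
  elim: (i.*2 - k)%N (leq_subr k i.*2) => [|d IH] di; first by rewrite subn0.
  rewrite -IH; last by lia.
  have -> : (i.*2 - d = (i.*2 - d.+1).+1)%N by lia.
  by apply: Yadj; [apply: path_adj bp _ _; lia | apply: wx; lia | apply: wx; lia].
have high k : (i.*2.+2 <= k <= n.*2)%N -> (w k \in Y) = S (w i.*2.+2).
  move=> /andP[ik kn]; rewrite -YS; last by apply: path_adj bp _ _; lia.
  have -> : k = (i.*2.+2 + (k - i.*2.+2))%N by lia.
  have : (i.*2.+2 + (k - i.*2.+2) <= n.*2)%N by lia.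
  elim: (k - i.*2.+2)%N => [|d IH] di; first by rewrite addn0.
  rewrite -IH; last by lia.
  rewrite addnS; apply/esym/Yadj; [apply: path_adj bp _ _; lia | apply: wx; lia..].
pose side f := [exists a, exists b, [&& adj G a b, lface G a b == f & (a \in Y) || (b \in Y)]].
have sideE a b : adj G a b -> lface G a b != outer G ->
    side (lface G a b) = (a \in Y) || (b \in Y).
  move=> ab abo; apply/existsP/idP => [[c /existsP[d /and3P[cd /eqP E cdY]]] | abY].
    by rewrite (face a b c d) // E.
  by exists a; apply/existsP; exists b; rewrite ab eqxx.
have side_adj f g : dual_adj f g -> side f = side g.
  case/and3P=> fo go /existsP[a /existsP[b /and3P[ab /eqP E1 /eqP E2]]]; subst f g.
  by rewrite !sideE 1?orbC // adjC.
have uvA : adj G u v.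
  by case: uvj => -[-> ->]; [|rewrite adjC]; apply: path_adj bp _ _; lia.
have uvA' : adj G u' v'.
  by case: uvl => -[-> ->]; [|rewrite adjC]; apply: path_adj bp _ _; lia.
have eq1 : (u \in Y) || (v \in Y) = S (w i.*2).
  have jE : (w j.+1 \in Y) -> S (w i.*2).
    have [-> | jn] := eqVneq j i.*2; first by rewrite (negPf xY).
    by rewrite low //; lia.
  have : (w j \in Y) || (w j.+1 \in Y) = S (w i.*2).
    by rewrite low //; case: (S _) jE => //= jE; apply/negP => /jE.
  by case: uvj => -[-> ->] //; rewrite orbC.
have eq2 : (u' \in Y) || (v' \in Y) = S (w i.*2.+2).
  have lE : (w l \in Y) -> S (w i.*2.+2).
    have [-> | jn] := eqVneq l i.*2.+1; first by rewrite (negPf xY).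
    by rewrite high //; lia.
  have : (w l.+1 \in Y) || (w l \in Y) = S (w i.*2.+2).
    rewrite high; last by lia.
    by case: (S _) lE => //= lE; apply/negP => /lE.
  by case: uvl => -[-> ->] //; rewrite orbC.
move=> /connectP[p dp pE].
have uvo' : lface G u' v' != outer G.
  rewrite pE; elim: p (lface G u v) uvo dp {pE} => //= g p IH f _ /andP[fg gp].
  by apply: IH gp; case/and3P: fg.
case/negP: Sneq; apply/eqP; rewrite -eq1 -eq2 -!sideE // pE.
elim: p (lface G u v) dp {pE uvo} => //= g p IH f /andP[/side_adj -> gp]; exact: IH.
Qed.

Let left j := lface G (w j) (w j.+1).
Let right j := lface G (w j.+1) (w j).

(** The face on a given side is the same before and after an inner even vertex, so a bounded side
    could be lost only at an odd vertex. *)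
Let path_steps (side : nat -> F) j l :
  (forall i, (0 < i < n)%N -> side i.*2 = side i.*2.-1) ->
  (forall i, (i < n)%N -> (j <= i.*2 < l)%N -> side i.*2 != outer G -> side i.*2.+1 != outer G) ->
  (j <= l)%N -> (l < n.*2)%N -> side j != outer G -> side l != outer G.
Proof.
move=> ev od jl ln sj; suff gen d : (j + d <= l)%N -> side (j + d)%N != outer G.
  by rewrite -(subnKC jl) gen // subnKC.
elim: d => [|d IH] dl; first by rewrite addn0.
have {}IH := IH ltac:(lia); rewrite addnS.
have E := odd_double_half (j + d); case o: (odd (j + d)) E => /= E.
  have -> : (j + d).+1 = (j + d)./2.+1.*2 by rewrite -{1}E; lia.
  by rewrite ev; [rewrite doubleS /= -add1n E | lia].
by rewrite -E add0n; apply: od; rewrite ?add0n in E *; [lia | lia | rewrite E].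
Qed.

(* A change of side along the path happens at a vertex separating the faces on the
   two parts of the path. *)
Lemma path_sides_disjoint j l : (j < n.*2)%N -> (l < n.*2)%N ->
  left j != outer G -> right l != outer G -> ~ connect dual_adj (left j) (right l).
Proof.
move=> jn ln lj rl cn.
have adjx i : (i < n)%N -> adj G (w i.*2.+1) (w i.*2) /\ adj G (w i.*2.+1) (w i.*2.+2).
  by move=> iN; split; [rewrite adjC; apply: path_adj bp _ _ | apply: path_adj bp _ _]; lia.
have neqx i : (i < n)%N -> w i.*2 != w i.*2.+2.
  by move=> iN; apply/eqP => /(path_inj bp); rewrite !inE; lia.
case: (ltngtP j l) => [jl | lj' | E]; last first.
- subst l; case: (path_outer bp jn) => E; first by rewrite /left E eqxx in lj.
  by rewrite /right E eqxx in rl.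
- suff rj : right j != outer G.
    case: (path_outer bp jn) => E; first by rewrite /left E eqxx in lj.
    by rewrite /right E eqxx in rj.
  apply: (path_steps (j := l)) => // [i i0 | i iN /andP[li ij] ri | ]; last exact: ltnW.
    have [_ E] := path_lface planeG bp i0; rewrite /right E.
    by rewrite prednK //; lia.
  apply/negP => /eqP ro.
  have lo : left i.*2 = outer G.
    by case: (path_outer bp (j := i.*2) ltac:(lia)) => // E; rewrite /right E eqxx in ri.
  have [a1 a2] := adjx i iN; have [S [S1 S2 _ _ S3]] := rot_interval a1 a2 (neqx i iN).
  apply: (@dual_separation S i iN _ _ (w l.+1) (w l) (w j) (w j.+1) l j) => //.
  + move=> u xu uo; apply: S3 => //; first by apply: contraNneq uo => ->; rewrite -lo.
    by apply: contraNneq uo => ->; rewrite -ro.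
  + by rewrite S1 S2.
  + by right.
  + by left.
  + by rewrite (sym_connect_sym dual_adj_sym).
- suff ll : left l != outer G.
    case: (path_outer bp ln) => E; first by rewrite /left E eqxx in ll.
    by rewrite /right E eqxx in rl.
  apply: (path_steps (j := j)) => // [i i0 | i iN /andP[ji il] li | ]; last exact: ltnW.
    have [E _] := path_lface planeG bp i0; rewrite /left E.
    by rewrite prednK //; lia.
  apply/negP => /eqP lo.
  have ro : right i.*2 = outer G.
    by case: (path_outer bp (j := i.*2) ltac:(lia)) => // E; rewrite /left E eqxx in li.
  have [a1 a2] := adjx i iN.
  have [u1 xu1 E1] := rot_surj planeG a1; have [u2 xu2 E2] := rot_surj planeG a2.
  have u12 : u1 != u2 by apply: contraNneq (neqx i iN) => E; rewrite -E1 -E2 E.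
  have [S [_ _ S1 S2 S3]] := rot_interval xu1 xu2 u12.
  apply: (@dual_separation S i iN _ _ (w j) (w j.+1) (w l.+1) (w l) j l) => //.
  + move=> u xu uo; apply: S3 => //.
      apply: contraNneq uo => ->; rewrite -ro /right -E1 lface_rot //.
      by rewrite adjC.
    apply: contraNneq uo => ->; rewrite -lo /left -E2 lface_rot //.
    by rewrite adjC.
  + by rewrite -E1 -E2 S1 S2.
  + by left.
  + by right.
Qed.

(** [k] is -1 on the dual components reached from the right side of the path and 1 elsewhere;
    [path_sides_disjoint] makes this 1 on the left. These signs balance the vertex terms in the sum
    [rho] used against primal cycles. *)
Lemma face_sign (R : realFieldType) : exists k : F -> R, [/\
  forall f, k f * k f = 1,
  forall u v, adj G u v -> lface G u v != outer G -> lface G v u != outer G ->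
    k (lface G u v) = k (lface G v u),
  forall j, (j < n.*2)%N -> lface G (w j) (w j.+1) != outer G ->
    k (lface G (w j) (w j.+1)) = 1 &
  forall j, (j < n.*2)%N -> lface G (w j.+1) (w j) != outer G ->
    k (lface G (w j.+1) (w j)) = -1].
Proof.
pose onR f := [exists j : 'I_n.*2, (right j != outer G) && connect dual_adj (right j) f].
exists (fun f => if onR f then -1 else 1); split.
- by move=> f; case: ifP; rewrite ?mulrNN mulr1.
- move=> u v uv uo vo; suff -> : onR (lface G u v) = onR (lface G v u) by [].
  have d : dual_adj (lface G u v) (lface G v u).
    by rewrite /dual_adj uo vo; apply/existsP; exists u; apply/existsP; exists v; rewrite uv !eqxx.
  by apply: eq_existsb => j; rewrite (same_connect_r (sym_connect_sym dual_adj_sym) (connect1 d)).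
- move=> j jn lj; rewrite /onR; case: ifP => // /existsP[l /andP[rl c]].
  by case: (path_sides_disjoint jn (ltn_ord l) lj rl); rewrite (sym_connect_sym dual_adj_sym).
- move=> j jn rj; suff -> : onR (lface G (w j.+1) (w j)) by [].
  apply/existsP; exists (Ordinal jn).
  by rewrite /= /right rj connect0.
Qed.

End FaceSign.

(** * Primal cycles *)

Section Incident.
Variables (V F : finType) (G : drawing V F) (n : nat) (w : nat -> V).

(* adjacency in the double graph of an edge-vertex and another vertex *)
Definition glued_incident (r : V * V * bool) (c : (V + F) * bool) : bool :=
  (path_edge n w r.1 || (r.2 == c.2)) &&
  match c.1 with
  | inl x => (r.1.1 == x) || (r.1.2 == x)
  | inr f => (lface G r.1.1 r.1.2 == f) || (lface G r.1.2 r.1.1 == f)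
  end.

End Incident.

Section Acyclicity.
Variables (V F : finType) (G : drawing V F) (n : nat) (w : nat -> V).
Variable R : realFieldType.
Hypothesis planeG : plane_graph G.
Hypothesis bp : boundary_path G n w.
Hypothesis conn : n_comp (adj G) predT = 1.

Local Notation ori := (path_ori n w).
Local Notation oe := (oedges G ori).
Local Notation evens := (evens n w).
Local Notation me := (path_edge n w).
Local Notation bdf := (@face_bd V F G R).
Local Notation entry := (glued_entry G n w R).
Local Notation rows := (rows G n w).
Local Notation cols := (cols G n w).
Local Notation pcols := (pcols G n w).
Local Notation dcols := (dcols G n w).
Local Notation sg := (path_sign n w R).
Local Notation touching := (touching G ori).
Local Notation incident := (glued_incident G n w).
Local Notation vpart := (vertex_part n w).
Local Notation fpart := (face_part G).
Local Notation df := (face_diff G).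
Let n_gt0 : (0 < n)%N := path_gt0 bp.
Let oriN := path_oriN planeG bp.
Let adjC := adjC planeG.
Let no_isol := no_isolated planeG bp conn.

Lemma path_edge_even e : me e ->
  (e.1 \in evens) && (e.2 \notin evens) || (e.1 \notin evens) && (e.2 \in evens).
Proof.
by case/path_edgeP => j jn -> /=; rewrite !(even_in bp) /= ?(ltnW jn) //; case: odd.
Qed.

Lemma path_edge_lface e : me e ->
  lface G e.1 e.2 = outer G \/ lface G e.2 e.1 = outer G.
Proof. by case/path_edgeP => j jn -> /=; exact: path_outer bp _ _. Qed.

Lemma oe_adj e : e \in oe -> adj G e.1 e.2.
Proof. by rewrite inE => /andP[]. Qed.

Lemma oe_path_edge e : me e -> e \in oe.
Proof. by case/path_edgeP => j jn ->; exact: path_edge_oe bp _ _. Qed.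

Lemma sg_neq0 e : sg e != 0.
Proof. by rewrite /path_sign; case: ifP; rewrite ?oppr_eq0 oner_eq0. Qed.

Definition edge_of u v : V * V := if ori u v then (u, v) else (v, u).

Lemma edge_of_oe u v : adj G u v -> edge_of u v \in oe.
Proof.
move=> uv; rewrite /edge_of inE; case: ifP => o /=; first by rewrite uv.
by rewrite adjC uv oriN // o.
Qed.

Lemma oe_edge_of e : e \in oe -> edge_of e.1 e.2 = e /\ edge_of e.2 e.1 = e.
Proof.
by case: e => u v; rewrite inE /edge_of /= => /andP[uv o]; rewrite o oriN // o.
Qed.

Lemma edge_ofP u v : edge_of u v = (u, v) \/ edge_of u v = (v, u).
Proof. by rewrite /edge_of; case: ifP; [left | right]. Qed.

Lemma entry_incident r c : entry r c != 0 -> incident r c.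
Proof.
case: r => [[u v] s]; case: c => [[x|f] t]; rewrite /entry /incident /=; case: ifP => _ /=;
  rewrite ?mulf_eq0 ?negb_or => /andP[h]; rewrite /vertex_bd /face_bd /=.
- by case: (u == x); case: (v == x); rewrite ?orbT ?subrr ?eqxx.
- case: (s == t) h => [_ | ]; last by rewrite eqxx.
  by case: (u == x); case: (v == x); rewrite ?orbT ?subrr ?eqxx.
- by case: (_ == f); case: (_ == f); rewrite ?orbT ?subrr ?eqxx.
- case: (s == t) h => [_ | ]; last by rewrite eqxx.
  by case: (_ == f); case: (_ == f); rewrite ?orbT ?subrr ?eqxx.
Qed.

Lemma entry_face r f t : entry r (inr f, t) != 0 ->
  lface G r.1.1 r.1.2 != lface G r.1.2 r.1.1.
Proof.
apply: contraNneq => E; rewrite /entry /= /face_bd E subrr !mulr0.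
by case: ifP.
Qed.

Variable mu : (V + F) * bool -> V * V * bool.
Hypothesis mu_row : forall c, c \in cols -> mu c \in rows.
Hypothesis mu_inj : {in cols &, injective mu}.
Hypothesis mu_inc : forall c, c \in cols -> incident (mu c) c.

(* A part of the graph attached at one vertex and surrounded by one face has no
   spare edge for a vertex or face outside it. *)
Lemma pendant_overfull (Y : {set V}) z (F' : {set F}) f0 c0 :
  z \notin Y ->
  (forall x y, adj G x y -> x \in Y -> y \notin Y -> y = z) ->
  (forall x y, adj G x y -> (x \in Y) || (y \in Y) ->
     lface G x y != f0 -> lface G x y \in F') ->
  (forall j, (j <= n.*2)%N -> w j \notin Y) ->
  (forall f, f \in F' -> f != outer G) ->
  (forall x y, adj G x y -> lface G x y \in F' -> (x \in Y) || (y \in Y)) ->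
  c0 \in cols -> match c0.1 with inl x => x \notin Y | inr f => f \notin F' end ->
  (mu c0).1 \in touching Y -> False.
Proof.
move=> zY Yz YF Yw Fo FY; case: c0 => z0 s c0c z0N mu0.
have leq := card_touching planeG conn no_isol oriN zY Yz YF.
pose D := [set t | match t with inl x => x \in Y | inr f => f \in F' end] : {set V + F}.
have cardD : #|z0 |: D| = (#|Y| + #|F'|).+1.
  rewrite cardsU1 inE; case: z0 z0N {c0c mu0} => t /negPf /= ->; rewrite add1n; congr _.+1;
  by rewrite -!sum1_card big_sumType /=; congr (_ + _)%N; apply: eq_bigl => u; rewrite inE.
have tN e : e \in touching Y -> ~~ me e.
  rewrite inE => /andP[_ eY]; apply/negP => /path_edgeP[j jn E]; move: eY.
  by rewrite E /= !(negPf (Yw _ _)) // ltnW.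
have Dc t : t \in z0 |: D -> (t, s) \in cols.
  rewrite !inE => /orP[/eqP -> | ]; first by move: c0c; rewrite !inE.
  case: t => [x xY | f /Fo //]; apply/negP => /evensP[i iN E].
  by move: xY; rewrite E (negPf (Yw _ _)) // leq_double.
have Dt t : t \in z0 |: D -> (mu (t, s)).1 \in touching Y.
  move=> tD; have tc := Dc t tD; case/setU1P: tD => [-> // | tD].
  have := mu_row tc; rewrite inE => /andP[to _].
  have ta := oe_adj to; rewrite inE to /=.
  have /andP[_] := mu_inc tc; case: t tD {tc to} ta => [x | f] /=; rewrite inE => tY ta.
    by case/orP=> /eqP ->; rewrite tY ?orbT.
  case/orP=> /eqP E; first by apply: FY; rewrite ?E.
  by rewrite orbC; apply: FY; rewrite ?E // adjC.
have Ds t : t \in z0 |: D -> (mu (t, s)).2 = s.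
  move=> tD; have /andP[] := mu_inc (Dc t tD).
  by rewrite (negPf (tN _ (Dt t tD))) => /eqP.
have inj : {in z0 |: D &, injective (fun t => (mu (t, s)).1)}.
  move=> t u tD uD E; suff [] : (t, s) = (u, s) by [].
  apply: mu_inj; rewrite ?Dc // [LHS]surjective_pairing [RHS]surjective_pairing.
  by rewrite E !Ds.
have : (#|[set (mu (t, s)).1 | t in z0 |: D]| <= #|touching Y|)%N.
  by apply/subset_leq_card/subsetP => e /imsetP[t tD ->]; exact: Dt.
by rewrite card_in_imset // cardD ltnNge leq.
Qed.

Lemma unit_diff (T : eqType) (a b c : T) : a != b -> (a == c) || (b == c) ->
  (b == c)%:R - (a == c)%:R != 0 :> R.
Proof.
move=> ab /orP[/eqP E | /eqP E]; subst c; rewrite eqxx.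
  by rewrite [b == a]eq_sym (negPf ab) sub0r oppr_eq0 oner_neq0.
by rewrite (negPf ab) subr0 oner_neq0.
Qed.

(** The unit flow on an edge with [f] on both sides has zero circulation, so it is a gradient and
    the edge is a bridge. If it were matched with [f], the part beyond it would contradict
    [pendant_overfull]. *)
Lemma bridge_face u v f s : (u, v) \in oe -> ~~ me (u, v) ->
  lface G u v = f -> lface G v u = f -> (inr f, s) \in cols -> (mu (inr f, s)).1 <> (u, v).
Proof.
move=> uvo uvm uvf vuf fc mE; have uv := oe_adj uvo; rewrite /= in uv.
have nuv := adj_neq planeG uv.
pose h (e : V * V) : R := (e == (u, v))%:R - (e == (v, u))%:R.
have hN e : adj G e.1 e.2 -> h (e.2, e.1) = - h e.
  by case: e => x y _; rewrite /h /= opprB !xpair_eqE andbC [(x == u) && _]andbC.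
have [|g go|b b0 bE] := exact_gradient planeG conn no_isol oriN (w 0%N) (h := h).
- exact: hN.
- rewrite /h sumrB.
  have one (e0 : V * V) : adj G e0.1 e0.2 ->
     \sum_(e | adj G e.1 e.2 && (lface G e.1 e.2 == g)) (e == e0)%:R
       = (lface G e0.1 e0.2 == g)%:R :> R.
    move=> a0; rewrite (bigID (pred1 e0)) /= [X in _ + X]big1 ?addr0; last first.
      by move=> e /andP[_ /negPf ->].
    rewrite big_mkcond (bigD1 e0) //= big1 ?addr0 => [|e /negPf ->]; last by rewrite andbF.
    by rewrite a0 !eqxx andbT /=; case: ifP.
  by rewrite !one //= 1?adjC // uvf vuf subrr.
(* The potential jumps only across the edge; as it vanishes at [w 0], [Y] is the side away from the
   path. *)
pose Y := [set x | b x != 0].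
have bC x y : adj G x y -> (x, y) != (u, v) -> (x, y) != (v, u) -> b x = b y.
  move=> xy n1 n2; have /eqP := bE x y xy; rewrite /h (negPf n1) (negPf n2) subrr.
  by rewrite eq_sym subr_eq0 => /eqP.
have buv : b v = b u + 1.
  have /eqP := bE u v uv; rewrite /h eqxx xpair_eqE (negPf nuv) subr0.
  by rewrite eq_sym subr_eq addrC => /eqP.
have Y0 : w 0%N \notin Y by rewrite inE b0 eqxx.
have YC x y : adj G x y -> (x, y) != (u, v) -> (x, y) != (v, u) -> (x \in Y) = (y \in Y).
  by move=> xy n1 n2; rewrite !inE (bC x y).
have one_in : (u \in Y) != (v \in Y).
  apply/negP => /eqP E; have YA x y : adj G x y -> (x \in Y) = (y \in Y).
    have [[-> ->] // | n1] := eqVneq (x, y) (u, v).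
    have [[-> ->] | n2] := eqVneq (x, y) (v, u); first by rewrite E.
    by move=> xy; apply: YC.
  have Yx x : x \notin Y by rewrite -(vertex_const planeG conn YA (w 0%N)).
  have := Yx u; have := Yx v; rewrite !inE !negbK => /eqP v0 /eqP u0.
  by move/eqP: buv; rewrite u0 v0 add0r eq_sym oner_eq0.
pose z := if u \in Y then v else u.
have zY : z \notin Y.
  by rewrite /z; case: ifP one_in => [_ | ->] //; case: (v \in Y).
have other : forall x y, adj G x y -> x \in Y -> y \notin Y -> y = z.
  move=> x y xy xY yY; rewrite /z.
  have [[E1 E2] | n1] := eqVneq (x, y) (u, v); first by subst x y; rewrite xY.
  have [[E1 E2] | n2] := eqVneq (x, y) (v, u); first by subst x y; rewrite (negPf yY).
  by move: yY; rewrite -(YC x y) ?xY.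
have Yw j : (j <= n.*2)%N -> w j \notin Y.
  elim: j => [// | j IH] jn; have jm : me (w j, w j.+1) by apply/path_edgeP; exists j.
  rewrite -(YC (w j)) ?IH ?(ltnW jn) //; first exact: path_adj bp _ _.
    by apply: contraNneq uvm => <-.
  apply/eqP => E; have := path_edge_ori bp jm; rewrite E /= oriN //.
  by move: uvo; rewrite inE /= uv /= => ->.
(* [f] surrounds the pendant part and serves as the exceptional face; [F'] collects the other faces
   touching it. *)
pose F' := [set g | (g != f) && [exists x, exists y,
   [&& adj G x y, lface G x y == g & (x \in Y) || (y \in Y)]]].
have sideN x y : adj G x y -> lface G x y != f -> (x, y) != (u, v) /\ (x, y) != (v, u).
  by move=> xy nf; split; apply: contraNneq nf => -[-> ->]; rewrite ?uvf ?vuf.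
have closed x y : adj G x y -> lface G x y \in F' -> (x \in Y) || (y \in Y).
  move=> xy; rewrite inE => /andP[nf /existsP[x' /existsP[y' /and3P[xy' /eqP E Y']]]].
  suff -> : (x \in Y) || (y \in Y) = (x' \in Y) || (y' \in Y) by [].
  rewrite -E in nf.
  apply: (face_orbit planeG conn no_isol oriN (f := lface G x' y')
     (Q := fun x y => (x \in Y) || (y \in Y))) => // a c ac acf.
  have cr := rot_adj planeG (etrans (adjC c a) ac).
  have [n1 n2] := sideN a c ac ltac:(by rewrite acf).
  have [n3 n4] := sideN _ _ cr ltac:(by rewrite lface_rot // acf).
  by rewrite (YC a c) // (YC c _ cr) // !orbb -(YC c _ cr).
apply: (@pendant_overfull Y z F' f (inr f, s)) => //=.
- move=> x y xy xyY nf; rewrite inE nf; apply/existsP; exists x; apply/existsP; exists y.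
  by rewrite xy eqxx.
- move=> g gF; apply/negP => /eqP go; subst g.
  have a01 : adj G (w 0%N) (w 1%N) by apply: path_adj bp _ _; lia.
  have := closed _ _ a01; rewrite (path_outer0 bp).1 => /(_ gF).
  by rewrite (negPf (Yw 0%N _)) // (negPf (Yw 1%N _)) //; lia.
- by rewrite inE eqxx.
- by rewrite mE inE uvo /=; case: (u \in Y) one_in; case: (v \in Y).
Qed.

(** Adjacency with a zero entry occurs only for an edge with the same face on both sides. On the
    path such a face would be the outer one, which is not a column; off the path [bridge_face]
    excludes it. *)
Lemma mu_entry c : c \in cols -> entry (mu c) c != 0.
Proof.
move=> cc; have := mu_row cc; have := mu_inc cc.
case E : (mu c) => [e s]; rewrite /incident /= => /andP[es inc].
rewrite inE /= => /andP[eo sm]; have ea := oe_adj eo.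
rewrite /entry /=; case: (boolP (me e)) es => [m _ | m /= /eqP es].
  rewrite mulf_neq0 //; first by case: c.2; rewrite ?sg_neq0 ?oner_neq0.
  case: c cc inc {E} => -[x | f] t /= cc inc.
    by apply: unit_diff; rewrite ?(adj_neq planeG).
  rewrite inE inE /= in cc; rewrite /bdf /incidence.
  apply: unit_diff; last by rewrite orbC.
  apply: contraNneq cc => E; case/orP: inc => /eqP <-.
    by case: (path_edge_lface m) => E'; rewrite ?E' // -?E E'.
  by case: (path_edge_lface m) => E'; rewrite ?E' // ?E E'.
rewrite es eqxx mul1r; case: c cc inc E es => -[x | f] t /= cc inc E es.
  by apply: unit_diff; rewrite ?(adj_neq planeG).
apply: unit_diff; last by rewrite orbC.
apply/eqP => E2; have E1 : lface G e.1 e.2 = f by case/orP: inc => /eqP <-.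
case: e eo m E E1 E2 {ea inc sm} => u v eo m E /= E1 E2.
by apply: (bridge_face eo m E1 _ cc); rewrite ?E // E2.
Qed.

Variable k : F -> R.
Hypothesis k_sqr : forall f, k f * k f = 1.
Hypothesis k_dual : forall u v, adj G u v -> lface G u v != outer G ->
  lface G v u != outer G -> k (lface G u v) = k (lface G v u).
Hypothesis k_left : forall j, (j < n.*2)%N -> lface G (w j) (w j.+1) != outer G ->
  k (lface G (w j) (w j.+1)) = 1.
Hypothesis k_right : forall j, (j < n.*2)%N -> lface G (w j.+1) (w j) != outer G ->
  k (lface G (w j.+1) (w j)) = -1.

(** The weights are chosen so that [rho] vanishes on every row meeting two primal columns, as
    [pcols_two] shows. *)
Let kt (c : (V + F) * bool) : R := match c.1 with inl _ => 1 | inr f => k f end.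
Let rho r := \sum_(c in pcols) entry r c * kt c.

(** Off the path, two vertices of weight 1 or two bounded faces of equal weight cancel. On a path
    edge with one bounded side, the value of [k] dictated by that side, times the path sign, cancels
    the term of the odd vertex. Only the outer face spoils this. *)
Lemma rho_root r : r \in rows -> rho r != 0 ->
  if me r.1 then lface G r.1.1 r.1.2 = outer G /\ lface G r.1.2 r.1.1 = outer G
  else r.2 /\ (lface G r.1.1 r.1.2 = outer G \/ lface G r.1.2 r.1.1 = outer G).
Proof.
case: r => [e s]; rewrite inE /= => /andP[eo sm].
have vp u : vpart kt false u = if u \in evens then 0 else 1 by [].
have fp f : fpart kt true f = if f == outer G then 0 else k f by [].
rewrite /rho pcols_entry // /face_diff /vertex_diff !vp !fp; case: ifP => /= [m | /negbT m].
  case/path_edgeP: m => j jn -> /=; rewrite (path_signE R bp) // !(even_in bp) ?(ltnW jn) //=.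
  have [lo | lo] := eqVneq (lface G (w j) (w j.+1)) (outer G);
    have [ro | ro] := eqVneq (lface G (w j.+1) (w j)) (outer G) => //.
  - by rewrite (k_right jn ro); case: (odd j) => /= /eqP[]; ring.
  - by rewrite (k_left jn lo); case: (odd j) => /= /eqP[]; ring.
  - by case: (path_outer bp jn) => E; [rewrite E eqxx in lo | rewrite E eqxx in ro].
have /andP[/negPf e1 /negPf e2] := oe_even planeG bp eo m.
case: s sm => /= [_ | _]; last by rewrite e1 e2 subrr eqxx.
have ea := oe_adj eo.
have [lo | lo] := eqVneq (lface G e.1 e.2) (outer G); first by split=> //; left.
have [ro | ro] := eqVneq (lface G e.2 e.1) (outer G); first by split=> //; right.
by rewrite k_dual // subrr eqxx.
Qed.

(** A path edge has one end that is a column and at most one bounded side; another row meets either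
    its two ends or its two faces, according to its copy. *)
Lemma pcols_pair r : r \in rows -> exists a b, forall c, c \in pcols ->
  entry r c != 0 -> c = a \/ c = b.
Proof.
case: r => [e s]; rewrite inE /= => /andP[eo sm].
have [m | m] := boolP (me e).
  exists (inl (if e.1 \in evens then e.2 else e.1), false).
  exists (inr (if lface G e.1 e.2 == outer G then lface G e.2 e.1 else lface G e.1 e.2), true).
  case=> [[x | f] t]; rewrite !inE /= => /andP[h1 h2] /entry_incident /andP[_] /=.
    move=> inc; left; have := path_edge_even m; case: t h2 => // _.
    case/orP: inc => /eqP E; rewrite E (negPf h1) //=.
    by rewrite ?andbT ?andbF ?orbF ?andTb => ->.
  move=> inc; right; case: t h2 => // _; congr (inr _, true).
  have := path_edge_lface m; case/orP: inc => /eqP E; rewrite E.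
    by rewrite (negPf h1).
  by case=> [-> | E2]; [rewrite eqxx | rewrite E2 eqxx in h1].
case: s sm => /= _.
  exists (inr (lface G e.1 e.2), true); exists (inr (lface G e.2 e.1), true).
  case=> [[x | f] t]; rewrite !inE /= => /andP[h1 h2] /entry_incident /andP[] /=.
    by rewrite (negPf m) /=; case: t h2.
  by case: t h2 => // _ _ /orP[] /eqP ->; [left | right].
exists (inl e.1, false); exists (inl e.2, false).
case=> [[x | f] t]; rewrite !inE /= => /andP[h1 h2] /entry_incident /andP[] /=.
  by case: t h2 => // _ _ /orP[] /eqP ->; [left | right].
by rewrite (negPf m) /=; case: t h2.
Qed.

Lemma pcols_two r c1 c2 : r \in rows -> c1 \in pcols -> c2 \in pcols -> c1 != c2 ->
  entry r c1 != 0 -> entry r c2 != 0 ->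
  (forall c, c \in pcols -> entry r c != 0 -> c = c1 \/ c = c2) /\ rho r = 0.
Proof.
move=> rr p1 p2 n12 e1 e2; split.
  have [a [b ab]] := pcols_pair rr => c pc ec.
  case: (ab _ p1 e1) (ab _ p2 e2) (ab _ pc ec) n12 => -> [] -> [] ->;
    rewrite ?eqxx //; by [left | right].
apply/eqP; apply: contraT => /(rho_root rr).
have := entry_incident e1; have := entry_incident e2; move: rr p1 p2 n12 e1 e2.
case: r => [e s]; case: c1 => [z1 t1]; case: c2 => [z2 t2]; rewrite !inE /incident /=.
case/andP => eo sm; case: ifP => /= [m | /negbT m].
  case: z1 => [x1 | f1] /andP[h1 g1]; case: z2 => [x2 | f2] /andP[h2 g2] n12 _ _ i2 i1 [lo ro].
  - case: t1 g1 n12 => //; case: t2 g2 => // _ _ n12.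
    have := path_edge_even m; case/orP: i1 => /eqP E1; case/orP: i2 => /eqP E2;
    by subst x1 x2; rewrite ?eqxx // in n12; rewrite (negPf h1) (negPf h2).
  - by case/orP: i2 => /eqP E; rewrite -E ?lo ?ro eqxx in h2.
  - by case/orP: i1 => /eqP E; rewrite -E ?lo ?ro eqxx in h1.
  - by case/orP: i1 => /eqP E; rewrite -E ?lo ?ro eqxx in h1.
case: s sm => /= _; last by move=> ? ? ? ? ? ? ? [].
case: z1 => [x1 | f1] /andP[h1 g1]; case: z2 => [x2 | f2] /andP[h2 g2] n12 _ _ /andP[/eqP E2 i2] /andP[/eqP E1 i1] [_ lor]; subst t1 t2 => //.
case/orP: i1 => /eqP E1; case/orP: i2 => /eqP E2; subst f1 f2; rewrite ?eqxx // in n12;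
by case: lor => E; rewrite E eqxx in h1 h2.
Qed.

(** [nx] picks another column of [C] in the row matched with a given one. By minimality [nx]
    permutes [C] in a single cycle. *)
Variables (C : {set (V + F) * bool}) (nx : (V + F) * bool -> (V + F) * bool).
Variable v0 : (V + F) * bool.
Hypothesis v0C : v0 \in C.
Hypothesis C_pcols : forall v, v \in C -> v \in pcols.
Hypothesis nxC : forall v, v \in C -> nx v \in C.
Hypothesis nx_neq : forall v, v \in C -> nx v != v.
Hypothesis nx_entry : forall v, v \in C -> entry (mu v) (nx v) != 0.
Hypothesis C_min : forall D : {set (V + F) * bool}, (forall v, v \in D -> v \in C) ->
  D != set0 -> (forall v, v \in D -> nx v \in D) -> D = C.

Let kt_sqr c : kt c * kt c = 1.
Proof. by rewrite /kt; case: c.1 => // ?; rewrite mulr1. Qed.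

Let kt_neq0 c : kt c != 0.
Proof. by apply/eqP => E; have /eqP := kt_sqr c; rewrite E mulr0 eq_sym oner_eq0. Qed.

Let pcols_cols c : c \in pcols -> c \in cols.
Proof. by rewrite inE => /andP[]. Qed.

Let dcols_cols c : c \in dcols -> c \in cols.
Proof. by rewrite inE => /andP[]. Qed.

Let pd_disjoint c : c \in pcols -> c \in dcols -> False.
Proof. by rewrite !inE => /andP[_ p] /andP[_ /negP]. Qed.

Let mu_ne c : c \in cols -> entry (mu c) c != 0.
Proof. exact: mu_entry. Qed.

Let mu_onto r : r \in rows -> exists2 c, c \in cols & r = mu c.
Proof.
have sub : [set mu c | c in cols] \subset rows.
  by apply/subsetP => _ /imsetP[c cc ->]; exact: mu_row.
have := subset_leqif_card sub; rewrite card_in_imset // (card_rows_cols planeG bp conn).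
case=> _; rewrite eqxx => /esym/subsetP h /h /imsetP[c cc ->]; by exists c.
Qed.

Let nx_onto : nx @: C = C.
Proof.
apply: C_min => [_ /imsetP[v vC ->] | | _ /imsetP[v vC ->]]; first exact: nxC.
  by apply/set0Pn; exists (nx v0); apply: imset_f.
by apply/imset_f/nxC.
Qed.

Let nx_injC : {in C &, injective nx}.
Proof. by apply/imset_injP; rewrite nx_onto. Qed.

Let nx_const (T : eqType) (g : (V + F) * bool -> T) :
  (forall v, v \in C -> g (nx v) = g v) -> forall v, v \in C -> g v = g v0.
Proof.
move=> gnx v vC; have E : [set u in C | g u == g v0] = C.
  apply: C_min => [u | | u]; first by rewrite inE => /andP[].
    by apply/set0Pn; exists v0; rewrite inE v0C eqxx.
  by rewrite !inE => /andP[uC ug]; rewrite nxC // gnx.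
by move: vC; rewrite -{1}E inE => /andP[_ /eqP].
Qed.

Let C_two v : v \in C -> (forall c, c \in pcols -> entry (mu v) c != 0 -> c = v \/ c = nx v) /\
  rho (mu v) = 0.
Proof.
move=> vC; have vp := C_pcols vC; have vc := pcols_cols vp.
apply: (pcols_two (mu_row vc) vp (C_pcols (nxC vC))).
- by rewrite eq_sym nx_neq.
- exact: mu_ne.
- exact: nx_entry.
Qed.

Let C_sum v (x : (V + F) * bool -> R) : v \in C ->
  \sum_(c in pcols) entry (mu v) c * x c =
  entry (mu v) v * x v + entry (mu v) (nx v) * x (nx v).
Proof.
move=> vC; rewrite (bigD1 v) ?C_pcols //= (bigD1 (nx v)) /=; last first.
  by rewrite C_pcols ?nxC ?nx_neq.
rewrite big1 ?addr0 // => c /andP[/andP[cp cv] cn].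
have [-> | e] := eqVneq (entry (mu v) c) 0; first by rewrite mul0r.
by case: ((C_two vC).1 c cp e) cv cn => ->; rewrite eqxx.
Qed.

Let C_rel v : v \in C ->
  entry (mu v) v * kt v + entry (mu v) (nx v) * kt (nx v) = 0.
Proof. by move=> vC; rewrite -C_sum //; exact: (C_two vC).2. Qed.

Let C_quot v : v \in C -> kt v / entry (mu v) v * entry (mu v) (nx v) = - kt (nx v).
Proof.
move=> vC; have := mu_ne (pcols_cols (C_pcols vC)); have := C_rel vC.
have := kt_sqr v; have := kt_sqr (nx v).
set a := entry _ v; set a' := entry _ (nx v); set k1 := kt v; set k2 := kt (nx v).
move=> K2 K1 Ek a0; have E : k1 * a' + a * k2 = 0.
  transitivity (k1 * k2 * (a * k1 + a' * k2)); last by rewrite Ek mulr0.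
  have -> : k1 * k2 * (a * k1 + a' * k2) = a * k2 * (k1 * k1) + a' * k1 * (k2 * k2) by ring.
  by rewrite K1 K2; ring.
apply: (mulfI a0); rewrite mulrCA !mulrA divfK //; apply/eqP.
by rewrite -subr_eq0 mulrN opprK E.
Qed.

(** Each cycle row has just two primal entries and [kt] solves its relation, so the ratio of [x] to
    [kt] passes unchanged from [v] to [nx v]. *)
Let C_const (x : (V + F) * bool -> R) :
  (forall v, v \in C -> \sum_(c in pcols) entry (mu v) c * x c = 0) ->
  forall v, v \in C -> x v = (x v0 * kt v0) * kt v.
Proof.
move=> x0 v vC.
suff E : x v * kt v = x v0 * kt v0 by rewrite -E -mulrA kt_sqr mulr1.
apply: (nx_const (g := fun v => x v * kt v)) vC => u uC.
have := x0 u uC; rewrite C_sum // => Ex; have Ek := C_rel uC.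
have e0 := mu_ne (pcols_cols (C_pcols uC)).
apply: (mulfI e0); move: Ex Ek (kt_sqr u) (kt_sqr (nx u)).
set a := entry _ u; set a' := entry _ (nx u); set x1 := x u; set x2 := x (nx u).
set k1 := kt u; set k2 := kt (nx u) => Ex Ek K1 K2.
have -> : a * (x2 * k2) = (a * k1 + a' * k2) * (x2 * k2 * k1) - a' * x2 * k1 * (k2 * k2) +
  a * x2 * k2 * (1 - k1 * k1) by ring.
have -> : a' * x2 = - (a * x1) by rewrite -[LHS](addKr (a * x1)) Ex addr0.
by rewrite Ek K1 K2; ring.
Qed.

Let offC r c : r \in rows -> c \in pcols -> c \notin C -> entry r c != 0 -> r \notin mu @: C.
Proof.
move=> rr cp cC e; apply/imsetP => -[v vC E]; subst r.
by case: ((C_two vC).1 c cp e) cC => ->; rewrite ?vC ?nxC.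
Qed.

(** The flow along the cycle, scaled so that the row [mu v] gives [kt v] at [v] and [- kt (nx v)] at
    [nx v]; the contributions cancel around the cycle. *)
Let gamma r := \sum_(v in C) (mu v == r)%:R * (kt v / entry (mu v) v).

Let gamma_off r : r \notin mu @: C -> gamma r = 0.
Proof.
move=> rC; apply: big1 => v vC; case: eqP => [E | _]; last by rewrite mul0r.
by case/negP: rC; rewrite -E; apply: imset_f.
Qed.

Let gamma_orth c : c \in pcols -> \sum_(r in rows) gamma r * entry r c = 0.
Proof.
move=> cp; rewrite /gamma; under eq_bigr do rewrite mulr_suml.
rewrite exchange_big /=.
transitivity (\sum_(v in C) ((c == v)%:R * kt c - (c == nx v)%:R * kt c)).
  apply: eq_bigr => v vC; have vc := pcols_cols (C_pcols vC); have e0 := mu_ne vc.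
  rewrite (bigD1 (mu v)) ?mu_row //= eqxx mul1r big1 ?addr0; last first.
    by move=> r /andP[_ /negPf]; rewrite eq_sym => ->; rewrite !mul0r.
  have [-> | cv] := eqVneq c v.
    by rewrite eq_sym (negPf (nx_neq vC)) mul1r mul0r subr0 divfK.
  have [-> | cn] := eqVneq c (nx v).
    by rewrite mul0r mul1r sub0r C_quot.
  suff -> : entry (mu v) c = 0 by rewrite mulr0 !mul0r subrr.
  apply/eqP; apply: contraT => /((C_two vC).1 c cp) [] E; first by rewrite E eqxx in cv.
  by rewrite E eqxx in cn.
rewrite sumrB; apply/eqP; rewrite subr_eq0; apply/eqP.
by rewrite -(big_imset (fun v => (c == v)%:R * kt c) nx_injC) nx_onto.
Qed.

Section Potential.
(** The dual potential whose combination of columns is the flow [gamma]; its support stands for the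
    interior of the cycle. *)
Variable c0 : (V + F) * bool -> R.
Hypothesis c0E : forall r, r \in rows -> gamma r = \sum_(d in dcols) entry r d * c0 d.

Let p := vpart c0 true.
Let q := fpart c0 false.

Let p_even x : x \in evens -> p x = 0. Proof. exact: vpart_even. Qed.
Let q_outer : q (outer G) = 0. Proof. exact: fpart_outer. Qed.

(** Off the cycle the potential is the same, up to sign, at all dual columns met by a row, so any of
    them tells whether the row is inside. *)
Let act (r : V * V * bool) : bool :=
  if me r.1 then (p r.1.1 != 0) || (p r.1.2 != 0)
  else if r.2 then p r.1.1 != 0 else q (lface G r.1.1 r.1.2) != 0.

Let off r : r \in rows -> r \notin mu @: C ->
  if me r.1 then df q r.1 + sg r.1 * vertex_diff p r.1 = 0
  else if r.2 then vertex_diff p r.1 = 0 else df q r.1 = 0.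
Proof.
move=> rr rC; have := c0E rr; rewrite gamma_off // dcols_entry //.
by case: ifP => _ /esym; last case: ifP.
Qed.

(** Off the cycle the jump of [q] and the signed jump of [p] are opposite. On a path edge each jump
    is a single value up to sign, since [p] vanishes at the even end and [q] on the outer face. *)
Let path_act e s : (e, s) \in rows -> (e, s) \notin mu @: C -> me e ->
  [/\ forall f, f != outer G -> (lface G e.1 e.2 == f) || (lface G e.2 e.1 == f) ->
        act (e, s) = (q f != 0) &
      forall x, x \notin evens -> (e.1 == x) || (e.2 == x) -> act (e, s) = (p x != 0)].
Proof.
move=> er eC m; have := off er eC; rewrite /= m /face_diff /vertex_diff => E.
have actV x : x \notin evens -> (e.1 == x) || (e.2 == x) -> act (e, s) = (p x != 0).
  move=> xe ex; rewrite /act /= m; have := path_edge_even m.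
  case/orP: ex => /eqP Ex; rewrite Ex (negPf xe) /= ?andbF ?orbF ?andbT /= => /p_even ->;
  by rewrite eqxx ?orbF.
split=> // f fo ef; have [x [xe ex pE]] : exists x, [/\ x \notin evens,
    (e.1 == x) || (e.2 == x) & p e.2 - p e.1 = p x \/ p e.2 - p e.1 = - p x].
  have := path_edge_even m; case/orP => /andP[h1 h2].
    by exists e.2; rewrite h2 eqxx orbT (p_even h1) subr0; split=> //; left.
  by exists e.1; rewrite h1 eqxx (p_even h2) sub0r; split=> //; right.
rewrite (actV x) //; have qE : q (lface G e.1 e.2) - q (lface G e.2 e.1) = q f \/
    q (lface G e.1 e.2) - q (lface G e.2 e.1) = - q f.
  have := path_edge_lface m; case/orP: ef => /eqP Ef; rewrite Ef => -[] E1.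
  - by rewrite E1 eqxx in fo.
  - by rewrite E1 q_outer subr0; left.
  - by rewrite E1 q_outer sub0r; right.
  - by rewrite E1 eqxx in fo.
have sg0 := sg_neq0 e.
have -> : (p x != 0) = (sg e * (p e.2 - p e.1) != 0).
  by rewrite mulf_eq0 negb_or sg0 /=; case: pE => ->; rewrite ?oppr_eq0.
have -> : (q f != 0) = (q (lface G e.1 e.2) - q (lface G e.2 e.1) != 0).
  by case: qE => ->; rewrite ?oppr_eq0.
by move/eqP: E; rewrite addr_eq0 => /eqP ->; rewrite oppr_eq0.
Qed.

Let act_face e s f : (e, s) \in rows -> (e, s) \notin mu @: C -> me e || ~~ s ->
  f != outer G -> (lface G e.1 e.2 == f) || (lface G e.2 e.1 == f) ->
  act (e, s) = (q f != 0).
Proof.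
move=> er eC; have [m _ | m /= sN] := boolP (me e); first by case: (path_act er eC m) => h _; apply: h.
move=> fo ef; have := off er eC; rewrite /act /= (negPf m) (negPf sN) => /eqP.
by rewrite subr_eq0 => /eqP E; case/orP: ef => /eqP <-; rewrite ?E.
Qed.

Let act_vertex e s x : (e, s) \in rows -> (e, s) \notin mu @: C -> me e || s ->
  x \notin evens -> (e.1 == x) || (e.2 == x) -> act (e, s) = (p x != 0).
Proof.
move=> er eC; have [m _ | m /= sT] := boolP (me e); first by case: (path_act er eC m) => _ h; apply: h.
move=> fo ef; have := off er eC; rewrite /act /= (negPf m) sT => /eqP.
by rewrite subr_eq0 => /eqP E; case/orP: ef => /eqP <-; rewrite ?E.
Qed.

Let act_d r d : r \in rows -> r \notin mu @: C -> d \in dcols -> entry r d != 0 ->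
  (c0 d != 0) = act r.
Proof.
case: r => e s rr rC dd /entry_incident /andP[/= es inc].
case: d dd es inc => [[x | f] t]; rewrite !inE /= => /andP[h1 h2].
  move: h2; rewrite /primal /= negbK => ->; rewrite eqb_id => es inc.
  by rewrite (act_vertex rr rC es h1 inc) /p /vertex_part (negPf h1).
move: h2; rewrite /primal /= => /negPf ->; rewrite eqbF_neg => es inc.
by rewrite (act_face rr rC es h1 inc) /q /face_part (negPf h1).
Qed.

Let E := [set r in rows | (r \notin mu @: C) && act r].

Let EP r : r \in E -> [/\ r \in rows, r \notin mu @: C & act r].
Proof. by rewrite inE => /and3P[]. Qed.

Let rigid := forall v r, v \in pcols -> v \notin C -> r \in E -> entry r v != 0 -> mu v \in E.

Let A := [set d in dcols | c0 d != 0].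
Let W := [set v in pcols | mu v \in E].

(** [mu] maps [A :|: W] onto [E]. Rows on the cycle are matched with columns of [C], hence never
    with dual ones, and a dual column matched with a row off the cycle is in [A] exactly when this
    row is active. *)
Let card_E : #|A :|: W| = #|E|.
Proof.
have sub : {in A :|: W, forall c, c \in cols}.
  by move=> c /setUP[]; rewrite inE => /andP[h _]; [apply: dcols_cols | apply: pcols_cols].
rewrite -(card_in_imset (f := mu)) => [|c d cA dA]; last by apply: mu_inj; apply: sub.
congr #|pred_of_set _|; apply/setP => r; apply/imsetP/idP => [[c cAW ->] | rE].
  have cc := sub c cAW; case/setUP: cAW; rewrite inE => /andP[cd ca] //.
  have cC : mu c \notin mu @: C.
    apply/imsetP => -[v vC Ev]; have cv : c = v.
      by apply: mu_inj => //; apply/pcols_cols/C_pcols.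
    by subst v; apply: pd_disjoint (C_pcols vC) cd.
  by rewrite inE mu_row // cC -(act_d (d := c)) // ?mu_ne // mu_row.
have [rr rC ra] := EP rE; have [c cc rE'] := mu_onto rr; subst r.
exists c => //; rewrite in_setU; case pc: (primal c).
  have cp : c \in pcols by rewrite inE cc.
  by rewrite [c \in W]inE cp rE orbT.
have cd : c \in dcols by rewrite inE cc pc.
by rewrite [c \in A]inE cd (act_d rr rC cd (mu_ne cc)) ra.
Qed.

Let some_A : exists2 d, d \in dcols & c0 d != 0.
Proof.
apply/exists_inP; apply: contraT => /exists_inPn c00.
have v0c := pcols_cols (C_pcols v0C).
have := c0E (mu_row v0c); rewrite big1 => [|d dd]; last first.
  by have := c00 d dd; rewrite negbK => /eqP ->; rewrite mulr0.
rewrite /gamma (bigD1 v0) //= eqxx mul1r big1 ?addr0 => [|v /andP[vC vn]].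
  by move/eqP; rewrite mulf_eq0 invr_eq0 (negPf (kt_neq0 _)) (negPf (mu_ne v0c)).
case: eqP => [Ev | _]; last by rewrite mul0r.
case/eqP: vn; apply: mu_inj Ev => //; exact/pcols_cols/C_pcols.
Qed.

Section Flow.
Hypothesis rigidE : rigid.
Hypothesis no_root : forall y : V * V * bool -> R, (forall r, r \notin E -> y r = 0) ->
  (forall d, d \in dcols -> \sum_(r in rows) y r * entry r d = 0) ->
  (forall c, c \in pcols -> c \notin C -> \sum_(r in rows) y r * entry r c = 0) ->
  \sum_(r in rows) y r * rho r = 0.

(* A vector supported on E, orthogonal to all columns but those of the cycle, is the
   gradient of a potential that is constant on the cycle; its energy is therefore
   proportional to its total flux, which vanishes. *)
Lemma flow_contradiction : False.
Proof.
(* On the rows of [E], off the cycle, the combination with coefficients [c0] is zero. So [x] is in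
   the kernel of the square block of [E] and [A :|: W], and a left kernel vector exists. *)
pose x c := if c \in dcols then c0 c else 0.
have [| | | y [[r1 r1E yr1] yAW]] :=
    @singular_left_kernel R _ _ E (A :|: W) entry x.
- by rewrite card_E.
- have [d dd cd] := some_A; exists d; first by rewrite in_setU [d \in A]inE dd cd.
  by rewrite /x dd.
- move=> r /EP[rr rC _]; rewrite -[RHS](gamma_off rC) c0E //.
  rewrite big_mkcond [RHS]big_mkcond; apply: eq_bigr => c _; rewrite /x.
  case dc: (c \in dcols); last by rewrite mulr0; case: ifP.
  rewrite in_setU [c \in A]inE dc /=; case: eqP => [-> | _] //=; by rewrite mulr0; case: ifP.
pose y' r := if r \in E then y r else 0.
have sumE (H : V * V * bool -> R) : \sum_(r in rows) y' r * H r = \sum_(r in E) y r * H r.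
  rewrite big_mkcond [RHS]big_mkcond; apply: eq_bigr => r _; rewrite /y'.
  case rE: (r \in E); last by rewrite mul0r; case: ifP.
  by have [-> _ _] := EP rE.
(* A dual column outside [A] meets no row of [E], by [act_d]; for primal columns outside [C] and
   [W], [rigidE] plays the same part. *)
have yd d : d \in dcols -> \sum_(r in rows) y' r * entry r d = 0.
  move=> dd; rewrite sumE; have [dA | dA] := boolP (d \in A :|: W); first exact: yAW.
  apply: big1 => r rE; have [rr rC ra] := EP rE.
  have [-> | e] := eqVneq (entry r d) 0; first by rewrite mulr0.
  by case/negP: dA; rewrite in_setU [d \in A]inE dd (act_d rr rC dd e) ra.
have yp c : c \in pcols -> c \notin C -> \sum_(r in rows) y' r * entry r c = 0.
  move=> cp cC; rewrite sumE; have [cA | cA] := boolP (c \in A :|: W); first exact: yAW.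
  apply: big1 => r rE; have [-> | e] := eqVneq (entry r c) 0; first by rewrite mulr0.
  by case/negP: cA; rewrite in_setU [c \in W]inE cp (rigidE cp cC rE e) orbT.
have [b bE] := pcols_exact planeG bp conn yd.
have bC := C_const (x := b) _.
have {}bC v : v \in C -> b v = (b v0 * kt v0) * kt v.
  apply: bC => u uC; rewrite -bE ?mu_row ?pcols_cols ?C_pcols //.
  rewrite /y'; case: ifP => // /EP[_ /negP[]]; exact: imset_f.
have flux (x' : (V + F) * bool -> R) :
    \sum_(r in rows) y' r * (\sum_(c in pcols) entry r c * x' c) =
    \sum_(c in C) x' c * \sum_(r in rows) y' r * entry r c.
  under eq_bigr do rewrite mulr_sumr; rewrite exchange_big /=.
  rewrite (bigID (mem C)) /= [X in _ + X]big1 ?addr0 => [|c /andP[cp cC]].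
    rewrite (eq_bigl (mem C)) => [|c]; last first.
      by rewrite andb_idl // => /C_pcols.
    by apply: eq_bigr => c _; rewrite mulr_sumr; apply: eq_bigr => r _; rewrite mulrA mulrC.
  by under eq_bigr do rewrite mulrA; rewrite -mulr_suml yp // mul0r.
have : \sum_(r in rows) y' r * y' r = 0.
  transitivity (\sum_(r in rows) y' r * (\sum_(c in pcols) entry r c * b c)).
    by apply: eq_bigr => r rr; rewrite {2}bE.
  rewrite flux; transitivity (b v0 * kt v0 * \sum_(r in rows) y' r * rho r).
    rewrite /rho flux mulr_sumr; apply: eq_bigr => c cC.
    by rewrite bC // mulrA.
  by rewrite no_root ?mulr0 // => r /negPf rE; rewrite /y' rE.
move/sum_sqr_eq0 => /(_ r1); have [rr _ _] := EP r1E; move/(_ rr).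
by rewrite /y' r1E => /eqP; rewrite (negPf yr1).
Qed.

End Flow.

Let rho_off r : r \in rows -> rho r != 0 -> r \notin mu @: C.
Proof.
by move=> rr; apply: contraNN => /imsetP[v vC ->]; rewrite (C_two vC).2.
Qed.

Let rho_rootE r : r \in rows -> rho r != 0 ->
  if me r.1 then lface G r.1.1 r.1.2 = outer G /\ lface G r.1.2 r.1.1 = outer G
  else r.2 /\ (lface G r.1.1 r.1.2 = outer G \/ lface G r.1.2 r.1.1 = outer G).
Proof. exact: (rho_root). Qed.

Let flux_expand (y : V * V * bool -> R) (x : (V + F) * bool -> R) :
  (forall c, c \in pcols -> c \notin C -> \sum_(r in rows) y r * entry r c = 0) ->
  (forall c, c \in C -> x c = 0) ->
  \sum_(r in rows) y r * (\sum_(c in pcols) entry r c * x c) = 0.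
Proof.
move=> yp xC; under eq_bigr do rewrite mulr_sumr; rewrite exchange_big /=.
apply: big1 => c cp; under eq_bigr do rewrite mulrA; rewrite -mulr_suml.
have [cC | cC] := boolP (c \in C); first by rewrite xC // mulr0.
by rewrite yp // mul0r.
Qed.

Let E_supp (y : V * V * bool -> R) (H : V * V * bool -> R) :
  (forall r, r \notin E -> y r = 0) ->
  \sum_(r in rows) y r * (if r \in E then H r else 0) = \sum_(r in rows) y r * H r.
Proof.
by move=> y0; apply: eq_bigr => r _; case: ifPn => // /y0 ->; rewrite !mul0r.
Qed.

Let path_root_act e : me e -> lface G e.1 e.2 = outer G -> lface G e.2 e.1 = outer G ->
  (e, false) \in rows -> (e, false) \notin mu @: C -> act (e, false) = false.
Proof.
move=> m lo ro er eC; have := off er eC; rewrite /act /= m /face_diff lo ro subrr add0r.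
move/eqP; rewrite mulf_eq0 (negPf (sg_neq0 e)) /= /vertex_diff subr_eq0 => /eqP pe.
have := path_edge_even m; case/orP => /andP[h1 h2].
  by rewrite pe (p_even h1) eqxx.
by rewrite -pe (p_even h2) eqxx.
Qed.

(* The part of rho on E is the gradient of a potential; this potential vanishes on the
   first copy, hence on the cycle. *)
Let no_root_top x (y : V * V * bool -> R) : (inl x, false) \in C ->
  (forall r, r \notin E -> y r = 0) ->
  (forall c, c \in pcols -> c \notin C -> \sum_(r in rows) y r * entry r c = 0) ->
  \sum_(r in rows) y r * rho r = 0.
Proof.
move=> xC y0 yp; pose rhoE r := if r \in E then rho r else 0.
have rhoE_orth d : d \in dcols -> \sum_(r in rows) rhoE r * entry r d = 0.
  move=> dd; have [cd | cd] := eqVneq (c0 d) 0.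
    apply: big1 => r rr; rewrite /rhoE; case: ifP => [/EP[_ rC ra] | _]; last by rewrite mul0r.
    have [-> | e] := eqVneq (entry r d) 0; first by rewrite mulr0.
    by move: ra; rewrite -(act_d rr rC dd e) cd eqxx.
  transitivity (\sum_(r in rows) rho r * entry r d).
    apply: eq_bigr => r rr; rewrite /rhoE; case: ifPn => // rE.
    have [-> | rr0] := eqVneq (rho r) 0; first by rewrite mul0r.
    have [-> | e] := eqVneq (entry r d) 0; first by rewrite !mulr0.
    by case/negP: rE; rewrite inE rr rho_off //= -(act_d rr (rho_off rr rr0) dd e).
  rewrite /rho; under eq_bigr do rewrite mulr_suml; rewrite exchange_big /=.
  apply: big1 => c cp; under eq_bigr do rewrite mulrAC; rewrite -mulr_suml.
  by rewrite entry_orth // mul0r.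
have [b bE] := pcols_exact planeG bp conn rhoE_orth.
have rho0 e : me e -> rhoE (e, false) = 0.
  move=> m; rewrite /rhoE; case: ifP => // /EP[er eC]; apply: contraTeq => rho0.
  have := rho_rootE er rho0; rewrite /= m => -[lo ro].
  by rewrite path_root_act.
have oe_row e : e \in oe -> (e, false) \in rows by move=> eo; rewrite inE /= eo.
have b_top u : vpart b false u = 0.
  apply: (@primal_eq0 _ _ G n w R planeG bp conn _ (fpart b true)) => [v | e m | e eo m].
  - exact: vpart_even.
  - have er := oe_row _ (oe_path_edge m).
    by have := bE _ er; rewrite rho0 // pcols_entry //= m => /esym.
  - have := bE _ (oe_row _ eo); rewrite pcols_entry //= (negPf m) => <-.
    rewrite /rhoE; case: ifP => // /EP[er eC _]; apply/eqP; apply: contraT => r0.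
    by have := rho_rootE er r0; rewrite /= (negPf m) => -[].
have bx : b (inl x, false) = 0.
  have := b_top x; rewrite /vertex_part; have := C_pcols xC; rewrite !inE /= andbT => /negPf ->.
  by [].
have bC : forall v, v \in C -> b v = 0.
  have h : forall v, v \in C -> b v = (b v0 * kt v0) * kt v.
    apply: C_const => v vC; rewrite -bE ?mu_row ?pcols_cols ?C_pcols //.
    by rewrite /rhoE; case: ifP => // /EP[_ /negP[]]; exact: imset_f.
  have := h _ xC; rewrite bx => /esym/eqP; rewrite mulf_eq0 (negPf (kt_neq0 _)) orbF => /eqP b0.
  by move=> v /h ->; rewrite b0 mul0r.
rewrite -(E_supp rho y0) -[RHS](flux_expand yp bC).
by apply: eq_bigr => r rr; rewrite -bE.
Qed.

(* a cycle inside the second copy surrounds neither the path nor the outer boundary *)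
Let no_root_bottom : (forall x, (inl x, false) \notin C) ->
  forall r, r \in E -> rho r = 0.
Proof.
move=> noV.
(* Without vertices the cycle consists of second-copy faces, and its rows are off-path edges between
   two bounded faces. *)
have muC v : v \in C -> [/\ ~~ me (mu v).1, (mu v).2,
    lface G (mu v).1.1 (mu v).1.2 != outer G & lface G (mu v).1.2 (mu v).1.1 != outer G].
  move=> vC; have isF u : u \in C -> exists2 f, u = (inr f, true) & f != outer G.
    move=> uC; have := C_pcols uC; case: u uC => [[x | f] []] uC; rewrite !inE /= ?andbF ?andbT //.
      by rewrite (negPf (noV x)) in uC.
    by move=> fo; exists f.
  have [f vf fo] := isF v vC; have [g ng go] := isF _ (nxC vC).
  have rr := mu_row (pcols_cols (C_pcols vC)).
  have := entry_incident (nx_entry vC); have := entry_incident (mu_ne (pcols_cols (C_pcols vC))).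
  have fg : g != f by apply: contraNneq (nx_neq vC) => Ef; rewrite ng vf Ef.
  move: rr; move: (mu v) => [e s]; rewrite ng vf /glued_incident inE /= => /andP[eo sm].
  case/andP=> s1 i1 /andP[_ i2].
  have nm : ~~ me e.
    apply/negP => m; have := path_edge_lface m.
    case/orP: i1 => /eqP E1; case/orP: i2 => /eqP E2.
    - by rewrite -E1 -E2 eqxx in fg.
    - by rewrite E1 E2 => -[] E3; [rewrite E3 eqxx in fo | rewrite E3 eqxx in go].
    - by rewrite E1 E2 => -[] E3; [rewrite E3 eqxx in go | rewrite E3 eqxx in fo].
    - by rewrite -E1 -E2 eqxx in fg.
  split=> //; first by move: s1; rewrite (negPf nm) => /eqP ->.
    case/orP: i1 => /eqP E1; case/orP: i2 => /eqP E2; first [by rewrite ?E1 ?E2 | by rewrite -E1 -E2 eqxx in fg].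
  case/orP: i1 => /eqP E1; case/orP: i2 => /eqP E2; first [by rewrite ?E1 ?E2 | by rewrite -E1 -E2 eqxx in fg].
have top_off e : (e, false) \notin mu @: C.
  by apply/imsetP => -[v vC Ev]; have [_] := muC v vC; rewrite -Ev.
have p0 e : me e -> p e.1 = 0 /\ p e.2 = 0.
  move=> m; have [] := @path_eq0 _ _ G n w R planeG bp p q p_even _ e m; last by [].
  move=> e' m'; have er : (e', false) \in rows by rewrite inE /= oe_path_edge.
  have := off er (top_off e'); rewrite /= m' => /(congr1 ( *%R (sg e'))).
  by rewrite mulr0 mulrDr mulrA path_sign_sqr mul1r addrC.
have outer_p u v : adj G u v -> lface G u v = outer G -> p u = p v.
  move=> uv uvo; have [m | m] := boolP (me (edge_of u v)).
    by have [] := p0 _ m; case: (edge_ofP u v) => -> /= -> ->.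
  have er : (edge_of u v, true) \in rows by rewrite inE /= edge_of_oe.
  have eC : (edge_of u v, true) \notin mu @: C.
    apply/imsetP => -[x xC Ex]; have [_ _] := muC x xC; rewrite -Ex /=.
    by case: (edge_ofP u v) => -> /=; rewrite uvo eqxx.
  have := off er eC; rewrite /= (negPf m) /vertex_diff => /eqP; rewrite subr_eq0 => /eqP.
  by case: (edge_ofP u v) => -> /= ->.
(* [p] is constant along edges on the outer face, whose boundary is a single walk through [w 0],
   where [p] vanishes. *)
have outer_p0 u v : adj G u v -> lface G u v = outer G -> p u = 0.
  move=> uv uvo; apply/eqP.
  have w01 : adj G (w 0%N) (w 1%N) by apply: path_adj bp _ _; lia.
  rewrite (face_orbit planeG conn no_isol oriN (f := outer G) (Q := fun a b => p a == 0)
    _ uv uvo w01 (path_outer0 bp).1).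
    by apply/eqP/p_even/evensP; exists 0%N.
  by move=> a b ab abo; rewrite (outer_p a b).
move=> r /EP[rr rC ra]; apply/eqP; apply: contraT => r0.
case: r rr rC ra r0 => e s rr rC ra r0; have := rho_rootE rr r0; rewrite /=.
have := rr; rewrite inE /= => /andP[eo _]; have ea := oe_adj eo.
move: ra; rewrite /act /=; case: ifP => [m | /negbT m].
  by have [-> ->] := p0 e m; rewrite eqxx.
case: s rr rC r0 => [rr rC r0 | _ _ _ _ [] //]; move=> /negP pe [_ [lo | ro]]; case: pe; apply/eqP.
  exact: outer_p0 lo.
by rewrite -(outer_p e.2 e.1) 1?adjC //; apply: outer_p0 ro; rewrite adjC.
Qed.

Let no_root (y : V * V * bool -> R) : (forall r, r \notin E -> y r = 0) ->
  (forall d, d \in dcols -> \sum_(r in rows) y r * entry r d = 0) ->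
  (forall c, c \in pcols -> c \notin C -> \sum_(r in rows) y r * entry r c = 0) ->
  \sum_(r in rows) y r * rho r = 0.
Proof.
move=> y0 _ yp; have [/existsP[x xC] | /existsPn noV] := boolP [exists x, (inl x, false) \in C].
  exact: no_root_top xC y0 yp.
apply: big1 => r _; have [rE | /y0 ->] := boolP (r \in E); last by rewrite mul0r.
by rewrite no_root_bottom ?mulr0.
Qed.

Let vertex_row x u : adj G x u -> (inl x, false) \in pcols -> (inl x, false) \notin C ->
  (edge_of x u, false) \in rows /\ (edge_of x u, false) \notin mu @: C.
Proof.
move=> xu xp xC; have er : (edge_of x u, false) \in rows by rewrite inE /= edge_of_oe.
split=> //; apply: (offC er xp xC); rewrite /glued_entry /= !mul1r if_same /vertex_bd.
have := adj_neq planeG xu; case: (edge_ofP x u) => -> /= ux; rewrite eqxx.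
  by rewrite (eq_sym u) (negPf ux) sub0r oppr_eq0 oner_neq0.
by rewrite (eq_sym u) (negPf ux) subr0 oner_neq0.
Qed.

Let vertex_entry x r : r \in rows -> entry r (inl x, false) != 0 ->
  x \notin evens -> exists2 u, adj G x u & r = (edge_of x u, false).
Proof.
case: r => [[a b] s]; rewrite inE /= => /andP[eo sm] /entry_incident /andP[/= ms inc] xe.
have ea := oe_adj eo; have [E1 E2] := oe_edge_of eo.
have -> : s = false by case: s sm ms => //= /negPf ->.
case/orP: inc => /eqP Ex; subst x.
  by exists b => //; rewrite /= in E1; rewrite E1.
by exists a; [rewrite adjC | rewrite /= in E2; rewrite E2].
Qed.

(** Under these conditions [q] does not jump across any edge at [x]: across path edges because [p]
    vanishes at both ends. Hence [q] is constant on the faces around [x] and decides the activity of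
    all edges there. *)
Let rigid_vertex x u1 u2 : (inl x, false) \in pcols -> (inl x, false) \notin C ->
  (p x = 0 \/ forall u, adj G x u -> ~~ me (edge_of x u)) ->
  adj G x u1 -> adj G x u2 ->
  act (edge_of x u1, false) = act (edge_of x u2, false).
Proof.
move=> xp xC px; have xe : x \notin evens by move: xp; rewrite !inE andbT.
have pm u : adj G x u -> me (edge_of x u) -> p x = 0 /\ p u = 0.
  move=> xu m; split; first by case: px => // h; move: (h u xu); rewrite m.
  apply: p_even; have := path_edge_even m.
  by case: (edge_ofP x u) => -> /=; rewrite (negPf xe) /= ?andbF ?orbF ?andbT.
have q_side u : adj G x u -> q (lface G x u) = q (lface G u x).
  move=> xu; have [er eC] := vertex_row xu xp xC; have := off er eC; rewrite /= /face_diff.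
  case: ifP => [/(pm u xu)[px0 pu0] | _ /eqP]; last first.
    by rewrite subr_eq0 => /eqP; case: (edge_ofP x u) => -> /=.
  by rewrite /vertex_diff; case: (edge_ofP x u) => -> /=; rewrite px0 pu0 subrr mulr0 addr0 => /eqP;
    rewrite subr_eq0 => /eqP.
have q_rot u : adj G x u -> q (lface G x (rot G x u)) = q (lface G x u).
  by move=> xu; have xu' : adj G u x by [rewrite adjC]; rewrite (lface_rot planeG xu') q_side.
have q_const u v : adj G x u -> adj G x v -> q (lface G x u) = q (lface G x v).
  by apply: (rot_const planeG (h := fun u => q (lface G x u))) => u' xu; rewrite q_rot.
have actE u : adj G x u -> act (edge_of x u, false) = (q (lface G x u) != 0).
  move=> xu; rewrite /act /=; case: ifP => [m | _]; last first.
    by case: (edge_ofP x u) => -> //=; rewrite q_side.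
  have [px0 pu0] := pm u xu m.
  have -> : q (lface G x u) = 0.
    by have := path_edge_lface m; case: (edge_ofP x u) => -> /= [] E1;
      rewrite ?q_side // -?q_side ?E1 // q_side ?E1.
  by rewrite eqxx; case: (edge_ofP x u) => -> /=; rewrite px0 pu0 eqxx.
by move=> xu1 xu2; rewrite !actE // (q_const u1 u2).
Qed.

(** Path edges at [x] are active as [p x] is non-zero. Activity changes only across outer corners at
    [x], so the inactive edges lead to a part [Y] attached at [x] alone and away from the path.
    Matching [x] into it would contradict [pendant_overfull]. *)
Let rigid_overfull x u0 : (inl x, false) \in pcols -> (inl x, false) \notin C ->
  p x != 0 -> (exists2 j, (j <= n.*2)%N & x = w j) -> adj G x u0 ->
  mu (inl x, false) = (edge_of x u0, false) -> act (edge_of x u0, false).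
Proof.
move=> xp xC px [j0 j0n xj] xu0 mux; apply: contraT => nact.
have xe : x \notin evens by move: xp; rewrite !inE andbT.
pose S u := ~~ act (edge_of x u, false).
have S_rot u : adj G x u -> lface G u x != outer G -> S u = S (rot G x u).
  move=> xu fo; rewrite /S; congr (~~ _).
  have side u' : adj G x u' -> (lface G u' x == lface G u x) || (lface G x u' == lface G u x) ->
    act (edge_of x u', false) = (q (lface G u x) != 0).
    move=> xu' fe; have [er eC] := vertex_row xu' xp xC; apply: act_face => //.
      by rewrite orbT.
    by case: (edge_ofP x u') => -> /=; rewrite // orbC.
  have xu' : adj G u x by rewrite adjC.
  by rewrite !side ?(lface_rot planeG xu') ?eqxx ?orbT // (rot_adj planeG xu).
have [Y [xY YS Ycut]] := side_cut planeG conn no_isol oriN S_rot.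
have pathS u : adj G x u -> me (edge_of x u) -> u \notin Y.
  move=> xu m; rewrite YS // /S negbK /act /= m.
  by case: (edge_ofP x u) => -> /=; rewrite px ?orbT.
have step j : (j < n.*2)%N -> (w j \in Y) = (w j.+1 \in Y).
  move=> jn; have wj := path_adj bp jn.
  have m : me (w j, w j.+1) by apply/path_edgeP; exists j.
  have eE : edge_of (w j) (w j.+1) = (w j, w j.+1).
    by rewrite /edge_of (path_edge_ori bp m).
  have eE' : edge_of (w j.+1) (w j) = (w j, w j.+1).
    by rewrite /edge_of oriN // (path_edge_ori bp m).
  have [E1 | j1] := eqVneq (w j) x.
    by rewrite E1 (negPf xY); apply/esym/negbTE/pathS; rewrite -E1 // eE.
  have [E2 | j2] := eqVneq (w j.+1) x.
    by rewrite E2 (negPf xY); apply/negbTE/pathS; rewrite -E2 1?adjC // eE'.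
  exact: Ycut.
have pathY0 j : (j <= n.*2)%N -> (w j \in Y) = (w 0%N \in Y).
  by elim: j => // j IH jn; rewrite -step // IH // ltnW.
have pathY j : (j <= n.*2)%N -> w j \notin Y.
  by move=> jn; rewrite pathY0 // -(pathY0 _ j0n) -xj.
pose F' := [set f | (f != outer G) && [exists a, exists b,
  [&& adj G a b, lface G a b == f & (a \in Y) || (b \in Y)]]].
case: (@pendant_overfull Y x F' (outer G)
  (inl x, false)) => //.
- move=> a b ab aY bY; apply/eqP; apply: contraNT bY => bx.
  by rewrite -(Ycut a b) //; apply: contraNneq xY => <-.
- move=> a b ab abY fo; rewrite inE fo; apply/existsP; exists a; apply/existsP; exists b.
  by rewrite ab eqxx.
- by move=> f; rewrite inE => /andP[].
- move=> a b ab; rewrite inE => /andP[fo /existsP[a' /existsP[b' /and3P[ab' /eqP fe]]]].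
  by rewrite (side_face planeG conn no_isol oriN S_rot xY YS Ycut ab' ab fe) // fe.
- exact: pcols_cols.
- rewrite mux !inE /=; have := edge_of_oe xu0; rewrite inE => -> /=.
  have u0Y : u0 \in Y by rewrite YS.
  by case: (edge_ofP x u0) => -> /=; rewrite u0Y ?orbT.
Qed.

(** Consecutive boundary edges of [f] share a dual column, either their common vertex in the second
    copy or [f] in the first, and the whole boundary is one walk by [face_orbit]. *)
Let rigid_face f u1 v1 u2 v2 : (inr f, true) \in pcols -> (inr f, true) \notin C ->
  adj G u1 v1 -> lface G u1 v1 = f -> adj G u2 v2 -> lface G u2 v2 = f ->
  act (edge_of u1 v1, ~~ me (edge_of u1 v1)) = act (edge_of u2 v2, ~~ me (edge_of u2 v2)).
Proof.
move=> fp fC; have fo : f != outer G by move: fp; rewrite !inE andbT.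
have row u v : adj G u v -> (edge_of u v, ~~ me (edge_of u v)) \in rows.
  by move=> uv; rewrite inE /= edge_of_oe //= implybb.
have roff u v : adj G u v -> lface G u v = f ->
    (edge_of u v, ~~ me (edge_of u v)) \notin mu @: C.
  (* With [f] on both sides the entry is zero and [offC] does not apply; but such a row has no
     non-zero primal entry at all, so the cycle cannot use it. *)
  move=> uv uvf; have [vuf | vuf] := eqVneq (lface G v u) f; last first.
    apply: (offC (row u v uv) fp fC); rewrite /glued_entry /=.
    have -> : (if me (edge_of u v) then sg (edge_of u v) * bdf (edge_of u v) f
      else ((~~ me (edge_of u v)) == true)%:R * bdf (edge_of u v) f) =
      (if me (edge_of u v) then sg (edge_of u v) else 1) * bdf (edge_of u v) f.
      by case: (me (edge_of u v)).
    rewrite mulf_neq0 //; first by case: ifP => _; rewrite ?sg_neq0 ?oner_neq0.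
    rewrite /bdf; case: (edge_ofP u v) => -> /=; rewrite uvf eqxx (negPf vuf).
      by rewrite subr0 oner_neq0.
    by rewrite sub0r oppr_eq0 oner_neq0.
  have nm : ~~ me (edge_of u v).
    apply: contraNN fo => m; have := path_edge_lface m.
    by case: (edge_ofP u v) => -> /= []; rewrite ?uvf ?vuf => ->.
  apply/imsetP => -[z zC Ez]; have zp := C_pcols zC.
  have := mu_ne (pcols_cols zp); rewrite -Ez; case: z zC Ez zp => [[x | g] t] zC Ez.
    rewrite !inE /= => /andP[_ tN] /entry_incident.
    by rewrite /glued_incident /= nm (negPf nm); case: t tN zC Ez.
  move=> _ /entry_face /=.
  by case: (edge_ofP u v) => -> /=; rewrite uvf vuf eqxx.
pose Q u v := act (edge_of u v, ~~ me (edge_of u v)).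
move=> a1 f1 a2 f2; apply: (face_orbit planeG conn no_isol oriN (f := f) (Q := Q)) => // u v uv uvf.
have vu : adj G v u by rewrite adjC.
have vr := rot_adj planeG vu.
have vrf : lface G v (rot G v u) = f by rewrite (lface_rot planeG uv).
(* Even vertices are not columns; both edges are then path edges, whose rows also meet the first
   copy of [f]. *)
have [ve | ve] := boolP (v \in evens).
  have m z : adj G v z -> me (edge_of v z) && me (edge_of z v).
    move=> vz; have := even_nbr bp ve vz.
    case/orP=> m; have o := path_edge_ori bp m.
      by rewrite /edge_of o oriN // o /= m.
    by rewrite /edge_of o [ori v z]oriN 1?adjC // o /= m.
  have m1 : me (edge_of u v) by have /andP[] := m u vu.
  have m2 : me (edge_of v (rot G v u)) by have /andP[] := m _ vr.
  have fs a b : lface G a b = f -> (lface G (edge_of a b).1 (edge_of a b).2 == f) ||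
      (lface G (edge_of a b).2 (edge_of a b).1 == f).
    by move=> <-; case: (edge_ofP a b) => -> /=; rewrite eqxx ?orbT.
  by rewrite /Q !(act_face (f := f)) ?row ?roff ?fs ?m1 ?m2.
have ms e : me e || ~~ me e by case: me.
have vs a b : (a == v) || (b == v) -> ((edge_of a b).1 == v) || ((edge_of a b).2 == v).
  by case: (edge_ofP a b) => -> //=; rewrite orbC.
by rewrite /Q !(act_vertex (x := v)) ?row ?roff ?ms ?vs ?eqxx ?orbT.
Qed.

Let rigidE : rigid.
Proof.
move=> v r vp vC /EP[rr rC ra] rv.
have muR := mu_row (pcols_cols vp); have muN := mu_ne (pcols_cols vp).
rewrite inE muR (offC muR vp vC muN) /=.
case: v vp vC rv muR muN => [[x | f] t] vp vC rv muR muN; have := vp; rewrite !inE /=.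
  case: t vp vC rv muR muN => [|] vp vC rv muR muN; first by rewrite /primal andbF.
  case/andP=> xe _.
  have [u1 xu1 Er] := vertex_entry rr rv xe; have [u2 xu2 Emu] := vertex_entry muR muN xe.
  rewrite Emu; rewrite Er in ra.
  have [px | px] := eqVneq (p x) 0.
    by rewrite -(rigid_vertex vp vC _ xu1 xu2) //; left.
  have [/existsP[u /andP[xu m]] | /existsPn noM] :=
    boolP [exists u, adj G x u && me (edge_of x u)].
    apply: rigid_overfull vp vC px _ xu2 Emu.
    have /path_edgeP[j jn Ej] := m.
    case: (edge_ofP x u) => E1; rewrite E1 in Ej; case: Ej => Ex Eu.
      by exists j; first exact: ltnW.
    by exists j.+1.
  rewrite -(rigid_vertex vp vC _ xu1 xu2) //; right=> u xu; have := noM u.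
  by rewrite xu.
case: t vp vC rv muR muN => [|] vp vC rv muR muN; last by rewrite /primal andbF.
move=> _; have repr r' : r' \in rows -> entry r' (inr f, true) != 0 -> exists a b,
    [/\ adj G a b, lface G a b = f & r' = (edge_of a b, ~~ me (edge_of a b))].
  case: r' => [[a b] s]; rewrite inE /= => /andP[eo sm] /entry_incident /andP[/= ms inc].
  have ea := oe_adj eo; have [/= E1 E2] := oe_edge_of eo.
  have sE : s = ~~ me (a, b) by case: s sm ms => /= [-> | ]; last by case: me.
  case/orP: inc => /eqP Ef; first by exists a, b; rewrite E1 sE.
  by exists b, a; rewrite E2 sE adjC.
have [a [b [ab abf Er]]] := repr _ rr rv; have [a' [b' [ab' abf' ->]]] := repr _ muR muN.
by rewrite -(rigid_face vp vC ab abf ab' abf') -Er.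
Qed.

Lemma potential_contradiction : False.
Proof. exact: flow_contradiction rigidE no_root. Qed.

End Potential.
Lemma minimal_cycle_false : False.
Proof.
have [c0 c0E] := dcols_exact planeG bp conn gamma_orth.
exact: (potential_contradiction (c0 := c0)).
Qed.

End Acyclicity.

(** A choice of successors followed by a minimal non-empty closed subset reduces [C] to a single
    cycle, and [face_sign] supplies the weights. *)
Lemma acyclic (V F : finType) (G : drawing V F) n w (R : realFieldType)
    (mu : (V + F) * bool -> V * V * bool) (C : {set (V + F) * bool}) :
  plane_graph G -> boundary_path G n w -> n_comp (adj G) predT = 1 ->
  (forall c, c \in cols G n w -> mu c \in rows G n w) ->
  {in cols G n w &, injective mu} ->
  (forall c, c \in cols G n w -> glued_incident G n w (mu c) c) ->
  C \subset pcols G n w ->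
  (forall v, v \in C -> exists u, [/\ u \in C, u != v & glued_entry G n w R (mu v) u != 0]) ->
  C = set0.
Proof.
move=> planeG bp conn mu_row mu_inj mu_inc CP C_next.
apply/eqP; apply: contraT => C0.
pose nx v := odflt v [pick u | [&& u \in C, u != v & glued_entry G n w R (mu v) u != 0]].
have nxP v : v \in C -> [/\ nx v \in C, nx v != v & glued_entry G n w R (mu v) (nx v) != 0].
  move=> vC; rewrite /nx; case: pickP => [u /and3P[] // | no].
  by have [u [uC uv e]] := C_next v vC; have := no u; rewrite uC uv e.
pose P := fun D : {set (V + F) * bool} =>
  [&& D != set0, D \subset C & [forall v in D, nx v \in D]].
have PC : P C.
  by rewrite /P C0 subxx; apply/forall_inP => v /nxP[].
have [D minD DC] := minset_exists PC.
have /and3P[/set0Pn[v0 v0D] _ /forall_inP Dnx] := minsetp minD.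
have DC' v : v \in D -> v \in C by move/(subsetP DC).
have [k [k1 k2 k3 k4]] := face_sign planeG bp conn R.
case: (minimal_cycle_false planeG bp conn mu_row mu_inj mu_inc k1 k2 k3 k4 v0D
  (fun v vD => subsetP CP v (DC' v vD)) Dnx
  (fun v vD => let: And3 _ h _ := nxP v (DC' v vD) in h)
  (fun v vD => let: And3 _ _ h := nxP v (DC' v vD) in h)).
move=> D' sD D'0 D'nx; have sD' : D' \subset D by apply/subsetP.
apply: (minsetinf minD); last exact: sD'.
by rewrite /P D'0 (subset_trans sD' DC); apply/forall_inP.
Qed.

(** * Counting matchings *)

Section Coherence.
Variables (V F : finType) (G : drawing V F) (n : nat) (w : nat -> V).
Variable R : rcfType.
Hypothesis planeG : plane_graph G.
Hypothesis bp : boundary_path G n w.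
Hypothesis conn : n_comp (adj G) predT = 1.

Local Notation me := (path_edge n w).
Local Notation entry := (glued_entry G n w R).
Local Notation rows := (rows G n w).
Local Notation cols := (cols G n w).
Local Notation pcols := (pcols G n w).
Local Notation dcols := (dcols G n w).
Local Notation incident := (glued_incident G n w).

(** Exchanging the copies, with the path rows fixed, turns dual columns into primal ones and changes
    entries by signs only. *)
Lemma dcols_pair r : r \in rows -> exists a b, forall c, c \in dcols ->
  entry r c != 0 -> c = a \/ c = b.
Proof.
move=> rr; pose flip (c : (V + F) * bool) := (c.1, ~~ c.2).
pose r' := if me r.1 then r else (r.1, ~~ r.2).
have rr' : r' \in rows.
  by rewrite /r'; case: ifPn => // m; move: rr; rewrite !inE /= m !implybT => /andP[-> _].
have [a [b ab]] := pcols_pair R bp rr'; exists (flip a), (flip b) => c cd e.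
have flipK : c = flip (flip c) by case: c {cd e} => [z t]; rewrite /flip /= negbK.
have fp : flip c \in pcols.
  by move: cd; rewrite !inE /primal; case: c {e flipK} => [[x | f] t]; rewrite /= ?negbK.
have fe : entry r' (flip c) != 0.
  move: e; rewrite /r' /glued_entry; case m: (me r.1) => /=; rewrite m.
    by rewrite !mulf_eq0 !negb_or => /andP[_ ->]; case: ifP; rewrite ?sg_neq0 ?oner_neq0.
  by rewrite (inj_eq negb_inj).
by rewrite flipK; case: (ab _ fp fe) => ->; [left | right].
Qed.

Lemma entry_unit r c : entry r c != 0 -> entry r c * entry r c = 1.
Proof.
have s2 := path_sign_sqr n w R r.1.
rewrite /glued_entry => e; have {e} : incidence G R r.1 c.1 != 0 /\
  (me r.1 || (r.2 == c.2)).
  by move: e; case: ifP => _; rewrite mulf_eq0 negb_or => /andP[h ->] //; split=> //=; move: h; case: (r.2 == c.2); rewrite ?eqxx.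
case=> inc sel; have i2 : incidence G R r.1 c.1 * incidence G R r.1 c.1 = 1.
  by move: inc; rewrite /incidence /vertex_bd /face_bd; case: c.1 => z; case: (_ == z); case: (_ == z);
    rewrite ?subrr ?eqxx // ?subr0 ?sub0r ?mulrNN ?mulr1.
case: ifP sel => _ /=; last by move=> ->; rewrite !mul1r.
by case: ifP; rewrite ?mul1r // mulrACA i2 s2 mulr1.
Qed.

Variables (m : nat) (er : 'I_m -> V * V * bool) (ec : 'I_m -> (V + F) * bool).
Hypothesis er_inj : injective er.
Hypothesis er_rows : er @: setT = rows.
Hypothesis ec_inj : injective ec.
Hypothesis ec_cols : ec @: setT = cols.

Definition glued_mx : 'M[R]_m := \matrix_(i, j) entry (er i) (ec j).

Let er_row i : er i \in rows.
Proof. by rewrite -er_rows imset_f. Qed.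

Let ec_col i : ec i \in cols.
Proof. by rewrite -ec_cols imset_f. Qed.

Let sum_er (H : V * V * bool -> R) : \sum_(r in rows) H r = \sum_i H (er i).
Proof.
rewrite -er_rows big_imset /=; last by move=> i j _ _; apply: er_inj.
by apply: eq_bigl => i; rewrite inE.
Qed.

Let ecP c : c \in cols -> exists i, c = ec i.
Proof.
by rewrite -ec_cols => /imsetP[i _ ->]; exists i.
Qed.

Let sum_ec (Q : pred ((V + F) * bool)) (H : (V + F) * bool -> R) :
  \sum_(c in cols | Q c) H c = \sum_(i | Q (ec i)) H (ec i).
Proof.
rewrite big_mkcondr -ec_cols big_imset /=; last by move=> i j _ _; apply: ec_inj.
by rewrite [RHS]big_mkcond; apply: eq_bigl => i; rewrite inE.
Qed.

Let sum_pc (H : (V + F) * bool -> R) :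
  \sum_(c in pcols) H c = \sum_(i | primal (ec i)) H (ec i).
Proof. by rewrite -sum_ec; apply: eq_bigl => c; rewrite inE. Qed.

Let sum_dc (H : (V + F) * bool -> R) :
  \sum_(c in dcols) H c = \sum_(i | ~~ primal (ec i)) H (ec i).
Proof. by rewrite -(sum_ec (fun c => ~~ primal c)); apply: eq_bigl => c; rewrite inE. Qed.

Let ec_p i : (ec i \in pcols) = primal (ec i).
Proof. by rewrite inE ec_col. Qed.

Let ec_d i : (ec i \in dcols) = ~~ primal (ec i).
Proof. by rewrite inE ec_col. Qed.

Let N_orth i j : primal (ec i) != primal (ec j) ->
  \sum_k glued_mx k i * glued_mx k j = 0.
Proof.
have orth a b : primal (ec a) -> ~~ primal (ec b) -> \sum_k glued_mx k a * glued_mx k b = 0.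
  move=> pa pb; rewrite -[RHS](entry_orth R planeG bp (c := ec a) (d := ec b)) ?ec_p ?ec_d //.
  by rewrite sum_er; apply: eq_bigr => k _; rewrite !mxE.
case pi: (primal (ec i)); case pj: (primal (ec j)) => // _; first by rewrite orth ?pi ?pj.
by under eq_bigr do rewrite mulrC; rewrite orth ?pi ?pj.
Qed.

(** In a vanishing combination the primal and dual parts are opposite and orthogonal, so both are
    zero, and each family is independent. *)
Lemma glued_mx_det : \det glued_mx != 0.
Proof.
apply/det_neq0P => x x0.
pose a i := \sum_(j | primal (ec j)) glued_mx i j * x j.
pose b i := \sum_(j | ~~ primal (ec j)) glued_mx i j * x j.
have ab i : b i = - a i.
  by apply/eqP; rewrite -addr_eq0 addrC; apply/eqP; rewrite -[RHS](x0 i) [RHS](bigID (fun j => primal (ec j))).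
have a0 : \sum_i a i * a i = 0.
  transitivity (- \sum_i a i * b i).
    by rewrite -sumrN; apply: eq_bigr => i _; rewrite ab mulrN opprK.
  apply/eqP; rewrite oppr_eq0; apply/eqP.
  transitivity (\sum_i \sum_(j | primal (ec j)) \sum_(k | ~~ primal (ec k))
    x j * x k * (glued_mx i j * glued_mx i k)).
    apply: eq_bigr => i _; rewrite mulr_suml; apply: eq_bigr => j _.
    by rewrite mulr_sumr; apply: eq_bigr => k _; ring.
  rewrite exchange_big big1 //= => j pj; rewrite exchange_big big1 //= => k pk.
  by rewrite -mulr_sumr N_orth ?mulr0 // pj (negPf pk).
have {}a0 i : a i = 0.
  apply: (sum_sqr_eq0 (A := [set: 'I_m]) (y := a)); rewrite ?inE // -[RHS]a0;
  by apply: eq_bigl => j; rewrite inE.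
have b0 i : b i = 0 by rewrite ab a0 oppr0.
pose x' c := if [pick i | ec i == c] is Some i then x i else 0.
have x'E i : x' (ec i) = x i.
  rewrite /x'; case: pickP => [j /eqP/ec_inj -> // | /(_ i)]; by rewrite eqxx.
have rI r : r \in rows -> exists i, r = er i.
  by rewrite -er_rows => /imsetP[i _ ->]; exists i.
move=> j; rewrite -x'E; case pj: (primal (ec j)).
  apply: (pcols_inj planeG bp conn) => [r /rI[i ->] | ]; last by rewrite ec_p pj.
  by rewrite sum_pc -[RHS](a0 i); apply: eq_bigr => l _; rewrite x'E mxE.
apply: (dcols_inj planeG bp conn) => [r /rI[i ->] | ]; last by rewrite ec_d pj.
by rewrite sum_dc -[RHS](b0 i); apply: eq_bigr => l _; rewrite x'E mxE.
Qed.

Section Matching.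
Variable s : 'S_m.
Hypothesis s_inc : forall i, incident (er (s i)) (ec i).

Let mu c := if [pick i | ec i == c] is Some i then er (s i) else (w 0%N, w 0%N, false).

Let muE i : mu (ec i) = er (s i).
Proof. by rewrite /mu; case: pickP => [j /eqP/ec_inj -> // | /(_ i)]; rewrite eqxx. Qed.

Let mu_row c : c \in cols -> mu c \in rows.
Proof. by case/ecP => i ->; rewrite muE. Qed.

Let mu_inj : {in cols &, injective mu}.
Proof.
by move=> _ _ /ecP[i ->] /ecP[j ->]; rewrite !muE => /er_inj/perm_inj ->.
Qed.

Let mu_inc c : c \in cols -> incident (mu c) c.
Proof. by case/ecP => i ->; rewrite muE. Qed.

Let d i := glued_mx (s i) i.

Let d_unit i : d i * d i = 1.
Proof.
rewrite /d mxE entry_unit //; have := mu_entry R planeG bp conn mu_row mu_inj mu_inc (ec_col i).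
by rewrite muE.
Qed.

Let P := \matrix_(i, j) (d i * glued_mx (s i) j).

Let det_P : \det P = (-1) ^+ s * (\prod_i d i) * \det glued_mx.
Proof.
have -> : P = diag_mx (\row_i d i) *m row_perm s glued_mx.
  by apply/matrixP => i j; rewrite mul_diag_mx !mxE.
rewrite det_mulmx det_diag row_permE det_mulmx det_perm mulrCA mulrA.
by congr (_ * _ * _); apply: eq_bigr => i _; rewrite mxE.
Qed.

Let prod_unit : (\prod_i d i) * (\prod_i d i) = 1.
Proof. by rewrite -big_split big1 // => i _; exact: d_unit. Qed.

Let P_offdiag i j : P i j != 0 -> `|P i j| = 1 /\ entry (er (s i)) (ec j) != 0.
Proof.
rewrite mxE => h; have e : entry (er (s i)) (ec j) != 0.
  by apply: contraNneq h => h; rewrite mxE h mulr0.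
split=> //; apply/eqP; rewrite -(@eqrXn2 _ 2) ?normr_ge0 ?ler01 // expr1n -normrX.
by rewrite exprMn !expr2 d_unit mul1r mxE entry_unit // normr1.
Qed.

(* an entry of largest absolute value within its kind is balanced by the only other
   entry of that kind in its row, so the extremal columns form a cycle *)
Lemma sign_coherence : 0 < (-1) ^+ s * (\prod_i d i) * \det glued_mx.
Proof.
have diag i : entry (er (s i)) (ec i) != 0.
  have := mu_entry R planeG bp conn mu_row mu_inj mu_inc (ec_col i); by rewrite muE.
(* The diagonal entry accounts for one of the at most two columns of its kind in the row, which
   leaves one. *)
have pair i : exists a, forall j, j != i -> primal (ec j) == primal (ec i) ->
    P i j != 0 -> j = a.
  have [a [b ab]] : exists a b, forall j, primal (ec j) == primal (ec i) ->
      entry (er (s i)) (ec j) != 0 -> ec j = a \/ ec j = b.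
    case pi: (primal (ec i)).
      have [a [b ab]] := pcols_pair R bp (er_row (s i)).
      by exists a, b => j /eqP pj; apply: ab; rewrite ec_p pj.
    have [a [b ab]] := dcols_pair (er_row (s i)).
    by exists a, b => j /eqP pj; apply: ab; rewrite ec_d pj.
  have [j0 /and3P[n0 p0 e0] | no] := pickP [pred j | [&& j != i, primal (ec j) == primal (ec i) & P i j != 0]].
    exists j0 => j ji pj ej; apply: ec_inj.
    have [_ ej'] := P_offdiag ej; have [_ e0'] := P_offdiag e0.
    have nij := inj_eq ec_inj.
    move: (ab _ pj ej') (ab _ p0 e0') (ab i (eqxx _) (diag i)).
    move: ji n0; rewrite -!nij => ji n0.
    case=> Ej [] E0 [] Ei; rewrite ?Ej ?E0 //;
      by rewrite ?Ej ?E0 ?Ei ?eqxx // in ji n0.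
  by exists i => j ji pj ej; move: (no j); rewrite /= ji pj ej.
rewrite -det_P; apply: (det_gt0_orthogonal (V := fun i => primal (ec i))).
- by move=> i; rewrite mxE d_unit.
- move=> i j ij; rewrite -[RHS](N_orth ij) [RHS](reindex_inj (@perm_inj _ s)) /=.
  by apply: eq_bigr => k _; rewrite !mxE mulrACA d_unit mul1r.
- move=> i; have [a ha] := pair i.
  have [ha' | ha'] := boolP ((a != i) && (primal (ec a) == primal (ec i))).
    rewrite (bigD1 a) //= big1 => [|j /andP[/andP[ji pj] ja]].
      rewrite addr0; have [-> | /P_offdiag[->]//] := eqVneq (P i a) 0.
      by rewrite normr0 ler01.
    by apply/normr0P; apply: contraNT ja => e; apply/eqP; apply: ha; rewrite ?normr_eq0 in e.
  rewrite big1 ?ler01 // => j /andP[ji pj]; apply/normr0P; apply: contraNT ha' => e.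
  by rewrite -(ha j) // ?ji.
- move=> x xF Px0.
  have [/existsP[j1 j1x] | /existsPn x0] := boolP [exists j, x j != 0]; last first.
    by move=> j; have := x0 j; rewrite negbK => /eqP.
  have [j0 _ j0max] := @arg_maxP _ R _ j1 predT (fun j => `|x j|) erefl.
  have xj0 : x j0 != 0.
    by rewrite -normr_gt0; apply: lt_le_trans (j0max j1 isT); rewrite normr_gt0.
  have xp j : x j != 0 -> primal (ec j).
    by apply: contraNT => /xF ->.
  pose C := [set ec j | j : 'I_m & `|x j| == `|x j0|].
  have C0 : C = set0; last first.
    have : ec j0 \in C by apply/imsetP; exists j0; rewrite ?inE.
    by rewrite C0 inE.
  have inC j : ec j \in C -> `|x j| = `|x j0|.
    by case/imsetP => j'; rewrite inE => /eqP E /ec_inj ->.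
  apply: (acyclic (R := R) planeG bp conn mu_row mu_inj mu_inc).
    apply/subsetP => c /imsetP[j]; rewrite inE => /eqP Ej ->; rewrite ec_p xp //.
    by rewrite -normr_gt0 Ej normr_gt0.
  move=> c /imsetP[i]; rewrite inE => /eqP Ei ->.
  have xi : x i != 0 by rewrite -normr_gt0 Ei normr_gt0.
  have Pii : P i i = 1 by rewrite mxE d_unit.
  have := Px0 i (xp i xi); rewrite (bigD1 i) //= Pii mul1r => E.
  have [a ha] := pair i.
  have [ha' | ha'] := boolP [&& a != i, primal (ec a) == primal (ec i) & P i a != 0].
    have /and3P[ai pa ea] := ha'; exists (ec a); rewrite muE (inj_eq ec_inj) ai.
    have [Pa ->] := P_offdiag ea; split=> //; apply/imsetP; exists a => //.
    rewrite inE -Ei; move: E; rewrite (bigD1 a) //= big1 => [|j /andP[ji ja]].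
      by rewrite addr0 => /eqP; rewrite addr_eq0 => /eqP ->; rewrite normrN normrM Pa mul1r.
    have [-> | xj] := eqVneq (x j) 0; first by rewrite mulr0.
    have [-> | pj] := eqVneq (P i j) 0; first by rewrite mul0r.
    by rewrite (ha j) ?eqxx // ?(xp j xj) ?(xp i xi) in ja.
  move: E; rewrite big1 ?addr0 => [E | j ji]; first by rewrite E eqxx in xi.
  have [-> | xj] := eqVneq (x j) 0; first by rewrite mulr0.
  have [-> | pj] := eqVneq (P i j) 0; first by rewrite mul0r.
  by case/negP: ha'; rewrite -(ha j) // ?ji ?pj ?(xp j xj) ?(xp i xi).
- by rewrite det_P !mulf_neq0 ?signr_eq0 ?glued_mx_det //; apply: contraTneq isT => E;
    have := prod_unit; rewrite E mul0r => /eqP; rewrite eq_sym oner_eq0.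
Qed.

Lemma matching_term : (-1) ^+ s * (\prod_i glued_mx (s i) i) = Num.sg (\det glued_mx).
Proof.
have := sign_coherence; change ((-1) ^+ s * \prod_i glued_mx (s i) i) with ((-1) ^+ s * \prod_i d i).
set t := (-1) ^+ s * _ => tN.
have t2 : t * t = 1 by rewrite /t mulrACA prod_unit -expr2 sqrr_sign mulr1.
have [t1 | t1] : t = 1 \/ t = -1.
  by have /eqP := t2; rewrite -expr2 sqrf_eq1 => /orP[] /eqP; [left | right].
- by move: tN; rewrite t1 mul1r => /gtr0_sg ->.
- by move: tN; rewrite t1 mulN1r oppr_gt0 => /ltr0_sg ->.
Qed.

End Matching.

(** The Leibniz formula is used for the transpose because [s] sends columns to rows. A permutation
    that is no matching has a zero factor; the others contribute the sign of the determinant. *)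
Lemma matching_count :
  #|[set s : 'S_m | [forall i, incident (er (s i)) (ec i)]]|%:R = `|\det glued_mx|.
Proof.
suff E : \det glued_mx =
    #|[set s : 'S_m | [forall i, incident (er (s i)) (ec i)]]|%:R * Num.sg (\det glued_mx).
  by have := congr1 Num.norm E; rewrite normrM normr_sg glued_mx_det mulr1 normr_nat => ->.
rewrite -[LHS]det_tr.
rewrite /determinant (bigID (fun s : 'S_m => [forall i, incident (er (s i)) (ec i)])) /=.
rewrite [X in _ + X]big1 ?addr0 => [|s /forallPn[i ni]].
  rewrite -sum1dep_card natr_sum mulr_suml; apply: eq_bigr => s /forallP s_inc.
  rewrite mul1r -(matching_term s_inc); congr (_ * _).
  by apply: eq_bigr => i _; rewrite mxE.
rewrite (bigD1 i) //= !mxE.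
have -> : entry (er (s i)) (ec i) = 0.
  by apply/eqP; apply: contraNT ni => /entry_incident.
by rewrite mul0r mulr0.
Qed.

End Coherence.

(** The factor with [D] combines the off-path rows of the two copies and keeps the path rows. The
    result is the block diagonal matrix of [X] and [Y] times the sum and difference matrix; their
    factors [2 ^+ p] and [2 ^+ (p + n)] leave [2 ^+ n]. *)
Lemma det_glued_block (R : realFieldType) p n (A : 'M[R]_(p, p + n)) (a1 a2 : 'M[R]_(n, p + n)) :
  \det (block_mx (col_mx A a1) (col_mx 0 (- a1)) (col_mx 0 a2) (col_mx A a2)) =
  2 ^+ n * (\det (col_mx A a1) * \det (col_mx A a2)).
Proof.
set N := block_mx _ _ _ _; set X := col_mx A a1; set Y := col_mx A a2.
pose D : 'M[R]_(p + n) := block_mx 1%:M 0 0 0.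
have DE (B : 'M[R]_(p, p + n)) (b : 'M[R]_(n, p + n)) : D *m col_mx B b = col_mx B 0.
  by rewrite mul_block_col mul1mx !mul0mx !addr0.
have LN : block_mx 1%:M (- D) D 1%:M *m N =
    block_mx X 0 0 Y *m block_mx 1%:M (- 1%:M) 1%:M 1%:M.
  rewrite !mulmx_block !mul1mx !mulNmx !DE !mul0mx !mulmxN !mulmx1 !addr0 !add0r.
  by rewrite /X /Y !opp_col_mx !add_col_mx !oppr0 !addr0 !add0r.
have DD : D *m D = D by rewrite mulmx_block !mul1mx !mul0mx !addr0.
have detL : \det (block_mx 1%:M (- D) D 1%:M) = 2 ^+ p.
  have -> : block_mx 1%:M (- D) D 1%:M = block_mx 1%:M 0 D 1%:M *m block_mx 1%:M (- D) 0 (1%:M + D).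
    by rewrite mulmx_block !mul1mx !mulmx1 !mulmx0 !mul0mx !addr0 mulmxN DD addrC addrK.
  rewrite det_mulmx det_lblock det_ublock !det1 !mul1r.
  have -> : 1%:M + D = block_mx 2%:M 0 0 1%:M.
    rewrite scalar_mx_block add_block_mx !addr0; congr (block_mx _ _ _ _).
    by rewrite -(raddfD (@scalar_mx R p)).
  by rewrite det_ublock det_scalar det1 mulr1.
have detQ : \det (block_mx 1%:M (- 1%:M) 1%:M 1%:M : 'M[R]_(p + n + (p + n))) = 2 ^+ (p + n).
  have -> : block_mx 1%:M (- 1%:M) 1%:M 1%:M =
      block_mx 1%:M 0 1%:M 1%:M *m block_mx 1%:M (- 1%:M) 0 2%:M :> 'M[R]_(p + n + (p + n)).
    rewrite mulmx_block !mul1mx !mulmx0 !mul0mx !addr0; congr (block_mx _ _ _ _).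
    by rewrite -raddfN -(raddfD (@scalar_mx R (p + n))); congr (_%:M); ring.
  by rewrite det_mulmx det_lblock det_ublock !det1 !mul1r det_scalar.
have := congr1 determinant LN; rewrite !det_mulmx detL detQ det_ublock exprD => E.
have n0 : 2 ^+ p != 0 :> R by rewrite expf_eq0 pnatr_eq0 andbF.
by apply: (mulfI n0); rewrite E; ring.
Qed.

Lemma sum_shift (R : nzRingType) m (i : 'I_m) (f g : nat -> R) : f 0%N = 0 ->
  (forall l, (l.+1 < m)%N -> f l.+1 = g l) ->
  \sum_(l < m) (l <= i)%N%:R * f l = \sum_(l < m) (l < i)%N%:R * g l.
Proof.
case: m i => [[] // | m] i f0 fg; rewrite big_ord_recl [RHS]big_ord_recr /= f0 mulr0 add0r.
rewrite [(m < i)%N]ltnNge -ltnS ltn_ord mul0r addr0.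
by apply: eq_bigr => l _; rewrite fg // ltnS.
Qed.

(** * Block form of the glued matrix and the number of matchings *)

Section CountSquare.
Variables (V F : finType) (G : drawing V F) (n : nat) (w : nat -> V).
Hypothesis planeG : plane_graph G.
Hypothesis bp : boundary_path G n w.
Hypothesis conn : n_comp (adj G) predT = 1.

Local Notation ori := (path_ori n w).
Local Notation oe := (oedges G ori).
Local Notation evens := (evens n w).
Local Notation me := (path_edge n w).
Local Notation rows := (rows G n w).
Local Notation cols := (cols G n w).
Local Notation half_cols := (half_cols G n w).

Let E0 := [set e in oe | ~~ me e].
Let p := #|E0|.

Let card_half : (p + n)%N = #|half_cols|.
Proof.
have := card_half_cols bp; have := card_oedges_euler planeG conn (path_oriN planeG bp).
have := card_path_edges bp; rewrite -(cardsID [set e | me e] oe).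
have -> : oe :&: [set e | me e] = [set e in oe | me e] by apply/setP => e; rewrite !inE.
have -> : oe :\: [set e | me e] = E0 by apply/setP => e; rewrite !inE andbC.
rewrite -/p => E1 E2 E3; apply: (@addIn n.+2); rewrite E3 E2 E1; lia.
Qed.

Let hc (j : 'I_(p + n)) : V + F := enum_val (cast_ord card_half j).

Let hcP j : hc j \in half_cols. Proof. exact: enum_valP. Qed.

Let hc_inj : injective hc.
Proof. by move=> i j /enum_val_inj/cast_ord_inj. Qed.

Let hc_onto : hc @: setT = half_cols.
Proof.
apply/setP => z; apply/imsetP/idP => [[j _ ->] // | zh].
by exists (cast_ord (esym card_half) (enum_rank_in zh z)); rewrite // /hc cast_ordKV enum_rankK_in.
Qed.

(** With [b] false the path part lists the m_j with [j] odd, with [b] true those with [j] even; each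
    m_j thus occurs in one half of the rows only. *)
Let half_edge (i : 'I_(p + n)) (b : bool) : V * V :=
  match split i with
  | inl a => enum_val a
  | inr j => if b then (w j.*2.+1, w j.*2.+2) else (w j.*2, w j.*2.+1)
  end.

Let er (i : 'I_(p + n + (p + n))) : V * V * bool :=
  match split i with
  | inl j => (half_edge j false, false)
  | inr j => (half_edge j true, if split j is inl _ then true else false)
  end.

Let ec (i : 'I_(p + n + (p + n))) : (V + F) * bool :=
  match split i with inl j => (hc j, false) | inr j => (hc j, true) end.

Let ec_inj : injective ec.
Proof.
move=> i j; rewrite /ec; have := splitK i; have := splitK j.
by case: (split i) (split j) => a [] b /= <- <- [] // /hc_inj ->.
Qed.

Let ec_cols : ec @: setT = cols.
Proof.
apply/setP => -[z t]; rewrite inE /= -hc_onto; apply/imsetP/imsetP => [[i _] | [j _ ->]].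
  by rewrite /ec; case: (split i) => j [-> _]; exists j.
by case: t; [exists (rshift _ j) | exists (lshift _ j)]; rewrite // /ec
  ?(unsplitK (inl _)) ?(unsplitK (inr _)).
Qed.

Let enum_E0 (a : 'I_p) : (enum_val a \in oe) && ~~ me (enum_val a).
Proof. by have := enum_valP a; rewrite inE. Qed.

Let me_path j : (j < n.*2)%N -> me (w j, w j.+1).
Proof. by move=> jn; apply/path_edgeP; exists j. Qed.

Let er_rows : er @: setT = rows.
Proof.
apply/setP => r; apply/imsetP/idP => [[i _ ->] | ].
  rewrite /er /half_edge inE; case: (split i) => j; case: (split j) => a /=.
  - by have /andP[-> h] := enum_E0 a; rewrite ?h.
  - by rewrite (path_edge_oe bp) //; have := ltn_ord a; lia.
  - by have /andP[-> h] := enum_E0 a; rewrite ?h.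
  - by rewrite (path_edge_oe bp) //; have := ltn_ord a; lia.
case: r => e s; rewrite inE /= => /andP[eo sm].
have [/path_edgeP[j jn Ee] | m] := boolP (me e).
  have -> : s = false by case: s sm => //; rewrite Ee me_path.
  have hj : (j./2 < n)%N by have := odd_double_half j; lia.
  case oj: (odd j); have := odd_double_half j; rewrite oj /= => Ej.
    exists (rshift _ (rshift p (Ordinal hj))) => //.
    rewrite /er /half_edge !(unsplitK (inr _)) /= Ee; congr (_, _, _); congr w; lia.
  exists (lshift _ (rshift p (Ordinal hj))) => //.
  rewrite /er /half_edge !(unsplitK (inl _)) !(unsplitK (inr _)) /= Ee; congr (_, _, _); congr w; lia.
have eE : e \in E0 by rewrite inE eo.
case: s sm => _.
  exists (rshift _ (lshift n (enum_rank_in eE e))) => //.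
  by rewrite /er /half_edge !(unsplitK (inr _)) !(unsplitK (inl _)) enum_rankK_in.
exists (lshift _ (lshift n (enum_rank_in eE e))) => //.
by rewrite /er /half_edge !(unsplitK (inl _)) enum_rankK_in.
Qed.

Let er_inj : injective er.
Proof.
have /imset_injP h : #|er @: setT| == #|[set: 'I_(p + n + (p + n))]|.
  by rewrite er_rows (card_rows_cols planeG bp conn) -ec_cols card_imset.
by move=> i j; apply: h; rewrite inE.
Qed.

Section Minors.
Variable R : realFieldType.

Local Notation inc := (incidence G R).

Let f1 l := (w l.*2, w l.*2.+1).
Let f2 l := (w l.*2.+1, w l.*2.+2).
Let A : 'M[R]_(p, p + n) := \matrix_(i, j) inc (enum_val i) (hc j).
Let a1 : 'M[R]_(n, p + n) := \matrix_(i < n, j < p + n) inc (f1 i) (hc j).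
Let a2 : 'M[R]_(n, p + n) := \matrix_(i < n, j < p + n) inc (f2 i) (hc j).

Let f1n (i : 'I_n) : (i.*2 < n.*2)%N. Proof. by have := ltn_ord i; lia. Qed.
Let f2n (i : 'I_n) : (i.*2.+1 < n.*2)%N. Proof. by have := ltn_ord i; lia. Qed.

Lemma glued_mx_block : (\matrix_(i, j) glued_entry G n w R (er i) (ec j)) =
  block_mx (col_mx A a1) (col_mx 0 (- a1)) (col_mx 0 a2) (col_mx A a2).
Proof.
apply/matrixP => i j; rewrite mxE /er /ec /half_edge !mxE.
case: (split i) => i'; rewrite !mxE; case: (split j) => j'; rewrite !mxE;
  case: (split i') => i2; rewrite !mxE /glued_entry /=.
- by have /andP[_ /negPf ->] := enum_E0 i2; rewrite mul1r.
- by rewrite me_path // mul1r.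
- by have /andP[_ /negPf ->] := enum_E0 i2; rewrite mul0r.
- by rewrite me_path // (path_signE R bp) // odd_double mulN1r.
- by have /andP[_ /negPf ->] := enum_E0 i2; rewrite mul0r.
- by rewrite me_path // mul1r.
- by have /andP[_ /negPf ->] := enum_E0 i2; rewrite mul1r.
- by rewrite me_path // (path_signE R bp) // /= odd_double mul1r.
Qed.

Let isV (z : V + F) := if z is inl _ then true else false.
Let Pi : 'M[R]_(p + n) := \matrix_(i, j) ((i == j) && ~~ isV (hc i))%:R.
Let h0 : 'cV[R]_(p + n) := \col_j (isV (hc j))%:R.

Let mulPi m (B : 'M[R]_(m, p + n)) i j : (B *m Pi) i j = if isV (hc j) then 0 else B i j.
Proof.
rewrite mxE (bigD1 j) //= big1 ?addr0 => [|l lj]; last by rewrite mxE (negPf lj) mulr0.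
by rewrite mxE eqxx /=; case: (isV _); rewrite ?mulr0 ?mulr1.
Qed.

Let mulPiC m (B : 'M[R]_(m, p + n)) i j : (B *m (1%:M - Pi)) i j = if isV (hc j) then B i j else 0.
Proof. by rewrite mulmxBr mulmx1 mxE [X in _ + X]mxE mulPi; case: (isV _); rewrite ?subr0 ?subrr. Qed.

Let mulPil m (B : 'M[R]_(p + n, m)) i j : (Pi *m B) i j = if isV (hc i) then 0 else B i j.
Proof.
rewrite mxE (bigD1 i) //= big1 ?addr0 => [|l li]; last by rewrite mxE eq_sym (negPf li) mul0r.
by rewrite mxE eqxx /=; case: (isV _); rewrite ?mul0r ?mul1r.
Qed.

Let sum_oe (H : V * V -> R) :
  \sum_(e in oe) H e = \sum_(i < p) H (enum_val i) + \sum_(i < n) H (f1 i) + \sum_(i < n) H (f2 i).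
Proof.
rewrite (bigID (fun e => me e)) /= (sum_path_edges bp) (sum_pairs n (fun j => H (w j, w j.+1))).
rewrite big_split /= addrC addrA; congr (_ + _ + _).
rewrite -[RHS](big_enum_val (A := mem E0) (fun e => H e)).
by apply: eq_bigl => e; rewrite [in RHS]inE.
Qed.

Let sum_h0 e : \sum_j inc e (hc j) * h0 j 0 = vertex_diff (fun x => if x \in evens then 0 else 1) e.
Proof.
transitivity (\sum_(z in half_cols) inc e z * (isV z)%:R).
  rewrite -hc_onto big_imset /=; last by move=> i j _ _; apply: hc_inj.
  by apply: eq_big => [j | j _]; rewrite ?inE // mxE.
rewrite big_sumType /= [X in _ + X]big1 ?addr0 => [|f _]; last by rewrite mulr0.
rewrite -[RHS](sum_vpart n w (fun _ : (V + F) * bool => 1) true e).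
by apply: eq_bigl => x; rewrite inE.
Qed.

(** Without the even vertices, m_{2i+1} and m_{2i+2} have opposite vertex parts. The vertices of
    degree two give the shifted identity on the faces, and the constant 1 on the remaining vertices
    has zero gradient off the path. *)
Lemma reflected_minors : \det (col_mx A a1) != 0 ->
  \det (col_mx A a1) ^+ 2 = \det (col_mx A a2) ^+ 2.
Proof.
have ev0 j : (j <= n.*2)%N -> ~~ odd j -> w j \in evens by move=> jn oj; rewrite (even_in bp).
have ev1 j : (j <= n.*2)%N -> odd j -> w j \in evens = false by move=> jn oj; rewrite (even_in bp) // oj.
apply: (reflected_minors_sqr (Pi := Pi) (h0 := h0)).
- by apply/matrixP => i j; rewrite mulPi !mxE; case: eqP => [-> | _] /=; case: (isV _).
- by apply/matrixP => i j; rewrite !mxE eq_sym; case: eqP => [-> | _].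
- apply/matrixP => i j; rewrite mulPiC [RHS]mxE mulPiC !mxE; have := hcP j.
  case: (hc j) => [x | f] /=; last by rewrite oppr0.
  rewrite inE /= => xe; rewrite /vertex_bd /=.
  have n1 l : (l <= n)%N -> (w l.*2 == x) = false.
    by move=> ln; apply: contraNF xe => /eqP <-; apply/evensP; exists l.
  by rewrite (n1 i) ?(n1 i.+1) ?ltn_ord //= 1?ltnW // sub0r subr0.
- apply/matrixP => i j; rewrite mulPiC mulPil [RHS]mxE.
  case jE: (hc j) => [x | f] //=; case iE: (hc i) => [y | f] //=.
  rewrite -[RHS](incidence_orth R planeG bp x f) sum_oe !mxE.
  by congr (_ + _ + _); apply: eq_bigr => l _; rewrite !mxE iE jE mulrC.
- apply/matrixP => i j; rewrite !mulPi; case jE: (hc j) => [x | f] //=.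
  rewrite !mxE.
  have -> : \sum_l (\matrix_(i, j) (i <= j)%:R)^T i l * a1 l j =
     \sum_(l < n) (l <= i)%:R * inc (f1 l) (inr f) by apply: eq_bigr => l _; rewrite !mxE jE.
  have -> : \sum_l ((\matrix_(i, j) (i <= j)%:R)^T - 1%:M) i l * a2 l j =
     \sum_(l < n) (l < i)%:R * inc (f2 l) (inr f).
    apply: eq_bigr => l _; rewrite !mxE jE; congr (_ * _).
    rewrite -val_eqE /=; case: (ltngtP l i) => //= _; rewrite ?subr0 ?subrr //.
  apply: (@sum_shift R n i (fun l => inc (f1 l) (inr f)) (fun l => inc (f2 l) (inr f))).
  + exact: (path_edge_bdf0 R bp f).1.
  + by move=> l ln; apply: (path_edge_bdf R planeG bp (j := l.*2.+1)); rewrite /= ?odd_double //; lia.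
- by apply/matrixP => i j; rewrite mulPil !mxE; case: (isV _).
- apply/matrixP => i j; rewrite !mxE (ord1 j); under eq_bigr do rewrite [A _ _]mxE.
  rewrite sum_h0 /vertex_diff; have /andP[eo m] := enum_E0 i.
  by have /andP[/negPf -> /negPf ->] := oe_even planeG bp eo m; rewrite subrr.
- apply/matrixP => i j; rewrite !mxE (ord1 j); under eq_bigr do rewrite [a1 _ _]mxE.
  by rewrite sum_h0 /vertex_diff /= (ev0 i.*2) ?(ev1 i.*2.+1) ?subr0 //= ?odd_double // ltnW.
- apply/matrixP => i j; rewrite !mxE (ord1 j); under eq_bigr do rewrite [a2 _ _]mxE.
  by rewrite sum_h0 /vertex_diff /= (ev0 i.*2.+2) ?(ev1 i.*2.+1) ?sub0r //= ?odd_double // ?negbK ?odd_double // ltnW.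
Qed.

(** The incidences are integers; this makes the square in the count that of a natural number. *)
Lemma minor_int : exists z : int, \det (col_mx A a1) = z%:~R.
Proof.
pose incz (e : V * V) (z : V + F) : int := match z with
  | inl x => (e.2 == x)%:Z - (e.1 == x)%:Z
  | inr f => (lface G e.1 e.2 == f)%:Z - (lface G e.2 e.1 == f)%:Z end.
have inczE e z : inc e z = (incz e z)%:~R.
  by case: z => z; rewrite /incz /incidence /vertex_bd /face_bd intrB.
pose X : 'M[int]_(p + n) := col_mx (\matrix_(i < p, j < p + n) incz (enum_val i) (hc j))
  (\matrix_(i < n, j < p + n) incz (f1 i) (hc j)).
exists (\det X); rewrite -det_map_mx map_col_mx; congr (\det (col_mx _ _));
  by apply/matrixP => i j; rewrite !mxE inczE.
Qed.

End Minors.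

Lemma matching_square : exists m (er : 'I_m -> V * V * bool) (ec : 'I_m -> (V + F) * bool),
  [/\ injective er, er @: setT = rows, injective ec, ec @: setT = cols &
    exists k, #|[set s : 'S_m | [forall i, glued_incident G n w (er (s i)) (ec i)]]| =
      (2 ^ n * k ^ 2)%N].
Proof.
exists _, er, ec; split=> //; have [z zE] := minor_int realalg; exists `|z|%N.
apply/eqP; rewrite -(eqr_nat realalg).
rewrite (matching_count realalg planeG bp conn er_inj er_rows ec_inj ec_cols).
rewrite /glued_mx glued_mx_block det_glued_block natrM !natrX normrM normrX normr_nat.
apply/eqP; congr (_ * _); have := @reflected_minors realalg.
set X := \det (col_mx _ _) in zE *; set Y := \det (col_mx _ _) => XY.
have zX : `|z|%N%:R = `|X| by rewrite zE -intr_norm natr_absz.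
(* [reflected_minors] requires [X] to be non-zero; otherwise both sides are 0. *)
rewrite zX normrM; have [-> | X0] := eqVneq X 0; first by rewrite normr0 mul0r expr0n.
have /eqP := XY X0; rewrite eqf_sqr => /orP[] /eqP ->; by rewrite ?normrN expr2.
Qed.

End CountSquare.

Local Close Scope ring_scope.

(** * Perfect matchings of bipartite graphs *)

Section BipartiteCard.
Variables (T : finType) (D : {set T}) (e : rel T) (P : {set {set T}}).
Hypothesis P_pm : perfect_matching D e P.

Lemma card_bipartite_side (C C' : {set T}) : C \subset D -> [disjoint C & C'] ->
  (forall x y, x \in D -> y \in D -> e x y ->
     (x \in C) && (y \in C') || (x \in C') && (y \in C)) -> #|C| = #|P|.
Proof.
case/andP: P_pm => /subsetP PE /forall_inP P1 CD CC' eC.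
have one x : x \in C -> 1 = \sum_(d in P) (x \in d).
  move=> /(subsetP CD)/P1/eqP <-; rewrite -sum1dep_card big_mkcondr.
  by apply: eq_bigr => d _; case: (x \in d).
rewrite -sum1_card (eq_bigr _ one) exchange_big -sum1_card; apply: eq_bigr => d /PE.
case/imset2P=> x y xD; rewrite inE => /andP[yD /(eC _ _ xD yD) exy] ->.
have [a [b [aC bC ->]]] : exists a b, [/\ a \in C, b \in C' & [set x; y] = [set a; b]].
  by case/orP: exy => /andP[hx hy]; [exists x, y | exists y, x; rewrite setUC].
rewrite (bigD1 a) //= !inE eqxx big1 // => z /andP[zC za].
by rewrite !inE (negPf za); case: eqP => // zb; have := disjointFr CC' zC; rewrite zb bC.
Qed.

Lemma card_bipartite (A B : {set T}) : D = A :|: B -> [disjoint A & B] ->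
  (forall x y, x \in D -> y \in D -> e x y ->
     (x \in A) && (y \in B) || (x \in B) && (y \in A)) -> #|A| = #|B|.
Proof.
move=> DE AB eAB; rewrite (card_bipartite_side _ AB eAB) ?DE ?subsetUl //.
rewrite (card_bipartite_side (C := B) (C' := A)) ?DE ?subsetUr 1?disjoint_sym //.
by rewrite -DE => x y xD yD /(eAB x y xD yD); rewrite orbC.
Qed.

End BipartiteCard.

Section BipartiteCount.
Variables (T : finType) (D : {set T}) (e : rel T) (m : nat) (f g : 'I_m -> T).
Variable b : 'I_m -> 'I_m -> bool.
Hypothesis f_inj : injective f.
Hypothesis g_inj : injective g.
Hypothesis fg : forall i j, f i != g j.
Hypothesis DE : D = [set f i | i : 'I_m] :|: [set g j | j : 'I_m].
Hypothesis e_bip : forall x y, x \in D -> y \in D -> e x y ->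
  exists i j, b i j /\ [set x; y] = [set f i; g j].
Hypothesis e_fg : forall i j, b i j -> e (f i) (g j).

Let pm (s : 'S_m) : {set {set T}} := [set [set f (s i); g i] | i : 'I_m].

Let in_fg i j k : (f k \in [set f i; g j]) = (k == i).
Proof. by rewrite !inE (inj_eq f_inj) (negPf (fg k j)) orbF. Qed.

Let in_gf i j k : (g k \in [set f i; g j]) = (k == j).
Proof. by rewrite !inE (inj_eq g_inj) eq_sym (negPf (fg i k)). Qed.

Let fD i : f i \in D. Proof. by rewrite DE inE imset_f. Qed.
Let gD i : g i \in D. Proof. by rewrite DE inE imset_f ?orbT. Qed.

Let pm_perfect (s : {perm 'I_m}) : (forall i, b (s i) i) -> perfect_matching D e (pm s).
Proof.
move=> sb; apply/andP; split.
  apply/subsetP => _ /imsetP[i _ ->]; apply/imset2P.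
  by exists (f (s i)) (g i); rewrite ?inE ?fD ?gD ?e_fg.
apply/forall_inP => x; rewrite DE => /setUP[] /imsetP[j _ ->]; apply/cards1P.
  exists [set f j; g (s^-1%g j)]; apply/setP => d; rewrite !inE.
  apply/andP/eqP => [[/imsetP[i _ ->]] | ->].
    by rewrite in_fg => /eqP ->; rewrite permK.
  by rewrite in_fg eqxx; split=> //; apply/imsetP; exists (s^-1%g j); rewrite ?permKV.
exists [set f (s j); g j]; apply/setP => d; rewrite !inE.
apply/andP/eqP => [[/imsetP[i _ ->]] | ->]; first by rewrite in_gf => /eqP ->.
by rewrite in_gf eqxx; split=> //; apply/imsetP; exists j.
Qed.

Let pm_inj : injective pm.
Proof.
move=> s t E; apply/permP => i.
have : [set f (s i); g i] \in pm t by rewrite -E; apply: imset_f.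
case/imsetP => j _ Ej; have := in_gf (s i) i i; have := in_fg (s i) i (s i).
by rewrite Ej in_fg in_gf !eqxx => /eqP -> /eqP ->.
Qed.

Let pm_onto P : perfect_matching D e P -> exists2 s : 'S_m, (forall i, b (s i) i) & P = pm s.
Proof.
case/andP=> /subsetP PE /forall_inP P1.
have Pfg d : d \in P -> exists i j, b i j /\ d = [set f i; g j].
  by case/PE/imset2P=> x y xD; rewrite inE => /andP[yD exy] ->; apply: e_bip.
have uniq x d d' : x \in D -> d \in P -> d' \in P -> x \in d -> x \in d' -> d = d'.
  move=> /P1/cards1P[d0 E] dP d'P xd xd'.
  have : d \in [set d in P | x \in d] by rewrite inE dP.
  have : d' \in [set d in P | x \in d] by rewrite inE d'P.
  by rewrite E !inE => /eqP -> /eqP ->.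
have sP j : {i | b i j && ([set f i; g j] \in P)}.
  apply: sigW; have /cards1P[d E] := P1 _ (gD j).
  have : d \in [set d in P | g j \in d] by rewrite E inE.
  rewrite inE => /andP[dP]; have [i [j' [bij dE]]] := Pfg d dP; rewrite dE in_gf => /eqP jj'.
  by exists i; rewrite jj' bij -dE.
have s_inj : injective (fun j => sval (sP j)).
  move=> j j'; case: (sP j) => i /= /andP[_ iP]; case: (sP j') => i' /= /andP[_ iP'] ii'; subst i'.
  have E := uniq _ _ _ (fD i) iP iP'; have := in_gf i j j.
  by rewrite E ?in_fg // in_gf eqxx => /eqP.
exists (perm s_inj) => [i | ].
  by rewrite permE; case: (sP i) => k /= /andP[].
apply/setP => d; apply/idP/imsetP => [dP | [j _ ->]]; last first.
  by rewrite permE; case: (sP j) => k /= /andP[].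
have [i [j [_ dE]]] := Pfg d dP; exists j => //; rewrite permE.
case: (sP j) => k /= /andP[_ kP]; apply: (uniq (g j)) => //; first by rewrite dE in_gf.
by rewrite in_gf.
Qed.

Lemma num_pm_bipartite : num_pm D e = #|[set s : 'S_m | [forall i, b (s i) i]]|.
Proof.
rewrite /num_pm -(card_imset _ pm_inj); congr #|pred_of_set _|; apply/setP => P.
rewrite inE; apply/idP/imsetP => [/pm_onto[s sb ->] | [s]].
  by exists s; rewrite // inE; apply/forallP.
by rewrite inE => /forallP sb ->; apply: pm_perfect.
Qed.

End BipartiteCount.

(** * Rows and columns as the vertices of the double graph *)

Section DoubledGraph.
Variables (V F : finType) (G : drawing V F) (n : nat) (w : nat -> V).
Hypothesis planeG : plane_graph G.
Hypothesis bp : boundary_path G n w.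

Local Notation ori := (path_ori n w).
Local Notation oe := (oedges G ori).
Local Notation evens := (evens n w).
Local Notation me := (path_edge n w).
Local Notation rows := (rows G n w).
Local Notation cols := (cols G n w).
Local Notation half_cols := (half_cols G n w).
Local Notation incident := (glued_incident G n w).
Local Notation K := (K_verts G n w).
Local Notation M := (m_verts F n w).
Local Notation vert := (dr_vertex V F * bool)%type.
Let oriN := path_oriN planeG bp.

Definition row_vertex (r : V * V * bool) : vert :=
  (edge_vertex F [set r.1.1; r.1.2], r.2).
Definition col_vertex (c : (V + F) * bool) : vert := (inl c.1, c.2).

Let D := double_verts K M.
Let eD := double_adj K (dr_adj G) M.

Let inlM z : (inl z \in M) = false.
Proof. by apply/imsetP => -[j _]. Qed.

Let inlK z : (inl z \in K) = (z \in half_cols).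
Proof.
rewrite !inE; case: z => [u | f].
  have -> : (inl (inl u) \in [set orig F (w i.*2) | i : 'I_n.+1]) = (u \in evens).
    by apply/imsetP/imsetP => -[i _ E]; exists i => //; [case: E | rewrite E].
  have -> : inl (inl u) \in [set orig F u | u : V] by apply/imsetP; exists u.
  by rewrite andbT.
have -> : (inl (inr f) \in [set orig F (w i.*2) | i : 'I_n.+1]) = false.
  by apply/imsetP => -[].
have -> : (inl (inr f) \in [set orig F u | u : V]) = false by apply/imsetP => -[].
have -> : (inl (inr f) \in [set edge_vertex F e | e in edges setT (adj G)]) = false.
  by apply/imsetP => -[].
rewrite orbF /=; apply/imsetP/idP => [[f'] | fo]; last by exists f; rewrite ?inE.
by rewrite inE => fo [->].
Qed.

Let inrK E : (inr E \in K) = (E \in edges [set: V] (adj G)).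
Proof.
rewrite !inE.
have -> : (inr E \in [set orig F (w i.*2) | i : 'I_n.+1]) = false by apply/imsetP => -[].
have -> : (inr E \in [set orig F u | u : V]) = false by apply/imsetP => -[].
have -> : (inr E \in [set face_vertex V f | f : F & f != outer G]) = false by apply/imsetP => -[].
by apply/imsetP/idP => [[E' ? [->]] // | EE]; exists E.
Qed.

Let rowM e : e \in oe -> (edge_vertex F [set e.1; e.2] \in M) = me e.
Proof.
move=> eo; apply/imsetP/path_edgeP => [[j _ [E]] | [j jn ->]]; last by exists (Ordinal jn).
by exists j => //; apply: (oedges_set_inj planeG oriN) => //; apply: path_edge_oe.
Qed.

Let D_in x s : ((x, s) \in D) = (x \in K) && (s ==> (x \notin M)).
Proof.
apply/imsetP/andP => [[[y t]] | [xK sM]].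
  rewrite inE /glue /= => /andP[yK _]; case yM: (y \in M) => -[-> ->];
  by rewrite yK ?yM ?implybT.
exists (x, s); first by rewrite in_setX xK inE.
rewrite /glue /=.
by case: (x \in M) sM; case: s.
Qed.

Lemma double_verts_rows_cols :
  D = [set row_vertex r | r in rows] :|: [set col_vertex c | c in cols].
Proof.
apply/setP => -[[z | E] s]; rewrite in_setU D_in ?inlK ?inrK ?inlM ?implybT ?andbT.
  have -> : ((inl z, s) \in [set row_vertex r | r in rows]) = false by apply/imsetP => -[].
  apply/idP/imsetP => [zh | [[z' s'] h [-> _]]]; last by rewrite inE in h.
  by exists (z, s); rewrite // inE.
have -> : ((inr E, s) \in [set col_vertex c | c in cols]) = false by apply/imsetP => -[].
rewrite orbF (edges_oedges planeG oriN); apply/andP/imsetP => [[/imsetP[e eo ->] sM] | [[e s'] er [-> ->]]].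
  by exists (e, s); rewrite // inE /= eo -rowM.
move: er; rewrite inE /= => /andP[eo sm]; rewrite -rowM // in sm.
by split; first by apply/imsetP; exists e.
Qed.

Lemma row_vertex_inj : {in rows &, injective row_vertex}.
Proof.
have oeP r : r \in rows -> r.1 \in oe by rewrite inE => /andP[].
move=> [e s] [e' s'] /oeP eo /oeP eo' [E ->].
by congr (_, _); apply: (oedges_set_inj planeG oriN).
Qed.

Lemma col_vertex_inj : injective col_vertex.
Proof. by move=> [z s] [z' s'] [-> ->]. Qed.

Let edge_onE e f : e \in oe ->
  edge_on G f [set e.1; e.2] = (lface G e.1 e.2 == f) || (lface G e.2 e.1 == f).
Proof.
move=> eo; have := eo; rewrite inE => /andP[ea o].
apply/existsP/idP => [[u /existsP[v /and3P[uv /eqP E /eqP <-]]] | ].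
  have [ov | ov] := boolP (ori u v).
    have -> : e = (u, v) by apply: (oedges_set_inj planeG oriN); rewrite // inE uv.
    by rewrite eqxx.
  have -> : e = (v, u).
    apply: (oedges_set_inj planeG oriN) => //=; last by rewrite E setUC.
    by rewrite inE /= (adjC planeG) uv oriN.
  by rewrite eqxx orbT.
case/orP => /eqP fe; first by exists e.1; apply/existsP; exists e.2; rewrite ea eqxx fe /=.
by exists e.2; apply/existsP; exists e.1; rewrite (adjC planeG) ea setUC eqxx fe /=.
Qed.

Let dr_incE e z : e \in oe -> z \in half_cols ->
  dr_inc G [set e.1; e.2] (inl z) = match z with
    | inl x => (e.1 == x) || (e.2 == x)
    | inr f => (lface G e.1 e.2 == f) || (lface G e.2 e.1 == f) end.
Proof.
case: z => [x | f] eo; rewrite inE /=; first by rewrite !inE ![x == _]eq_sym.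
by move=> ->; rewrite edge_onE.
Qed.

Lemma double_adj_incident r c : r \in rows -> c \in cols ->
  incident r c -> eD (row_vertex r) (col_vertex c).
Proof.
case: r => e s; case: c => z t; rewrite inE /= => /andP[eo sm]; rewrite inE /= => zh.
case/andP=> /= st inc; apply/exists_inP; exists (edge_vertex F [set e.1; e.2]).
  by rewrite inrK (edges_oedges planeG oriN); apply/imsetP; exists e.
apply/exists_inP; exists (inl z); first by rewrite inlK.
apply/existsP; exists t; rewrite /glue /= rowM // inlM eqxx andbT.
have := dr_incE eo zh; rewrite /= => ->; rewrite inc /=.
rewrite /row_vertex /=; case: ifP st sm => [_ _ | _ /= /eqP -> _ //]; by case: s.
Qed.

Lemma double_adj_bip p q : p \in D -> q \in D -> eD p q -> exists r c,
  [/\ r \in rows, c \in cols, incident r c &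
    p = row_vertex r /\ q = col_vertex c \/ p = col_vertex c /\ q = row_vertex r].
Proof.
move=> pD qD /exists_inP[x xK /exists_inP[y yK /existsP[s /and3P[xy /eqP Ep /eqP Eq]]]].
have main E z : inr E \in K -> inl z \in K -> dr_inc G E (inl z) ->
    exists r c, [/\ r \in rows, c \in cols, incident r c &
      glue M (inr E, s) = row_vertex r /\ glue M (inl z, s) = col_vertex c].
  rewrite inrK (edges_oedges planeG oriN) inlK => /imsetP[e eo ->] zh; rewrite dr_incE // => inc.
  rewrite /glue /= inlM rowM //; exists (e, if me e then false else s), (z, s).
  split; [| by rewrite inE | |].
  - by rewrite inE /= eo; case: ifP => //; rewrite implybT.
  - by rewrite /glued_incident /=; case: ifP => //=; rewrite eqxx.
  - by split=> //; case: ifP.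
case: x y xK yK xy Ep Eq => [z | E] [z' | E'] //= xK yK xy Ep Eq.
  have [r [c [rr cc i [E1 E2]]]] := main _ _ yK xK xy; exists r, c; split=> //; right.
  by rewrite Ep Eq.
have [r [c [rr cc i [E1 E2]]]] := main _ _ xK yK xy; exists r, c; split=> //; left.
by rewrite Ep Eq.
Qed.

Lemma num_pm_double m (er : 'I_m -> V * V * bool) (ec : 'I_m -> (V + F) * bool) :
  injective er -> er @: setT = rows -> injective ec -> ec @: setT = cols ->
  num_pm D eD = #|[set s : 'S_m | [forall i, incident (er (s i)) (ec i)]]|.
Proof.
move=> er_inj er_rows ec_inj ec_cols.
have erR i : er i \in rows by rewrite -er_rows imset_f.
have ecC i : ec i \in cols by rewrite -ec_cols imset_f.
apply: (@num_pm_bipartite _ D eD m (fun i => row_vertex (er i)) (fun i => col_vertex (ec i))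
  (fun i j => incident (er i) (ec j))) => //.
- by move=> i j /row_vertex_inj h; apply/er_inj/h.
- by move=> i j /col_vertex_inj/ec_inj.
- rewrite double_verts_rows_cols -er_rows -ec_cols -!imset_comp.
  by congr (_ :|: _); apply/setP => x; apply/imsetP/imsetP => -[i _ ->]; exists i.
- move=> p q pD qD /(double_adj_bip pD qD)[r [c []]]; rewrite -er_rows -ec_cols.
  case/imsetP=> i _ -> /imsetP[j _ ->] inc h; exists i, j; split=> //.
  by case: h => -[-> ->] //; rewrite setUC.
- by move=> i j; apply: double_adj_incident.
Qed.

(** By Euler's formula the columns outnumber the rows by twice the number of components minus one,
    while a perfect matching forces equality. *)
Lemma num_pm_disconnected : n_comp (adj G) predT <> 1 -> num_pm D eD = 0.
Proof.
move=> nconn; apply/eqP; rewrite cards_eq0; apply/set0Pn => -[P]; rewrite inE => PM.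
case: nconn; have : #|rows| = #|cols|.
  rewrite -(card_in_imset row_vertex_inj) -(card_imset _ col_vertex_inj).
  apply: (card_bipartite PM); first exact: double_verts_rows_cols.
    rewrite disjoint_subset; apply/subsetP => _ /imsetP[r _ ->]; rewrite inE.
    by apply/imsetP => -[].
  move=> p q pD qD /(double_adj_bip pD qD)[r [c [rr cc _ [[-> ->] | [-> ->]]]]].
    by rewrite !imset_f.
  by rewrite !imset_f ?orbT.
have := card_rows bp; have := card_cols G n w; have := card_half_cols bp.
have := plane_euler planeG; rewrite -(card_oedges planeG oriN); lia.
Qed.

End DoubledGraph.

Lemma double_count (V F : finType) (G : drawing V F) n w :
  plane_graph G -> boundary_path G n w ->
  exists k, num_pm (double_verts (K_verts G n w) (m_verts F n w))
    (double_adj (K_verts G n w) (dr_adj G) (m_verts F n w)) = 2 ^ n * k ^ 2.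
Proof.
move=> planeG bp; have [conn | nconn] := n_comp (adj G) predT =P 1; last first.
  by exists 0; rewrite num_pm_disconnected // muln0.
have [m [er [ec [er_inj er_rows ec_inj ec_cols [k kE]]]]] := matching_square planeG bp conn.
by exists k; rewrite (num_pm_double planeG bp er_inj er_rows ec_inj ec_cols).
Qed.

(** * The extended path after adding the two leaves *)

Section OuterLeaves.
Variables (V F : finType) (G0 : drawing V F) (G : drawing (V + bool)%type F).
Variables (n : nat) (v : nat -> V).
Hypothesis n_gt0 : 0 < n.
Hypothesis planeG0 : plane_graph G0.
Hypothesis v_inj : {in [pred j | 0 < j < n.*2] &, injective v}.
Hypothesis v_path : forall j, 0 < j -> j.+1 < n.*2 -> adj G0 (v j) (v j.+1).
Hypothesis v_edge_outer : forall j, 0 < j -> j.+1 < n.*2 ->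
  edge_on G0 (outer G0) [set v j; v j.+1].
Hypothesis v_degree : forall i, 0 < i < n -> degree G0 (v i.*2) = 2.
Hypothesis planeG : plane_graph G.
Hypothesis G_leaves : add_outer_leaves G0 (v 1) (v n.*2.-1) G.

Local Notation w := (ext_path n v).

Let w_inl j : 0 < j < n.*2 -> w j = inl (v j).
Proof. by move=> h; rewrite /ext_path; do 2?case: eqP => //; lia. Qed.

Let w0 : w 0 = inr false. Proof. by []. Qed.

Let wn : w n.*2 = inr true.
Proof. by rewrite /ext_path eqxx; case: eqP => //; lia. Qed.

Let end_vertex (s : bool) := if s then v n.*2.-1 else v 1.

Let leaf_adj s x : adj G (inr s) x = (x == inl (end_vertex s)).
Proof. by case: s; [exact: aol_adjr G_leaves x | exact: aol_adjl G_leaves x]. Qed.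

(** The rotation at a leaf fixes its only neighbour, so [plane_face] identifies the two sides of its
    edge. *)
Let leaf_lface s : lface G (inr s) (inl (end_vertex s)) = outer G /\
  lface G (inl (end_vertex s)) (inr s) = outer G.
Proof.
have ls : adj G (inr s) (inl (end_vertex s)) by rewrite leaf_adj.
have out : lface G (inr s) (inl (end_vertex s)) = outer G.
  rewrite (aol_outer G_leaves).
  have /orP[/existsP[x] | /andP[/eqP d0 _]] := aol_leaf G_leaves s.
    by rewrite leaf_adj => /andP[/eqP -> /eqP].
  have /eqP := d0; rewrite cards_eq0 => /eqP/setP/(_ (inl (end_vertex s))).
  by rewrite !inE ls.
split=> //; rewrite -[RHS]out -(lface_rot planeG (u := inl (end_vertex s)) (v := inr s)).
  have := rot_adj planeG ls; rewrite leaf_adj => /eqP -> //.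
by rewrite (adjC planeG).
Qed.

Let w1E : w 1 = inl (end_vertex false). Proof. by rewrite w_inl //; lia. Qed.

Let wnE : w n.*2.-1 = inl (end_vertex true). Proof. by rewrite w_inl //; lia. Qed.

Let nbrs i x : 0 < i < n -> adj G0 (v i.*2) x -> x = v i.*2.-1 \/ x = v i.*2.+1.
Proof.
move=> hi ax; have dE := v_degree hi.
have a1 : adj G0 (v i.*2) (v i.*2.-1).
  rewrite (adjC planeG0); have := @v_path i.*2.-1; rewrite prednK; last lia.
  by apply; lia.
have a2 : adj G0 (v i.*2) (v i.*2.+1) by apply: v_path; lia.
have n12 : v i.*2.-1 != v i.*2.+1.
  by apply/eqP => /v_inj; rewrite !inE; lia.
have sub : [set v i.*2.-1; v i.*2.+1] \subset [set y | adj G0 (v i.*2) y].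
  by apply/subsetP => y; rewrite !inE => /orP[] /eqP ->.
have := subset_leqif_card sub; rewrite cards2 n12 => -[_]; rewrite -/(degree _ _) dE eqxx.
by move=> /esym/subsetP/(_ x); rewrite !inE => /(_ ax)/orP[] /eqP; [left | right].
Qed.

Let w_inj : {in [pred j | j <= n.*2] &, injective w}.
Proof.
have ends j : j <= n.*2 -> ~~ (0 < j < n.*2) -> j = 0 \/ j = n.*2 by lia.
move=> i j; rewrite !inE => ilt jlt.
have [hi | /(ends _ ilt) hi] := boolP (0 < i < n.*2);
  have [hj | /(ends _ jlt) hj] := boolP (0 < j < n.*2).
- by rewrite !w_inl // => -[/v_inj]; apply.
- by rewrite w_inl //; case: hj => ->; rewrite ?wn.
- by rewrite (w_inl hj); case: hi => ->; rewrite ?wn.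
- by case: hi => ->; case: hj => ->; rewrite ?wn.
Qed.

Lemma ext_boundary_path : boundary_path G n w.
Proof.
split=> //.
- move=> j jn; have [-> | j0] := eqVneq j 0; first by rewrite w0 w1E leaf_adj.
  have [jE | jn'] := eqVneq j.+1 n.*2.
    have -> : j = n.*2.-1 by lia.
    by rewrite prednK ?double_gt0 // wn wnE (adjC planeG) leaf_adj.
  by rewrite !w_inl ?(aol_adj G_leaves) ?v_path; lia.
- move=> i u ilen; have [-> | i0] := eqVneq i 0.
    by rewrite w0 leaf_adj => /eqP ->; right; rewrite w1E.
  have [-> | iN] := eqVneq i n.
    by rewrite wn leaf_adj => /eqP ->; left; rewrite wnE.
  have hi : 0 < i < n by lia.
  rewrite w_inl; last lia.
  case: u => [u | s].
    rewrite (aol_adj G_leaves) => /(nbrs hi)[] ->; [left | right]; (split; first lia); rewrite w_inl //; lia.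
  rewrite (adjC planeG) leaf_adj => /eqP[] E.
  (* The leaves hang at vertices of odd index, against the parity of [i.*2]. *)
  have : i.*2 = (if s then n.*2.-1 else 1).
    by apply: v_inj; rewrite ?inE ?E /end_vertex; case: s {E} => //; lia.
  by case: s {E}; lia.
- move=> j jn; have [-> | j0] := eqVneq j 0.
    by left; rewrite w0 w1E (leaf_lface false).1.
  have [jE | jn'] := eqVneq j.+1 n.*2.
    have -> : j = n.*2.-1 by lia.
    by left; rewrite prednK ?double_gt0 // wn wnE (leaf_lface true).2.
  rewrite !w_inl; [|lia|lia].
  have hj : j.+1 < n.*2 by lia.
  have jpos : 0 < j by lia.
  have aj := v_path jpos hj.
  have /existsP[a /existsP[b /and3P[ab /eqP E /eqP o]]] := v_edge_outer jpos hj.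
  have aj' : adj G0 (v j.+1) (v j) by rewrite (adjC planeG0).
  rewrite (aol_lface G_leaves aj) (aol_lface G_leaves aj') (aol_outer G_leaves) -o.
  have nab := adj_neq planeG0 ab.
  have ia : a \in [set v j; v j.+1] by rewrite E set21.
  have ib : b \in [set v j; v j.+1] by rewrite E set22.
  move: ia ib nab; rewrite !inE => /orP[] /eqP -> /orP[] /eqP ->; rewrite ?eqxx //; by [left | right].
- by rewrite w0 w1E (leaf_lface false).1 (leaf_lface false).2.
- by rewrite wn wnE (leaf_lface true).1 (leaf_lface true).2.
Qed.

End OuterLeaves.

Theorem theorem2p2 (V F : finType) (G0 : drawing V F)
    (G : drawing (V + bool)%type F) (n : nat) (v : nat -> V)
    (n_gt0 : 0 < n)
    (planeG0 : plane_graph G0)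
    (v_inj : {in [pred j | 0 < j < n.*2] &, injective v})
    (v_path : forall j, 0 < j -> j.+1 < n.*2 -> adj G0 (v j) (v j.+1))
    (v_outer : forall j, 0 < j < n.*2 -> vertex_on G0 (outer G0) (v j))
    (v_edge_outer : forall j, 0 < j -> j.+1 < n.*2 ->
       edge_on G0 (outer G0) [set v j; v j.+1])
    (v_degree : forall i, 0 < i < n -> degree G0 (v i.*2) = 2)
    (planeG : plane_graph G)
    (G_leaves : add_outer_leaves G0 (v 1) (v n.*2.-1) G)
    (G_no_inner_leaf : no_inner_leaf G) :
  let w := ext_path n v in
  let K := K_verts G n w in
  let M := m_verts F n w in
  let MGbar := num_pm (double_verts K M) (double_adj K (dr_adj G) M) in
  exists k, MGbar = k ^ 2 \/ MGbar = 2 * k ^ 2.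
Proof.
move=> w K M; cbv zeta.
have bp := ext_boundary_path n_gt0 planeG0 v_inj v_path v_edge_outer v_degree planeG G_leaves.
have [k ->] := double_count planeG bp; exists (2 ^ n./2 * k).
(* [2 ^ n] is the square of [2 ^ n./2], times 2 when [n] is odd. *)
rewrite -{1 3}[n]odd_double_half expnMn -expnM muln2; case: (odd n); [right | left] => //.
by rewrite add1n expnS mulnA.
Qed.
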